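(* Let $J\in\mathbb{C}^{2\times2}$ be unitary and let $G$ be the associated Green's function (defined in the context). Let $\alpha_0\in(0,\frac{\pi}{2})$, let $\Omega\subseteq\mathbb{C}$ be an open set containing the double sector $S_{\alpha_0}\cup(-S_{\alpha_0})$, where $S_{\alpha_0}=\{re^{i\theta}: r\geq0,\ 0\leq\theta\leq\alpha_0\}$, and let $F:\Omega\to\mathbb{C}$ be holomorphic and satisfy, for some $A,B\geq0$, $$|F(z)|\leq A\,e^{B|\operatorname{Im}(z)|},\qquad z\in S_{\alpha_0}\cup(-S_{\alpha_0}).$$ Then for all $t>0$ and $x\in\mathbb{R}\setminus\{0\}$ the function $$\Psi(t,x;F)=\int_{\mathbb{R}}G(t,x,y)F(y)\,dy$$ exists as an improper Riemann integral of the form $$\int_{\mathbb{R}}G(t,x,y)F(y)\,dy:=\lim_{R_1\to\infty}\int_{-R_1}^0G(t,x,y)F(y)\,dy+\lim_{R_2\to\infty}\int_0^{R_2}G(t,x,y)F(y)\,dy,$$ and $\Psi(t,x)=\Psi(t,x;F)$ is a solution of the Schrödinger equation with generalized point interaction, i.e. $$i\frac{\partial}{\partial t}\Psi(t,x)=-\frac{\partial^2}{\partial x^2}\Psi(t,x),\qquad t>0,\ x\in\mathbb{R}\setminus\{0\},$$ $$(I-J)\begin{pmatrix}\Psi(t,0^+)\\ \Psi(t,0^-)\end{pmatrix}=i(I+J)\begin{pmatrix}\frac{\partial}{\partial x}\Psi(t,0^+)\\ -\frac{\partial}{\partial x}\Psi(t,0^-)\end{pmatrix},\qquad t>0,$$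 $$\Psi(0^+,x)=F(x),\qquad x\in\mathbb{R}\setminus\{0\}.$$
   Context: Conventions: $I$ is the $2\times2$ identity matrix; for $t>0$, $\sqrt{it}=e^{i\pi/4}\sqrt t$ and $\sqrt{i\pi t}=e^{i\pi/4}\sqrt{\pi t}$ (principal branch); $\Theta(x)=1$ for $x>0$ and $\Theta(x)=0$ for $x<0$; $\Psi(t,0^\pm)$, $\frac{\partial}{\partial x}\Psi(t,0^\pm)$ denote one-sided limits as $x\to0^\pm$ and $\Psi(0^+,x)=\lim_{t\to0^+}\Psi(t,x)$ (pointwise in $x$). The entire function $\Lambda$ is $\Lambda(z)=e^{z^2}(1-\operatorname{erf}(z))$, where $\operatorname{erf}(z)=\frac{2}{\sqrt\pi}\int_0^z e^{-\xi^2}d\xi$. Coefficients. Every unitary $J\in\mathbb{C}^{2\times2}$ has the form $J=e^{i\phi}\begin{pmatrix}\alpha&-\bar\beta\\ \beta&\bar\alpha\end{pmatrix}$ with $\phi\in[0,\pi)$, $\alpha,\beta\in\mathbb{C}$ and $|\alpha|^2+|\beta|^2=1$. For $x,y\in\mathbb{R}\setminus\{0\}$ put $\eta^{(x,y)}=0$ if $|\operatorname{Re}(\alpha)|=1$, and if $|\operatorname{Re}(\alpha)|\neq1$ put $$\eta^{(x,y)}=\frac{1}{\sqrt{1-\operatorname{Re}(\alpha)^2}}\cdot\begin{cases}-\operatorname{Im}(\alpha),&x,y>0,\\ -i\bar\beta,&x>0,\,y<0,\\ i\beta,&x<0,\,y>0,\\ \operatorname{Im}(\alpha),&x,y<0.\end{cases}$$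 Case I: if $\operatorname{Re}(\alpha)\neq-\cos(\phi)$, then $\omega_\pm=\frac{-\sin(\phi)\pm\sqrt{1-\operatorname{Re}(\alpha)^2}}{\cos(\phi)+\operatorname{Re}(\alpha)}$, $\mu_\pm^{(x,y)}=-\frac{\omega_\pm}{2}\big(\Theta(xy)\pm\eta^{(x,y)}\big)$, $\mu_0^{(x,y)}=\operatorname{sgn}(xy)$. Case II: if $\operatorname{Re}(\alpha)=-\cos(\phi)\neq-1$, then $\omega_-=\mu_-^{(x,y)}=0$, $\omega_+=\cot(\phi)$, $\mu_+^{(x,y)}=-\frac{\omega_+}{2}\big(\Theta(xy)+\eta^{(x,y)}\big)$, $\mu_0^{(x,y)}=\eta^{(x,y)}-\Theta(-xy)$. Case III: if $\operatorname{Re}(\alpha)=-\cos(\phi)=-1$, then $\omega_\pm=\mu_\pm^{(x,y)}=0$ and $\mu_0^{(x,y)}=-1$. Green's function: for $t>0$, $x,y\in\mathbb{R}\setminus\{0\}$, $$G(t,x,y)=\Big(\mu_+^{(x,y)}\Lambda\Big(\tfrac{|x|+|y|}{2\sqrt{it}}+\omega_+\sqrt{it}\Big)+\mu_-^{(x,y)}\Lambda\Big(\tfrac{|x|+|y|}{2\sqrt{it}}+\omega_-\sqrt{it}\Big)\Big)e^{-\frac{(|x|+|y|)^2}{4it}}+\frac{1}{2\sqrt{i\pi t}}\Big(\mu_0^{(x,y)}e^{-\frac{(|x|+|y|)^2}{4it}}+e^{-\frac{(x-y)^2}{4it}}\Big).$$ *)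

(* Defs.v *)
From Stdlib Require Import Reals Lra.
From Coquelicot Require Export Coquelicot.

Open Scope R_scope.
Open Scope C_scope.

(** * Complex functions *)

Definition cexp (z : C) : C := (exp (Re z) * (cos (Im z), sin (Im z)))%C.

(** [csqrt_i t] is the principal square root of [i t], for [t > 0]. *)
Definition csqrt_i (t : R) : C := cexp (Ci * (PI / 4)) * sqrt t.

(** The integral from [0] to [z] is taken along the segment [s |-> s z]. *)
Definition cerf (z : C) : C :=
  2 / sqrt PI *
  RInt (V := C_R_CompleteNormedModule) (fun s : R => cexp (- (s * z) ^ 2) * z) 0 1.

Definition Lambda (z : C) : C := cexp (z ^ 2) * (1 - cerf z).

Definition sector (a : R) (z : C) : Prop :=
  exists r theta : R,
    (0 <= r)%R /\ (0 <= theta <= a)%R /\ z = r * cexp (Ci * theta).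

Definition double_sector (a : R) (z : C) : Prop := sector a z \/ sector a (- z).

Definition holomorphic_on (Omega : C -> Prop) (F : C -> C) : Prop :=
  forall z : C, Omega z -> ex_derive (K := C_AbsRing) (V := C_NormedModule) F z.

(** * Matrices *)

Definition mat2 (a b c d : C) : @matrix C 2 2 := [[a, b], [c, d]].

Definition col2 (a b : C) : @matrix C 2 1 := [[a], [b]].

Definition Mscal {m n : nat} (c : C) (M : @matrix C m n) : @matrix C m n :=
  mk_matrix m n (fun i j => c * coeff_mat (RtoC 0) M i j).

Definition Madjoint {m n : nat} (M : @matrix C m n) : @matrix C n m :=
  mk_matrix n m (fun i j => Cconj (coeff_mat (RtoC 0) M j i)).

Definition unitary (J : @matrix C 2 2) : Prop :=
  Mmult (Madjoint J) J = Mone /\ Mmult J (Madjoint J) = Mone.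

Definition J_params (J : @matrix C 2 2) (phi : R) (alpha beta : C) : Prop :=
  (0 <= phi < PI)%R /\
  (Cmod alpha ^ 2 + Cmod beta ^ 2 = 1)%R /\
  J = Mscal (cexp (Ci * phi)) (mat2 alpha (- Cconj beta) beta (Cconj alpha)).

(** * The Green's function *)

Definition Theta (x : R) : R := if Rlt_dec 0 x then 1%R else 0%R.

(** The four sign cases are those of [x, y <> 0]; on the axes the value is
    irrelevant, being hit at most at the end point [y = 0] of an integral. *)
Definition eta (alpha beta : C) (x y : R) : C :=
  if Req_dec_T (Rabs (Re alpha)) 1 then 0
  else / sqrt (1 - Re alpha ^ 2) *
    (if Rlt_dec 0 x
     then if Rlt_dec 0 y then - Im alpha else - Ci * Cconj beta
     else if Rlt_dec 0 y then Ci * beta else Im alpha).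

(** Case I: [Re alpha <> - cos phi];  case II: [Re alpha = - cos phi <> -1];
    case III: [Re alpha = - cos phi = -1]. *)
Definition by_case {T : Type} (phi : R) (alpha : C) (c1 c2 c3 : T) : T :=
  if Req_dec_T (Re alpha) (- cos phi)
  then if Req_dec_T (Re alpha) (-1) then c3 else c2
  else c1.

Definition omega_plus (phi : R) (alpha : C) : R :=
  by_case phi alpha
    ((- sin phi + sqrt (1 - Re alpha ^ 2)) / (cos phi + Re alpha))%R
    (cos phi / sin phi)%R
    0%R.

Definition omega_minus (phi : R) (alpha : C) : R :=
  by_case phi alpha
    ((- sin phi - sqrt (1 - Re alpha ^ 2)) / (cos phi + Re alpha))%R
    0%R
    0%R.

Definition mu_plus (phi : R) (alpha beta : C) (x y : R) : C :=
  by_case phi alpha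
    (- (omega_plus phi alpha / 2) * (Theta (x * y) + eta alpha beta x y))
    (- (omega_plus phi alpha / 2) * (Theta (x * y) + eta alpha beta x y))
    (RtoC 0).

Definition mu_minus (phi : R) (alpha beta : C) (x y : R) : C :=
  by_case phi alpha
    (- (omega_minus phi alpha / 2) * (Theta (x * y) - eta alpha beta x y))
    (RtoC 0)
    (RtoC 0).

Definition mu_zero (phi : R) (alpha beta : C) (x y : R) : C :=
  by_case phi alpha
    (RtoC (sign (x * y)))
    (eta alpha beta x y - Theta (- (x * y)))
    (RtoC (-1)).

Definition green (phi : R) (alpha beta : C) (t x y : R) : C :=
  let r : R := (Rabs x + Rabs y)%R in
  let s : C := csqrt_i t in
  (mu_plus phi alpha beta x y * Lambda (r / (2 * s) + omega_plus phi alpha * s) +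
   mu_minus phi alpha beta x y * Lambda (r / (2 * s) + omega_minus phi alpha * s)) *
    cexp (- (r ^ 2 / (4 * Ci * t))) +
  / (2 * csqrt_i (PI * t)) *
    (mu_zero phi alpha beta x y * cexp (- (r ^ 2 / (4 * Ci * t))) +
     cexp (- ((x - y) ^ 2 / (4 * Ci * t)))).

(** * Improper Riemann integrals over the real line, split at [0] *)

Definition ex_improper_RInt (f : R -> C) : Prop :=
  ex_RInt_gen (V := C_R_NormedModule) f (Rbar_locally m_infty) (at_point 0) /\
  ex_RInt_gen (V := C_R_NormedModule) f (at_point 0) (Rbar_locally p_infty).

Definition improper_RInt (f : R -> C) : C :=
  RInt_gen (V := C_R_CompleteNormedModule) f (Rbar_locally m_infty) (at_point 0) +
  RInt_gen (V := C_R_CompleteNormedModule) f (at_point 0) (Rbar_locally p_infty).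

Definition Psi (phi : R) (alpha beta : C) (F : C -> C) (t x : R) : C :=
  improper_RInt (fun y : R => green phi alpha beta t x y * F (RtoC y)).

(** * The Schrödinger equation with generalized point interaction *)

Definition is_derive_RC (f : R -> C) (x : R) (l : C) : Prop :=
  is_derive (K := R_AbsRing) (V := C_R_NormedModule) f x l.

Definition tends_to (f : R -> C) (G : (R -> Prop) -> Prop) (l : C) : Prop :=
  filterlim (U := C_UniformSpace) f G (locally (T := C_UniformSpace) l).

Definition schrodinger_point_interaction
    (J : @matrix C 2 2) (f : R -> C) (u : R -> R -> C) : Prop :=
  exists u_t u_x u_xx : R -> R -> C,
    (forall t x : R, (0 < t)%R -> x <> 0%R ->
       is_derive_RC (fun s => u s x) t (u_t t x) /\
       is_derive_RC (u t) x (u_x t x) /\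
       is_derive_RC (u_x t) x (u_xx t x) /\
       Ci * u_t t x = - u_xx t x) /\
    (forall t : R, (0 < t)%R ->
       exists up um dup dum : C,
         tends_to (u t) (at_right 0) up /\
         tends_to (u t) (at_left 0) um /\
         tends_to (u_x t) (at_right 0) dup /\
         tends_to (u_x t) (at_left 0) dum /\
         Mmult (minus Mone J) (col2 up um) =
         Mmult (Mscal Ci (plus Mone J)) (col2 dup (- dum))) /\
    (forall x : R, x <> 0%R ->
       tends_to (fun t => u t x) (at_right 0) (f x)).

(** * Every unitary matrix admits parameters *)

Lemma circle_angle (u v : R) :
  (u ^ 2 + v ^ 2 = 1)%R ->
  exists th : R, (0 <= th < 2 * PI)%R /\ cos th = u /\ sin th = v.
Proof.
intros H.
assert (Hu : (-1 <= u <= 1)%R) by (split; nra).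
pose proof (acos_bound u) as Hb.
pose proof PI_RGT_0 as Hpi.
assert (Hs : sin (acos u) = sqrt (v ^ 2)).
{ rewrite sin_acos by lra. unfold Rsqr. f_equal. lra. }
destruct (Rle_dec 0 v) as [Hv | Hv].
- exists (acos u). rewrite cos_acos by lra.
  rewrite Hs, sqrt_pow2 by lra. split; [lra | auto].
- exists (2 * PI - acos u)%R.
  assert (Hs' : sin (acos u) = (- v)%R).
  { rewrite Hs. replace (v ^ 2)%R with ((- v) ^ 2)%R by ring.
    apply sqrt_pow2; lra. }
  assert (Hne : acos u <> 0%R).
  { intros E. rewrite E, sin_0 in Hs'. lra. }
  rewrite cos_minus, sin_minus, cos_2PI, sin_2PI, cos_acos, Hs' by lra.
  split; [lra | split; ring].
Qed.

Lemma J_params_exist (J : @matrix C 2 2) :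
  unitary J -> exists (phi : R) (alpha beta : C), J_params J phi alpha beta.
Proof.
destruct J as [[a [b []]] [[c [d []]] []]].
intros [H _].
assert (E : forall i j, coeff_mat (RtoC 0)
    (Mmult (T := C_Ring) (Madjoint (mat2 a b c d)) (mat2 a b c d)) i j =
    coeff_mat (RtoC 0) (@Mone C_Ring 2) i j).
{ intros i j. exact (f_equal (fun M => coeff_mat (RtoC 0) M i j) H). }
pose proof (E 0%nat 0%nat) as E00. pose proof (E 0%nat 1%nat) as E01.
pose proof (E 1%nat 1%nat) as E11.
clear E H.
unfold Mmult, Madjoint, mat2, coeff_mat in E00, E01, E11; cbn in E00, E01, E11.
set (delta := a * d - b * c).
assert (Hd : d = delta * Cconj a).
{ transitivity (d * (Cconj a * a + (Cconj c * c + 0)) -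
                c * (Cconj a * b + (Cconj c * d + 0))).
  - rewrite E00, E01. ring.
  - unfold delta. ring. }
assert (Hb : b = - (delta * Cconj c)).
{ transitivity (b * (Cconj a * a + (Cconj c * c + 0)) -
                a * (Cconj a * b + (Cconj c * d + 0))).
  - rewrite E00, E01. ring.
  - unfold delta. ring. }
assert (Hdelta : Cconj delta * delta = 1).
{ rewrite <- E11, Hd, Hb.
  rewrite Copp_conj, !Cmult_conj, !Cconj_conj.
  transitivity (Cconj delta * delta * (Cconj a * a + (Cconj c * c + 0))).
  - rewrite E00. ring.
  - ring. }
destruct delta as [u v].
assert (Huv : (u ^ 2 + v ^ 2 = 1)%R).
{ apply (f_equal fst) in Hdelta. cbn in Hdelta. cbn. lra. }
destruct (circle_angle u v Huv) as (th & Hth & Hcos & Hsin).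
assert (Hsum : (fst a ^ 2 + snd a ^ 2 + fst c ^ 2 + snd c ^ 2 = 1)%R).
{ apply (f_equal fst) in E00. cbn in E00. cbn. lra. }
set (e := cexp (Ci * (th / 2)%R)).
assert (He : e = (cos (th / 2), sin (th / 2))).
{ unfold e, cexp, Ci, RtoC, Cmult, Re, Im; cbn [fst snd].
  replace (0 * (th / 2) - 1 * 0)%R with 0%R by ring.
  replace (0 * 0 + 1 * (th / 2))%R with (th / 2)%R by ring.
  rewrite exp_0. f_equal; ring. }
assert (He1 : e * Cconj e = 1).
{ rewrite He. pose proof (sin2_cos2 (th / 2)) as Hsc. unfold Rsqr in Hsc.
  unfold Cmult, Cconj, RtoC; cbn [fst snd]. f_equal; lra. }
assert (He2 : e * e = (u, v)).
{ rewrite He, <- Hcos, <- Hsin.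
  replace (cos th) with (cos (2 * (th / 2))) by (f_equal; field).
  replace (sin th) with (sin (2 * (th / 2))) by (f_equal; field).
  rewrite cos_2a, sin_2a. unfold Cmult; cbn [fst snd]. f_equal; ring. }
exists (th / 2)%R, (Cconj e * a), (Cconj e * c). unfold J_params.
split; [lra |]. split.
- assert (Hm : Cmod (Cconj e) = 1%R).
  { rewrite Cmod_conj, He. unfold Cmod; cbn [fst snd].
    pose proof (sin2_cos2 (th / 2)) as Hsc. unfold Rsqr in Hsc.
    replace (_ + _)%R with 1%R by (cbn; lra). apply sqrt_1. }
  rewrite !Cmod_mult, Hm, !Rmult_1_l, !Cmod2_alt. unfold Re, Im. lra.
- fold e. unfold Mscal, mat2, coeff_mat, mk_matrix; cbn.
  rewrite !Cmult_conj, !Cconj_conj.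
  rewrite <- He2 in Hd, Hb.
  replace (e * (Cconj e * a)) with a
    by (transitivity (e * Cconj e * a); [rewrite He1 |]; ring).
  replace (e * (Cconj e * c)) with c
    by (transitivity (e * Cconj e * c); [rewrite He1 |]; ring).
  replace (e * - (e * Cconj c)) with b by (rewrite Hb; ring).
  replace (e * (e * Cconj a)) with d by (rewrite Hd; ring).
  reflexivity.
Qed.

(* Main.v *)
Require Import Defs.
From Stdlib Require Import Reals Lra Lia Psatz ClassicalEpsilon.
From Coquelicot Require Import Coquelicot.

(** Write [k(t,r) = e^(i r^2 / 4t) / (2 sqrt(i pi t))] and
    [E_w(t,r) = Lambda(r / (2 sqrt(it)) + w sqrt(it)) e^(i r^2 / 4t)].  Then
    [E_w] and [k] solve the free Schrödinger equation in [r], with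
    [d/dr E_w = w E_w - 2 k], and [G(t,x,y)] is [k(t,x-y)] plus a combination of
    [E_(w+)], [E_(w-)] and [k] at [r = |x| + |y|] whose coefficients depend only
    on the signs of [x] and [y].

    For [y > 0], Cauchy's theorem (through Goursat's lemma, as [F] is only
    assumed differentiable) turns the oscillatory integrals into absolutely
    convergent ones along the ray [y = s e^(ia)], [a = alpha0], where the kernels
    decay like a Gaussian while [F] grows at most exponentially.  The new
    integrals are smooth in [t > 0] and in [x] up to and across [0], which gives
    the equation and the one-sided limits.  The boundary condition becomes an
    identity between coefficients: the columns of [Theta +- eta] are eigenvectors
    of [J].  As [t -> 0+], every term at [r = |x| + |y|] is [O(sqrt t)]; the
    integral of [k(t,x-y) F(y)] is cut at [y = x], and each of the two parts,
    after rotating the contour about [x], tends to [F(x) / 2].  The part over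
    [[0,x]] is pushed into a thin tube around the segment contained in
    [Omega]. *)

Local Open Scope C_scope.

(** * Complex-valued functions of a real variable *)

(** On the real axis [|k|] does not depend on [r] and [F] is merely bounded, so the integrals of
    [k F] converge only by oscillation and cannot be dominated, neither for differentiation under
    the integral nor for [t -> 0+]. Hence [Psi] is identified once with integrals over the rotated
    ray ([wave]), and the later estimates take place there. Only [y] is rotated: [x] stays real and
    may have either sign, so that the one-sided limits at [0] are plain values of smooth functions.
    The negative half line is reflected onto the positive one by [signed], which is what the double
    sector is for. Rotating [[x, oo)] about [x > 0] stays in the sector, which is stable under
    positive translations. Rotating [[0, x]] about [x] leaves it: the points [x - s e^(ia)] lie
    below the axis, where only the openness of [Omega] helps, so a short piece of that ray, closed
    by a chord, has to do. The rate [O(sqrt t)] has a single source: an amplitude [1 / sqrt t]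
    against a decay rate of order [1 / t]. *)

Notation CV := C_R_CompleteNormedModule.
Notation CInt := (RInt (V := C_R_CompleteNormedModule)).
Notation is_CInt := (is_RInt (V := C_R_NormedModule)).
Notation ex_CInt := (ex_RInt (V := C_R_NormedModule)).
Notation ccont := (continuous (T := R_UniformSpace) (U := C_UniformSpace)).

Ltac derive_eq H :=
  match type of H with _ ?f ?x ?l => match goal with |- _ ?g ?y ?m => replace m with l; [exact H |] end end.

Ltac ceq := match goal with |- @eq _ ?a ?b => change (@eq C a b) end.

Lemma is_derive_RC_split (f : R -> C) (x : R) (l : C) :
  is_derive_RC f x l <->
  is_derive (fun y => Re (f y)) x (Re l) /\ is_derive (fun y => Im (f y)) x (Im l).
Proof.
split.
- intros H. split.
  + unfold is_derive_RC, is_derive in *.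
    eapply filterdiff_ext_lin.
    * apply (filterdiff_comp f (fun z : prod_NormedModule R_AbsRing R_NormedModule R_NormedModule => fst z) _ (fun z => fst z) H).
      apply filterdiff_linear, is_linear_fst.
    * reflexivity.
  + unfold is_derive_RC, is_derive in *.
    eapply filterdiff_ext_lin.
    * apply (filterdiff_comp f (fun z : prod_NormedModule R_AbsRing R_NormedModule R_NormedModule => snd z) _ (fun z => snd z) H).
      apply filterdiff_linear, is_linear_snd.
    * reflexivity.
- intros [H1 H2]. unfold is_derive_RC, is_derive in *.
  apply filterdiff_ext with (f := fun y => (Re (f y), Im (f y))).
  { intros y. now destruct (f y). }
  eapply filterdiff_ext_lin.
  + apply (filterdiff_comp_2 (fun y => Re (f y)) (fun y => Im (f y)) (fun u v => (u, v) : C_R_NormedModule) _ _ (fun u v => (u, v)) H1 H2).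
    apply filterdiff_ext with (f := fun z : prod_NormedModule R_AbsRing R_NormedModule R_NormedModule => z).
    { now intros []. }
    apply filterdiff_ext_lin with (l1 := fun z => z); [apply filterdiff_id | now intros []].
  + reflexivity.
Qed.

Lemma is_derive_RC_eps (f : R -> C) (x : R) (l : C) :
  is_derive_RC f x l <->
  forall eps : posreal, exists d : posreal, forall y : R,
    (Rabs (y - x) < d -> Cmod (f y - f x - (y - x)%R * l) <= eps * Rabs (y - x))%R.
Proof.
assert (E : forall y, norm (minus (minus (f y) (f x)) (scal (minus y x) l) : C_R_NormedModule)
                    = Cmod (f y - f x - (y - x)%R * l)).
{ intros y. rewrite <- Cmod_norm. f_equal.
  apply injective_projections; unfold minus, plus, opp, scal; simpl;
    unfold scal; simpl; unfold mult; simpl; ring. }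
split.
- intros [_ H] eps. specialize (H x (fun P HP => HP) eps).
  destruct H as [d Hd]. exists d. intros y Hy. rewrite <- E. exact (Hd y Hy).
- intros H; split; [apply is_linear_scal_l |].
  intros y Hy.
  apply (is_filter_lim_locally_unique (K := R_AbsRing) (V := R_NormedModule) x y) in Hy.
  subst y. intros eps. destruct (H eps) as [d Hd]. exists d.
  intros y Hy. apply Rle_trans with (2 := Hd y Hy). right. apply E.
Qed.

Definition is_derive_C (f : C -> C) (z l : C) : Prop :=
  is_derive (K := C_AbsRing) (V := C_NormedModule) f z l.

Lemma is_derive_C_eps (f : C -> C) (x l : C) :
  is_derive_C f x l <->
  forall eps : posreal, exists d : posreal, forall y : C,
    (Cmod (y - x) < d -> Cmod (f y - f x - (y - x) * l) <= eps * Cmod (y - x))%R.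
Proof.
split.
- intros [_ H] eps. specialize (H x (fun P HP => HP) eps).
  destruct H as [d Hd]. exists d. exact Hd.
- intros H; split; [apply is_linear_scal_l |].
  intros y Hy.
  apply (is_filter_lim_locally_unique (K := C_AbsRing) (V := AbsRing_NormedModule C_AbsRing) x y) in Hy.
  subst y. intros eps. destruct (H eps) as [d Hd]. exists d. exact Hd.
Qed.

(** Coquelicot's rules for products and compositions are stated for functions
    valued in [AbsRing_NormedModule C_AbsRing]. *)
Lemma is_derive_C_AbsRing (f : C -> C) (x l : C) :
  is_derive_C f x l <->
  is_derive (K := C_AbsRing) (V := AbsRing_NormedModule C_AbsRing) f x l.
Proof.
rewrite is_derive_C_eps. split.
- intros H; split; [apply is_linear_scal_l |].
  intros y Hy.
  apply (is_filter_lim_locally_unique (K := C_AbsRing) (V := AbsRing_NormedModule C_AbsRing) x y) in Hy.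
  subst y. intros eps. destruct (H eps) as [d Hd]. exists d. exact Hd.
- intros [_ H] eps. specialize (H x (fun P HP => HP) eps).
  destruct H as [d Hd]. exists d. exact Hd.
Qed.

Lemma is_derive_C_const (c x : C) : is_derive_C (fun _ => c) x 0.
Proof. exact (is_derive_const (K := C_AbsRing) (V := C_NormedModule) c x). Qed.

Lemma is_derive_C_id (x : C) : is_derive_C (fun z => z) x 1.
Proof. apply is_derive_C_AbsRing. exact (is_derive_id (K := C_AbsRing) x). Qed.

Lemma is_derive_C_plus (f g : C -> C) (x l m : C) :
  is_derive_C f x l -> is_derive_C g x m -> is_derive_C (fun z => f z + g z) x (l + m).
Proof. exact (is_derive_plus (K := C_AbsRing) (V := C_NormedModule) f g x l m). Qed.

Lemma is_derive_C_mult (f g : C -> C) (x l m : C) :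
  is_derive_C f x l -> is_derive_C g x m ->
  is_derive_C (fun z => f z * g z) x (l * g x + f x * m).
Proof.
rewrite !is_derive_C_AbsRing. intros H1 H2.
exact (is_derive_mult (K := C_AbsRing) f g x l m H1 H2 Cmult_comm).
Qed.

Lemma is_derive_C_comp (f g : C -> C) (x l m : C) :
  is_derive_C f (g x) l -> is_derive_C g x m ->
  is_derive_C (fun z => f (g z)) x (m * l).
Proof.
rewrite !is_derive_C_AbsRing. intros H1 H2.
exact (is_derive_comp (K := C_AbsRing) (V := AbsRing_NormedModule C_AbsRing) f g x l m H1 H2).
Qed.

Lemma is_derive_C_affine (a b x : C) : is_derive_C (fun z => a + b * z) x b.
Proof.
pose proof (is_derive_C_plus (fun _ => a) (fun z => b * z) x 0 (0 * x + b * 1)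
  (is_derive_C_const a x)
  (is_derive_C_mult (fun _ => b) (fun z => z) x 0 1
     (is_derive_C_const b x) (is_derive_C_id x))) as H.
replace (0 + (0 * x + b * 1)) with b in H by ring. exact H.
Qed.

Lemma ccont_split (f : R -> C) (x : R) :
  ccont f x <->
  continuous (fun y => Re (f y)) x /\ continuous (fun y => Im (f y)) x.
Proof.
split.
- intros H. split.
  + apply (continuous_comp f fst); [exact H | apply continuous_fst].
  + apply (continuous_comp f snd); [exact H | apply continuous_snd].
- intros [H1 H2].
  apply continuous_ext with (f := fun y => (Re (f y), Im (f y))).
  { intros y. now destruct (f y). }
  apply (continuous_comp_2 (fun y => Re (f y)) (fun y => Im (f y)) (fun u v => (u, v))); auto.
  apply continuous_ext with (f := fun z : R * R => z); [now intros [] | apply continuous_id].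
Qed.

Lemma ccont_const (c : C) (x : R) : ccont (fun _ => c) x.
Proof. apply continuous_const. Qed.

Lemma ccont_plus (f g : R -> C) (x : R) :
  ccont f x -> ccont g x -> ccont (fun y => f y + g y) x.
Proof.
rewrite !ccont_split. intros [H1 H2] [H3 H4]. split; simpl.
- exact (continuous_plus _ _ x H1 H3).
- exact (continuous_plus _ _ x H2 H4).
Qed.

Lemma ccont_mult (f g : R -> C) (x : R) :
  ccont f x -> ccont g x -> ccont (fun y => f y * g y) x.
Proof.
rewrite !ccont_split. intros [H1 H2] [H3 H4]. split; simpl.
- apply (continuous_minus (fun y => fst (f y) * fst (g y))%R); apply (continuous_mult (K := R_AbsRing)); assumption.
- apply (continuous_plus (fun y => fst (f y) * snd (g y))%R); apply (continuous_mult (K := R_AbsRing)); assumption.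
Qed.

Lemma ccont_RtoC (f : R -> R) (x : R) : continuous f x -> ccont (fun y => RtoC (f y)) x.
Proof. intros H. apply ccont_split. split; [exact H | apply continuous_const]. Qed.

Lemma is_derive_RC_cont (f : R -> C) (x : R) (l : C) : is_derive_RC f x l -> ccont f x.
Proof.
rewrite is_derive_RC_split, ccont_split. intros [H1 H2].
split; apply (ex_derive_continuous (K := R_AbsRing) (V := R_NormedModule)); eexists; eassumption.
Qed.

Lemma is_derive_RC_const (c : C) (x : R) : is_derive_RC (fun _ => c) x 0.
Proof. exact (is_derive_const (V := C_R_NormedModule) c x). Qed.

Lemma is_derive_RC_plus (f g : R -> C) (x : R) (l m : C) :
  is_derive_RC f x l -> is_derive_RC g x m -> is_derive_RC (fun y => f y + g y) x (l + m).
Proof. exact (is_derive_plus (V := C_R_NormedModule) f g x l m). Qed.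

Lemma is_derive_RC_mult (f g : R -> C) (x : R) (l m : C) :
  is_derive_RC f x l -> is_derive_RC g x m ->
  is_derive_RC (fun y => f y * g y) x (l * g x + f x * m).
Proof.
rewrite !is_derive_RC_split. intros [H1 H2] [H3 H4]. split.
- apply (is_derive_ext (fun y => Re (f y) * Re (g y) - Im (f y) * Im (g y))%R); [reflexivity |].
  replace (Re (l * g x + f x * m))
    with ((Re l * Re (g x) + Re (f x) * Re m) - (Im l * Im (g x) + Im (f x) * Im m))%R by (unfold Re, Im; simpl; ring).
  apply (is_derive_minus (fun y => Re (f y) * Re (g y))%R);
    apply (is_derive_mult (K := R_AbsRing)); auto using Rmult_comm.
- apply (is_derive_ext (fun y => Re (f y) * Im (g y) + Im (f y) * Re (g y))%R); [reflexivity |].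
  replace (Im (l * g x + f x * m))
    with ((Re l * Im (g x) + Re (f x) * Im m) + (Im l * Re (g x) + Im (f x) * Re m))%R by (unfold Re, Im; simpl; ring).
  apply (is_derive_plus (fun y => Re (f y) * Im (g y))%R);
    apply (is_derive_mult (K := R_AbsRing)); auto using Rmult_comm.
Qed.

Lemma is_derive_RC_scal (c : C) (f : R -> C) (x : R) (l : C) :
  is_derive_RC f x l -> is_derive_RC (fun y => c * f y) x (c * l).
Proof.
intros H. replace (c * l) with (0 * f x + c * l) by ring.
apply is_derive_RC_mult; [apply is_derive_RC_const | exact H].
Qed.

Lemma is_derive_RC_RtoC (f : R -> R) (x l : R) :
  is_derive f x l -> is_derive_RC (fun y => RtoC (f y)) x (RtoC l).
Proof.
intros H. apply is_derive_RC_split. split; [exact H |].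
exact (is_derive_const 0%R x).
Qed.

Lemma is_derive_RC_comp_R (f : R -> C) (g : R -> R) (x : R) (l : C) (m : R) :
  is_derive_RC f (g x) l -> is_derive g x m ->
  is_derive_RC (fun y => f (g y)) x (m * l).
Proof.
rewrite !is_derive_RC_split. intros [H1 H2] H. split.
- replace (Re (m * l)) with (scal m (Re l)) by (unfold scal, Re; simpl; unfold mult; simpl; ring).
  exact (is_derive_comp (fun y => Re (f y)) g x _ _ H1 H).
- replace (Im (m * l)) with (scal m (Im l)) by (unfold scal, Im; simpl; unfold mult; simpl; ring).
  exact (is_derive_comp (fun y => Im (f y)) g x _ _ H2 H).
Qed.

Lemma is_derive_RC_ray (e : C) (x : R) : is_derive_RC (fun s => e * RtoC s) x e.
Proof.
pose proof (is_derive_RC_scal e RtoC x 1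
  (is_derive_RC_RtoC (fun s => s) x 1 (is_derive_id (K := R_AbsRing) x))) as H.
replace (e * 1) with e in H by ring. exact H.
Qed.

Lemma is_derive_RC_affine (a b : C) (x : R) : is_derive_RC (fun s => a + b * RtoC s) x b.
Proof.
pose proof (is_derive_RC_plus (fun _ => a) (fun s => b * RtoC s) x 0 b
  (is_derive_RC_const a x) (is_derive_RC_ray b x)) as H.
replace (0 + b) with b in H by ring. exact H.
Qed.

(** The inner derivative is over [R] and the outer one over [C], so the errors are compared by hand:
    the outer error at [g y], plus [l] times the inner one. *)
Lemma is_derive_RC_comp_C (f : C -> C) (g : R -> C) (x : R) (l m : C) :
  is_derive_C f (g x) l -> is_derive_RC g x m ->
  is_derive_RC (fun y => f (g y)) x (m * l).
Proof.
rewrite is_derive_C_eps, !is_derive_RC_eps. intros Hf Hg eps.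
pose proof (Cmod_ge_0 l) as Hl. pose proof (Cmod_ge_0 m) as Hm.
(* Each error gets half of [eps]; the cap 1 in [He2] makes [g] Lipschitz near [x] with constant
   [Cmod m + 1]. *)
assert (He1 : (0 < eps / (2 * (Cmod m + 1)))%R).
{ apply Rdiv_lt_0_compat; [apply cond_pos | lra]. }
assert (He2 : (0 < Rmin 1 (eps / (2 * (Cmod l + 1))))%R).
{ apply Rmin_pos; [lra |]. apply Rdiv_lt_0_compat; [apply cond_pos | lra]. }
destruct (Hf (mkposreal _ He1)) as [d1 Hd1].
destruct (Hg (mkposreal _ He2)) as [d2 Hd2]. simpl in Hd1, Hd2.
assert (Hd : (0 < Rmin d2 (d1 / (Cmod m + 1)))%R).
{ apply Rmin_pos; [apply cond_pos | apply Rdiv_lt_0_compat; [apply cond_pos | lra]]. }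
exists (mkposreal _ Hd). intros y Hy. simpl in Hy.
pose proof (Rmin_l d2 (d1 / (Cmod m + 1))). pose proof (Rmin_r d2 (d1 / (Cmod m + 1))).
specialize (Hd2 y ltac:(lra)).
pose proof (Rabs_pos (y - x)) as Hyx.
set (r := Rabs (y - x)) in *.
pose proof (Rmin_l 1 (eps / (2 * (Cmod l + 1)))) as M1.
pose proof (Rmin_r 1 (eps / (2 * (Cmod l + 1)))) as M2.
assert (Hgr : (Cmod (g y - g x) <= (Cmod m + 1) * r)%R).
{ replace (g y - g x) with ((g y - g x - (y - x)%R * m) + (y - x)%R * m) by ring.
  eapply Rle_trans; [apply Cmod_triangle |].
  rewrite Cmod_mult, Cmod_R. fold r. nra. }
assert (Hlt : (Cmod (g y - g x) < d1)%R).
{ eapply Rle_lt_trans; [exact Hgr |].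
  replace (pos d1) with ((Cmod m + 1) * (d1 / (Cmod m + 1)))%R by (field; lra).
  apply Rmult_lt_compat_l; lra. }
specialize (Hd1 _ Hlt).
replace (f (g y) - f (g x) - (y - x)%R * (m * l))
  with ((f (g y) - f (g x) - (g y - g x) * l) + (g y - g x - (y - x)%R * m) * l) by ring.
eapply Rle_trans; [apply Cmod_triangle |].
rewrite Cmod_mult.
apply Rle_trans with (eps / (2 * (Cmod m + 1)) * ((Cmod m + 1) * r) + (eps / (2 * (Cmod l + 1)) * r) * (Cmod l + 1))%R.
- apply Rplus_le_compat.
  + eapply Rle_trans; [exact Hd1 |]. apply Rmult_le_compat_l; lra.
  + apply Rmult_le_compat; try apply Cmod_ge_0; try lra.
    eapply Rle_trans; [exact Hd2 |]. apply Rmult_le_compat_r; lra.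
- right. field. lra.
Qed.

Lemma ccont_line (f : C -> C) (a b : C) (s : R) :
  (exists l, is_derive_C f (a + b * RtoC s) l) -> ccont (fun s => f (a + b * RtoC s)) s.
Proof.
intros [l Hl]. apply (is_derive_RC_cont _ _ (b * l)).
apply (is_derive_RC_comp_C f (fun s => a + b * RtoC s)); [exact Hl | apply is_derive_RC_affine].
Qed.

Lemma ccont_ray (f : C -> C) (e : C) (s : R) :
  (exists l, is_derive_C f (e * RtoC s) l) -> ccont (fun s => f (e * RtoC s)) s.
Proof.
intros [l Hl]. apply (is_derive_RC_cont _ _ (e * l)).
apply (is_derive_RC_comp_C f (fun s => e * RtoC s)); [exact Hl | apply is_derive_RC_ray].
Qed.

Lemma ccont_real (f : C -> C) (s : R) :
  (exists l, is_derive_C f (RtoC s) l) -> ccont (fun s => f (RtoC s)) s.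
Proof.
intros H. apply continuous_ext with (f := fun s => f (RtoC 1 * RtoC s)).
- intros u. now rewrite Cmult_1_l.
- apply ccont_ray. now rewrite Cmult_1_l.
Qed.

Lemma continuous_of_derive (f : R -> R) (x : R) : ex_derive f x -> continuous f x.
Proof. apply (ex_derive_continuous (K := R_AbsRing) (V := R_NormedModule)). Qed.

Lemma exp_le (x y : R) : (x <= y)%R -> (exp x <= exp y)%R.
Proof. intros [H | H]; [left; now apply exp_increasing | right; now rewrite H]. Qed.

Lemma RtoC_m1 : RtoC (-1) = - RtoC 1.
Proof. apply injective_projections; simpl; ring. Qed.

Lemma RtoC_m2 : RtoC (-2) = - RtoC 2.
Proof. apply injective_projections; simpl; ring. Qed.

Lemma filterlim_C_eps {T : Type} (G : (T -> Prop) -> Prop) (FG : Filter G) (f : T -> C) (l : C) :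
  filterlim (U := C_UniformSpace) f G (locally (T := C_UniformSpace) l) <->
  forall eps : posreal, G (fun x => Cmod (f x - l) < eps)%R.
Proof.
split.
- intros H eps. apply (H (fun z => Cmod (z - l) < eps)%R).
  apply locally_C. exists eps. intros y Hy. exact Hy.
- intros H P HP. apply locally_C in HP. destruct HP as [eps HP].
  refine (filter_imp (fun x => Cmod (f x - l) < eps)%R _ _ (H eps)). intros x Hx. apply HP. exact Hx.
Qed.

Lemma ccont_eps (f : R -> C) (x : R) :
  ccont f x <-> forall eps : posreal, exists d : posreal, forall y,
     (Rabs (y - x) < d -> Cmod (f y - f x) < eps)%R.
Proof. unfold continuous. rewrite filterlim_C_eps; [reflexivity | apply locally_filter]. Qed.

(** The scalars of this module are real; a complex factor mixes real and imaginary parts, hence the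
    passage to coordinates. *)
Lemma is_CInt_mult (c : C) (f : R -> C) (a b : R) (l : C) :
  is_CInt f a b l -> is_CInt (fun x => c * f x) a b (c * l).
Proof.
intros H.
pose proof (is_RInt_fct_extend_fst f a b l H) as H1.
pose proof (is_RInt_fct_extend_snd f a b l H) as H2.
apply is_RInt_fct_extend_pair.
- exact (is_RInt_minus (V := R_NormedModule) _ _ a b _ _
    (is_RInt_scal _ a b (fst c) _ H1) (is_RInt_scal _ a b (snd c) _ H2)).
- exact (is_RInt_plus (V := R_NormedModule) _ _ a b _ _
    (is_RInt_scal _ a b (fst c) _ H2) (is_RInt_scal _ a b (snd c) _ H1)).
Qed.

Lemma CInt_mult (c : C) (f : R -> C) (a b : R) :
  ex_CInt f a b -> CInt (fun x => c * f x) a b = c * CInt f a b.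
Proof.
intros H. apply is_RInt_unique. apply is_CInt_mult. apply (RInt_correct (V := CV) f a b H).
Qed.

Lemma ex_CInt_cont (f : R -> C) (a b : R) :
  (forall x, (Rmin a b <= x <= Rmax a b)%R -> ccont f x) -> ex_CInt f a b.
Proof. exact (ex_RInt_continuous (V := CV) f a b). Qed.

Lemma Cmod_CInt_le (f : R -> C) (g : R -> R) (a b : R) :
  (a <= b)%R -> ex_CInt f a b -> ex_RInt g a b ->
  (forall x, (a <= x <= b)%R -> (Cmod (f x) <= g x)%R) ->
  (Cmod (CInt f a b) <= RInt g a b)%R.
Proof.
intros Hab Hf Hg H. rewrite Cmod_norm.
apply (norm_RInt_le (V := C_R_NormedModule) f g a b); auto.
- intros x Hx. specialize (H x Hx). rewrite Cmod_norm in H. exact H.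
- exact (RInt_correct (V := CV) f a b Hf).
- exact (RInt_correct (V := R_CompleteNormedModule) g a b Hg).
Qed.

Lemma Cmod_CInt_le_const (f : R -> C) (a b M : R) :
  (a <= b)%R -> ex_CInt f a b ->
  (forall x, (a <= x <= b)%R -> (Cmod (f x) <= M)%R) ->
  (Cmod (CInt f a b) <= M * (b - a))%R.
Proof.
intros Hab Hf H.
replace (M * (b - a))%R with (RInt (fun _ : R => M) a b).
- apply Cmod_CInt_le; auto. apply ex_RInt_const.
- rewrite RInt_const. unfold scal; simpl; unfold mult; simpl. ring.
Qed.

(** * Mean value and Taylor estimates *)

Lemma is_CInt_derive (f df : R -> C) (a b : R) :
  (forall x, (Rmin a b <= x <= Rmax a b)%R -> is_derive_RC f x (df x)) ->
  (forall x, (Rmin a b <= x <= Rmax a b)%R -> ccont df x) ->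
  is_CInt df a b (f b - f a).
Proof. exact (is_RInt_derive (V := CV) f df a b). Qed.

Lemma mean_value_bound (f df : R -> C) (a b M : R) :
  (forall x, (Rmin a b <= x <= Rmax a b)%R -> is_derive_RC f x (df x)) ->
  (forall x, (Rmin a b <= x <= Rmax a b)%R -> ccont df x) ->
  (forall x, (Rmin a b <= x <= Rmax a b)%R -> (Cmod (df x) <= M)%R) ->
  (Cmod (f b - f a) <= M * Rabs (b - a))%R.
Proof.
assert (W : forall a b : R, (a <= b)%R ->
  (forall x, (a <= x <= b)%R -> is_derive_RC f x (df x)) ->
  (forall x, (a <= x <= b)%R -> ccont df x) ->
  (forall x, (a <= x <= b)%R -> (Cmod (df x) <= M)%R) ->
  (Cmod (f b - f a) <= M * (b - a))%R).
{ clear a b. intros a b Hab H1 H2 H3.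
  assert (E : is_CInt df a b (f b - f a)).
  { apply is_CInt_derive; rewrite Rmin_left, Rmax_right by lra; auto. }
  rewrite <- (is_RInt_unique (V := CV) df a b _ E).
  apply Cmod_CInt_le_const; auto. now exists (f b - f a). }
intros H1 H2 H3. destruct (Rle_dec a b) as [Hab | Hab].
- rewrite Rmin_left, Rmax_right in * by lra. rewrite Rabs_pos_eq by lra. auto.
- rewrite Rmin_right, Rmax_left in * by lra. rewrite Rabs_minus_sym, Rabs_pos_eq by lra.
  rewrite <- Cmod_opp. replace (- (f b - f a)) with (f a - f b) by ring.
  apply W; auto. lra.
Qed.

(** The mean value bound is used twice: once for [df], then for [f] minus its tangent, whose
    derivative [df x - df a] is at most [M |b - a|]. The sharp factor 1/2 is of no interest here. *)
Lemma taylor_bound (f df ddf : R -> C) (a b M : R) :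
  (forall x, (Rmin a b <= x <= Rmax a b)%R -> is_derive_RC f x (df x)) ->
  (forall x, (Rmin a b <= x <= Rmax a b)%R -> is_derive_RC df x (ddf x)) ->
  (forall x, (Rmin a b <= x <= Rmax a b)%R -> ccont ddf x) ->
  (forall x, (Rmin a b <= x <= Rmax a b)%R -> (Cmod (ddf x) <= M)%R) ->
  (Cmod (f b - f a - (b - a)%R * df a) <= M * Rabs (b - a) ^ 2)%R.
Proof.
intros H1 H2 H3 H4.
pose (g := fun x : R => f x + (- df a * a + df a * (- RtoC x))).
replace (f b - f a - (b - a)%R * df a) with (g b - g a).
2: { unfold g. rewrite RtoC_minus. ring. }
replace (M * Rabs (b - a) ^ 2)%R with ((M * Rabs (b - a)) * Rabs (b - a))%R by ring.
apply mean_value_bound with (df := fun x => df x - df a).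
- intros x Hx. replace (df x - df a) with (df x + (- df a)) by ring.
  apply is_derive_RC_plus; [auto |].
  eapply is_derive_ext; [| apply (is_derive_RC_affine (- df a * a) (- df a) x)].
  intros y. simpl. change (plus (- df a * a) (- df a * y) = - df a * a + df a * - y).
  unfold plus; simpl. ring.
- intros x Hx. apply (ccont_plus df (fun _ => - df a)); [| apply ccont_const].
  eapply is_derive_RC_cont; eauto.
- intros x Hx.
  assert (Hax : forall y, (Rmin a x <= y <= Rmax a x)%R -> (Rmin a b <= y <= Rmax a b)%R).
  { intros y. destruct Hx as [Hx1 Hx2]. unfold Rmin, Rmax in *.
    destruct (Rle_dec a b), (Rle_dec a x); lra. }
  eapply Rle_trans; [apply (mean_value_bound df ddf a x M) |]; auto.
  apply Rmult_le_compat_l.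
  + eapply Rle_trans; [apply Cmod_ge_0 | apply (H4 x Hx)].
  + revert Hx. unfold Rmin, Rmax, Rabs. destruct (Rle_dec a b), (Rcase_abs (x - a)), (Rcase_abs (b - a)); lra.
Qed.

(** * Goursat's lemma *)

Definition seg (f : C -> C) (a b : C) : C :=
  (b - a) * CInt (fun s => f (a + (b - a) * RtoC s)) 0 1.

Definition tri (f : C -> C) (a b c : C) : C := seg f a b + seg f b c + seg f c a.

Definition convex (D : C -> Prop) : Prop :=
  forall (a b : C) (s : R), D a -> D b -> (0 <= s <= 1)%R -> D (a + (b - a) * RtoC s).

(** Keeps the limit point of the nested triangles inside [D], where [f] is differentiable. The
    domains used below are closed sets with the contour on their boundary. *)
Definition seq_closed (D : C -> Prop) : Prop :=
  forall (u : nat -> C) (z : C), (forall n, D (u n)) ->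
    (forall eps : posreal, exists n, (Cmod (u n - z) < eps)%R) -> D z.

Definition seg_cont (f : C -> C) (a b : C) : Prop :=
  forall s : R, (0 <= s <= 1)%R -> ccont (fun s => f (a + (b - a) * RtoC s)) s.

Lemma seg_cont_ex (f : C -> C) (a b : C) (u v : R) :
  (0 <= u <= 1)%R -> (0 <= v <= 1)%R -> seg_cont f a b ->
  ex_CInt (fun s => f (a + (b - a) * RtoC s)) u v.
Proof.
intros Hu Hv H. apply ex_CInt_cont. intros x Hx. apply H.
revert Hx. unfold Rmin, Rmax. destruct (Rle_dec u v); lra.
Qed.

Lemma seg_cont_holomorphic (D : C -> Prop) (f : C -> C) (a b : C) :
  convex D -> (forall z, D z -> exists l, is_derive_C f z l) ->
  D a -> D b -> seg_cont f a b.
Proof.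
intros HD Hf Ha Hb s Hs. apply ccont_line, Hf. now apply HD.
Qed.

Lemma Rmult_1_scal (u : R) (z : C) : scal (V := C_R_NormedModule) u z = u * z.
Proof.
apply injective_projections; unfold scal; simpl; unfold scal; simpl; unfold mult; simpl; ring.
Qed.

(** Multiplying by [u] instead of dividing keeps [u = 0] in the equation, so degenerate segments
    need no separate treatment. *)
Lemma CInt_comp_lin (f : R -> C) (u v a b : R) :
  ex_CInt f (u * a + v) (u * b + v) ->
  u * CInt (fun y => f (u * y + v)%R) a b = CInt f (u * a + v) (u * b + v) /\
  (u <> 0%R -> ex_CInt (fun y => f (u * y + v)%R) a b).
Proof.
intros H.
pose proof (is_RInt_comp_lin (V := C_R_NormedModule) f u v a b _ (RInt_correct (V := CV) _ _ _ H)) as E.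
assert (E' : is_CInt (fun y => u * f (u * y + v)%R) a b (CInt f (u * a + v) (u * b + v))).
{ revert E. apply is_RInt_ext. intros x _. apply Rmult_1_scal. }
assert (W : u <> 0%R -> ex_CInt (fun y => f (u * y + v)%R) a b).
{ intros Hu. eexists. eapply is_RInt_ext; [| apply (is_CInt_mult (/ u) _ _ _ _ E')].
  intros x _. cbv beta. rewrite Cmult_assoc, Cinv_l, Cmult_1_l; [reflexivity |].
  intros E0. apply Hu. now injection E0. }
split; [| exact W].
destruct (Req_dec_T u 0) as [Hu | Hu].
- subst u. rewrite Cmult_0_l.
  replace (0 * a + v)%R with v by ring. replace (0 * b + v)%R with v by ring.
  symmetry. exact (RInt_point (V := CV) v f).
- rewrite <- CInt_mult by now apply W.
  exact (is_RInt_unique (V := CV) _ _ _ _ E').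
Qed.

Lemma seg_swap (f : C -> C) (a b : C) : seg_cont f a b -> seg f b a = - seg f a b.
Proof.
intros H. unfold seg.
assert (E : ex_CInt (fun s => f (a + (b - a) * RtoC s)) (-1 * 0 + 1) (-1 * 1 + 1)).
{ apply seg_cont_ex; [lra | lra | exact H]. }
destruct (CInt_comp_lin _ _ _ _ _ E) as [E1 _].
replace (-1 * 0 + 1)%R with 1%R in E1 by ring.
replace (-1 * 1 + 1)%R with 0%R in E1 by ring.
assert (E2 : CInt (fun s => f (b + (a - b) * RtoC s)) 0 1 =
             CInt (fun y => f (a + (b - a) * RtoC (-1 * y + 1)%R)) 0 1).
{ apply (RInt_ext (V := CV)). intros x _. f_equal.
  rewrite RtoC_plus, RtoC_mult, RtoC_m1. ring. }
rewrite E2.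
assert (E3 : CInt (fun s => f (a + (b - a) * RtoC s)) 1 0 = - CInt (fun s => f (a + (b - a) * RtoC s)) 0 1).
{ symmetry. apply (opp_RInt_swap (V := CV)). apply seg_cont_ex; [lra | lra | exact H]. }
rewrite E3 in E1.
transitivity ((b - a) * (RtoC (-1) * CInt (fun y => f (a + (b - a) * RtoC (-1 * y + 1)%R)) 0 1)).
- rewrite RtoC_m1. ring.
- rewrite E1. ring.
Qed.

Definition midpoint (a b : C) : C := a + (b - a) * RtoC (/ 2).

Lemma seg_midpoint (f : C -> C) (a b : C) :
  seg_cont f a b -> seg f a b = seg f a (midpoint a b) + seg f (midpoint a b) b.
Proof.
intros H. unfold seg.
set (phi := fun s => f (a + (b - a) * RtoC s)).
assert (X1 : ex_CInt phi 0 (/ 2)) by (apply seg_cont_ex; [lra | lra | exact H]).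
assert (X2 : ex_CInt phi (/ 2) 1) by (apply seg_cont_ex; [lra | lra | exact H]).
assert (E0 : CInt phi 0 1 = CInt phi 0 (/ 2) + CInt phi (/ 2) 1).
{ symmetry. exact (RInt_Chasles (V := CV) phi 0 (/ 2) 1 X1 X2). }
rewrite E0.
destruct (CInt_comp_lin phi (/ 2) 0 0 1) as [E1 _].
{ replace (/ 2 * 0 + 0)%R with 0%R by ring. replace (/ 2 * 1 + 0)%R with (/ 2)%R by ring. exact X1. }
destruct (CInt_comp_lin phi (/ 2) (/ 2) 0 1) as [E2 _].
{ replace (/ 2 * 0 + / 2)%R with (/ 2)%R by ring. replace (/ 2 * 1 + / 2)%R with 1%R by field. exact X2. }
replace (/ 2 * 0 + 0)%R with 0%R in E1 by ring. replace (/ 2 * 1 + 0)%R with (/ 2)%R in E1 by ring.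
replace (/ 2 * 0 + / 2)%R with (/ 2)%R in E2 by ring. replace (/ 2 * 1 + / 2)%R with 1%R in E2 by field.
rewrite <- E1, <- E2.
assert (T1 : CInt (fun s => f (a + (midpoint a b - a) * RtoC s)) 0 1 = CInt (fun y => phi (/ 2 * y + 0)%R) 0 1).
{ apply (RInt_ext (V := CV)). intros x _. unfold phi, midpoint. f_equal.
  rewrite RtoC_plus, RtoC_mult. ring. }
assert (T2 : CInt (fun s => f (midpoint a b + (b - midpoint a b) * RtoC s)) 0 1 = CInt (fun y => phi (/ 2 * y + / 2)%R) 0 1).
{ apply (RInt_ext (V := CV)). intros x _. unfold phi, midpoint. f_equal.
  rewrite RtoC_plus, RtoC_mult, RtoC_inv by lra. field. }
rewrite T1, T2. unfold midpoint. rewrite RtoC_inv by lra. field.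
Qed.

Lemma seg_bound (f : C -> C) (a b : C) (M : R) :
  seg_cont f a b ->
  (forall s : R, (0 <= s <= 1)%R -> (Cmod (f (a + (b - a) * RtoC s)%C) <= M)%R) ->
  (Cmod (seg f a b) <= Cmod (b - a) * M)%R.
Proof.
intros H HM. unfold seg. rewrite Cmod_mult.
apply Rmult_le_compat_l; [apply Cmod_ge_0 |].
replace M with (M * (1 - 0))%R by ring.
apply Cmod_CInt_le_const; [lra | | exact HM].
apply seg_cont_ex; [lra | lra | exact H].
Qed.

Lemma seg_primitive (G f : C -> C) (a b : C) :
  (forall s : R, (0 <= s <= 1)%R ->
     is_derive_C G (a + (b - a) * RtoC s) (f (a + (b - a) * RtoC s))) ->
  seg_cont f a b ->
  seg f a b = G b - G a.
Proof.
intros HG H. unfold seg.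
rewrite <- CInt_mult by (apply seg_cont_ex; [lra | lra | exact H]).
assert (E : is_CInt (fun s => (b - a) * f (a + (b - a) * RtoC s)) 0 1
   (G (a + (b - a) * RtoC 1) - G (a + (b - a) * RtoC 0))).
{ apply (is_CInt_derive (fun s => G (a + (b - a) * RtoC s)));
    rewrite Rmin_left, Rmax_right by lra; intros s Hs.
  - apply (is_derive_RC_comp_C G); [now apply HG | apply is_derive_RC_affine].
  - apply (ccont_mult (fun _ => b - a)); [apply ccont_const | now apply H]. }
rewrite (is_RInt_unique (V := CV) _ _ _ _ E). f_equal; [| f_equal]; f_equal; ring.
Qed.

Lemma seg_plus (f g : C -> C) (a b : C) :
  seg_cont f a b -> seg_cont g a b ->
  seg (fun z => f z + g z) a b = seg f a b + seg g a b.
Proof.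
intros Hf Hg. unfold seg. rewrite <- Cmult_plus_distr_l. f_equal.
apply (RInt_plus (V := CV)); apply seg_cont_ex; auto; lra.
Qed.

Lemma seg_cont_affine (p q a b : C) : seg_cont (fun z => p + q * z) a b.
Proof.
intros s _. apply (ccont_line (fun z => p + q * z)). exists q. apply is_derive_C_affine.
Qed.

(** An affine function has a quadratic primitive. In [goursat] this allows the tangent at the limit
    point to be subtracted. *)
Lemma tri_affine (p q a b c : C) : tri (fun z => p + q * z) a b c = 0.
Proof.
assert (E : forall a b, seg (fun z => p + q * z) a b =
   (p * b + q * / 2 * (b * b)) - (p * a + q * / 2 * (a * a))).
{ clear. intros a b.
  apply (seg_primitive (fun z => p * z + q * / 2 * (z * z))).
  - intros s _. set (z := a + (b - a) * s).
    pose proof (is_derive_C_plus (fun z => p * z) (fun z => q * / 2 * (z * z)) z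
      (0 * z + p * 1) (0 * (z * z) + q * / 2 * (1 * z + z * 1))
      (is_derive_C_mult _ _ _ _ _ (is_derive_C_const p z) (is_derive_C_id z))
      (is_derive_C_mult _ _ _ _ _ (is_derive_C_const (q * / 2) z)
        (is_derive_C_mult _ _ _ _ _ (is_derive_C_id z) (is_derive_C_id z)))) as H.
    replace (p + q * z) with (0 * z + p * 1 + (0 * (z * z) + q * / 2 * (1 * z + z * 1))); [exact H |].
    field.
  - apply seg_cont_affine. }
unfold tri. rewrite !E. ring.
Qed.

Record triangle := Triangle { va : C; vb : C; vc : C }.

Definition tri_in (D : C -> Prop) (T : triangle) : Prop := D (va T) /\ D (vb T) /\ D (vc T).

Definition sides_le (T : triangle) (L : R) : Prop :=
  (Cmod (vb T - va T) <= L /\ Cmod (vc T - vb T) <= L /\ Cmod (va T - vc T) <= L)%R.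

Definition tri_of (f : C -> C) (T : triangle) : C := tri f (va T) (vb T) (vc T).

Lemma Cmod_half (z : C) (L : R) : (Cmod z <= L)%R -> (Cmod (z * RtoC (/ 2)) <= L / 2)%R.
Proof. intros H. rewrite Cmod_mult, Cmod_R, Rabs_pos_eq by lra. lra. Qed.

(** Cutting at the midpoints gives four triangles whose inner sides cancel, so one of them carries
    at least a quarter of the integral. The size bounds are stated for every [L], which keeps the
    choice of [T'] independent of [L]. *)
Lemma goursat_step (D : C -> Prop) (f : C -> C) (HD : convex D)
  (Hf : forall z, D z -> exists l, is_derive_C f z l) (T : triangle) :
  tri_in D T ->
  exists T', tri_in D T' /\
    (forall L, sides_le T L -> sides_le T' (L / 2) /\ (Cmod (va T' - va T) <= L)%R) /\
    (Cmod (tri_of f T) <= 4 * Cmod (tri_of f T'))%R.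
Proof.
destruct T as [a b c]. unfold tri_in, sides_le, tri_of; simpl. intros (Ha & Hb & Hc).
set (m1 := midpoint a b). set (m2 := midpoint b c). set (m3 := midpoint c a).
assert (D1 : D m1) by (apply HD; auto; lra).
assert (D2 : D m2) by (apply HD; auto; lra).
assert (D3 : D m3) by (apply HD; auto; lra).
assert (S : forall x y, D x -> D y -> seg_cont f x y) by (intros; eapply seg_cont_holomorphic; eauto).
assert (Sum : tri f a b c = tri f a m1 m3 + tri f m1 b m2 + tri f m2 c m3 + tri f m1 m2 m3).
{ unfold tri. rewrite (seg_midpoint f a b), (seg_midpoint f b c), (seg_midpoint f c a) by auto.
  fold m1 m2 m3.
  rewrite (seg_swap f m1 m3), (seg_swap f m1 m2), (seg_swap f m2 m3) by auto. ring. }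
assert (A1 : forall p q L, (Cmod (q - p) <= L)%R -> (Cmod (midpoint p q - p) <= L / 2)%R).
{ intros p q L H. replace (midpoint p q - p) with ((q - p) * RtoC (/ 2)) by (unfold midpoint; ring).
  now apply Cmod_half. }
assert (A2 : forall p q L, (Cmod (q - p) <= L)%R -> (Cmod (q - midpoint p q) <= L / 2)%R).
{ intros p q L H. replace (q - midpoint p q) with ((q - p) * RtoC (/ 2))
    by (unfold midpoint; rewrite RtoC_inv by lra; field).
  now apply Cmod_half. }
assert (A3 : forall p q r L, (Cmod (r - p) <= L)%R -> (Cmod (midpoint q r - midpoint p q) <= L / 2)%R).
{ intros p q r L H. replace (midpoint q r - midpoint p q) with ((r - p) * RtoC (/ 2))
    by (unfold midpoint; rewrite RtoC_inv by lra; field).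
  now apply Cmod_half. }
assert (Sw : forall p q L, (Cmod (q - p) <= L)%R -> (Cmod (p - q) <= L)%R).
{ intros p q L H. now replace (p - q) with (- (q - p)) by ring; rewrite Cmod_opp. }
assert (Tr : (Cmod (tri f a b c) <= Cmod (tri f a m1 m3) + Cmod (tri f m1 b m2)
   + Cmod (tri f m2 c m3) + Cmod (tri f m1 m2 m3))%R).
{ rewrite Sum. eapply Rle_trans; [apply Cmod_triangle |]. apply Rplus_le_compat_r.
  eapply Rle_trans; [apply Cmod_triangle |]. apply Rplus_le_compat_r. apply Cmod_triangle. }
assert (P : forall x y z, D x -> D y -> D z ->
  (Cmod (tri f a b c) <= 4 * Cmod (tri f x y z))%R ->
  (forall L, (Cmod (b - a) <= L /\ Cmod (c - b) <= L /\ Cmod (a - c) <= L)%R ->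
     ((Cmod (y - x) <= L / 2 /\ Cmod (z - y) <= L / 2 /\ Cmod (x - z) <= L / 2) /\ Cmod (x - a) <= L)%R) ->
  exists T', (D (va T') /\ D (vb T') /\ D (vc T')) /\
    (forall L, (Cmod (b - a) <= L /\ Cmod (c - b) <= L /\ Cmod (a - c) <= L)%R ->
     ((Cmod (vb T' - va T') <= L / 2 /\ Cmod (vc T' - vb T') <= L / 2 /\
       Cmod (va T' - vc T') <= L / 2) /\ Cmod (va T' - a) <= L)%R) /\
    (Cmod (tri f a b c) <= 4 * Cmod (tri f (va T') (vb T') (vc T')))%R).
{ intros x y z Dx Dy Dz H1 H2. exists (Triangle x y z). simpl. auto. }
assert (HL : forall L, (Cmod (b - a) <= L)%R -> (L / 2 <= L)%R).
{ intros L HL. pose proof (Cmod_ge_0 (b - a)). lra. }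
assert (Half : forall x y z,
  (forall L, (Cmod (b - a) <= L /\ Cmod (c - b) <= L /\ Cmod (a - c) <= L)%R ->
     (Cmod (y - x) <= L / 2)%R /\ (Cmod (z - y) <= L / 2)%R /\ (Cmod (x - z) <= L / 2)%R /\ (Cmod (x - a) <= L)%R) ->
  (forall L, (Cmod (b - a) <= L /\ Cmod (c - b) <= L /\ Cmod (a - c) <= L)%R ->
     ((Cmod (y - x) <= L / 2 /\ Cmod (z - y) <= L / 2 /\ Cmod (x - z) <= L / 2) /\ Cmod (x - a) <= L)%R)).
{ intros x y z H L HL'. specialize (H L HL'). tauto. }
assert (B1 : forall L, (Cmod (b - a) <= L /\ Cmod (c - b) <= L /\ Cmod (a - c) <= L)%R ->
  (Cmod (m1 - a) <= L / 2 /\ Cmod (b - m1) <= L / 2 /\ Cmod (m2 - b) <= L / 2 /\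
   Cmod (c - m2) <= L / 2 /\ Cmod (m3 - c) <= L / 2 /\ Cmod (a - m3) <= L / 2 /\
   Cmod (m2 - m1) <= L / 2 /\ Cmod (m3 - m2) <= L / 2 /\ Cmod (m1 - m3) <= L / 2)%R).
{ intros L (La & Lb & Lc). unfold m1, m2, m3.
  repeat apply conj; solve [apply A1; auto | apply A2; auto | apply A3; apply Sw; auto]. }
destruct (Rle_dec (Cmod (tri f a b c)) (4 * Cmod (tri f a m1 m3))) as [H1 | H1].
{ apply (P a m1 m3); auto. apply Half. intros L HL'. specialize (B1 L HL').
  replace (a - a) with (RtoC 0) by ring. rewrite Cmod_0. pose proof (Cmod_ge_0 (b - a)).
  repeat apply conj; solve [tauto | apply Sw; tauto | lra]. }
destruct (Rle_dec (Cmod (tri f a b c)) (4 * Cmod (tri f m1 b m2))) as [H2 | H2].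
{ apply (P m1 b m2); auto. apply Half. intros L HL'. specialize (B1 L HL').
  pose proof (Cmod_ge_0 (m1 - a)).
  repeat apply conj; solve [tauto | apply Sw; tauto | lra]. }
destruct (Rle_dec (Cmod (tri f a b c)) (4 * Cmod (tri f m2 c m3))) as [H3 | H3].
{ apply (P m2 c m3); auto. apply Half. intros L HL'. specialize (B1 L HL').
  assert (Cmod (m2 - a) <= L)%R.
  { replace (m2 - a) with ((m2 - m1) + (m1 - a)) by ring.
    eapply Rle_trans; [apply Cmod_triangle |]. lra. }
  repeat apply conj; solve [tauto | apply Sw; tauto]. }
(* The three corner triangles carry less than a quarter each, so by [Tr] the middle one carries
   more. *)
apply (P m1 m2 m3); auto; [lra |].
apply Half. intros L HL'. specialize (B1 L HL'). pose proof (Cmod_ge_0 (m1 - a)).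
repeat apply conj; solve [tauto | lra].
Qed.

Lemma C_cauchy_lim (u : nat -> C) :
  (forall eps : posreal, exists N : nat, forall n, (N <= n)%nat -> (Cmod (u n - u N) < eps)%R) ->
  exists z, forall eps : posreal, exists N : nat, forall n, (N <= n)%nat -> (Cmod (u n - z) < eps)%R.
Proof.
intros H.
destruct (proj1 (filterlim_locally_cauchy (U := C_R_CompleteNormedModule) (F := eventually) u)) as [z Hz].
{ intros eps.
  destruct (H (pos_div_2 eps)) as [N HN]. exists (fun n => (N <= n)%nat).
  split; [now exists N |]. intros n m Hn Hm.
  apply C_NormedModule_mixin_compat1. change (Cmod (u m - u n) < eps)%R.
  replace (u m - u n) with ((u m - u N) + - (u n - u N)) by ring.
  eapply Rle_lt_trans; [apply Cmod_triangle |]. rewrite Cmod_opp.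
  pose proof (HN n Hn). pose proof (HN m Hm). simpl in *. lra. }
exists z. exact (proj1 (filterlim_C_eps eventually _ u z) Hz).
Qed.

Lemma pow2_inv_small (K : R) (eps : posreal) : exists N : nat, (K * (/ 2) ^ N < eps)%R.
Proof.
destruct (Rle_dec K 0) as [HK | HK].
{ exists 0%nat. simpl. destruct eps; simpl; lra. }
destruct (pow_lt_1_zero (/ 2) ltac:(rewrite Rabs_pos_eq; lra) (eps / K)) as [N HN].
{ apply Rdiv_lt_0_compat; [apply cond_pos | lra]. }
exists N. specialize (HN N (Nat.le_refl N)).
rewrite Rabs_pos_eq in HN by (apply pow_le; lra).
replace (pos eps) with (K * (eps / K))%R by (field; lra).
apply Rmult_lt_compat_l; lra.
Qed.

Theorem goursat (D : C -> Prop) (f : C -> C) (a b c : C) :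
  convex D -> seq_closed D -> (forall z, D z -> exists l, is_derive_C f z l) ->
  D a -> D b -> D c -> tri f a b c = 0.
Proof.
intros HD HC Hf Ha Hb Hc.
(* With the hypothesis placed under the existential, choice yields a total function [next] that can
   be iterated. *)
assert (Step : forall T, exists T', tri_in D T -> tri_in D T' /\
    (forall L, sides_le T L -> sides_le T' (L / 2) /\ (Cmod (va T' - va T) <= L)%R) /\
    (Cmod (tri_of f T) <= 4 * Cmod (tri_of f T'))%R).
{ intros T. destruct (classic (tri_in D T)) as [HT | HT].
  - destruct (goursat_step D f HD Hf T HT) as [T' HT']. exists T'. auto.
  - exists T. tauto. }
pose (next := fun T => proj1_sig (constructive_indefinite_description _ (Step T))).
assert (Hnext : forall T, tri_in D T -> tri_in D (next T) /\
    (forall L, sides_le T L -> sides_le (next T) (L / 2) /\ (Cmod (va (next T) - va T) <= L)%R) /\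
    (Cmod (tri_of f T) <= 4 * Cmod (tri_of f (next T)))%R).
{ intros T. exact (proj2_sig (constructive_indefinite_description _ (Step T))). }
pose (T := fun n => Nat.iter n next (Triangle a b c)).
assert (TS : forall n, T (S n) = next (T n)) by reflexivity.
pose (L := (Cmod (b - a) + Cmod (c - b) + Cmod (a - c))%R).
pose proof (Cmod_ge_0 (b - a)) as P1. pose proof (Cmod_ge_0 (c - b)) as P2.
pose proof (Cmod_ge_0 (a - c)) as P3.
assert (HT : forall n, tri_in D (T n) /\ sides_le (T n) (L * (/ 2) ^ n) /\
   (Cmod (tri f a b c) <= 4 ^ n * Cmod (tri_of f (T n)))%R).
{ induction n as [| n (I1 & I2 & I3)].
  - split; [| split].
    + repeat split; assumption.
    + unfold sides_le; simpl. unfold L. lra.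
    + simpl. unfold tri_of; simpl. lra.
  - rewrite TS. destruct (Hnext (T n) I1) as (J1 & J2 & J3).
    split; [exact J1 | split].
    + replace (L * (/ 2) ^ S n)%R with (L * (/ 2) ^ n / 2)%R by (simpl; field).
      now apply J2.
    + eapply Rle_trans; [exact I3 |]. simpl.
      replace (4 * 4 ^ n * Cmod (tri_of f (next (T n))))%R
        with (4 ^ n * (4 * Cmod (tri_of f (next (T n)))))%R by ring.
      apply Rmult_le_compat_l; [apply pow_le; lra | exact J3]. }
assert (Hstep : forall n, (Cmod (va (T (S n)) - va (T n)) <= L * (/ 2) ^ n)%R).
{ intros n. destruct (HT n) as (I1 & I2 & _). rewrite TS.
  destruct (Hnext (T n) I1) as (_ & J2 & _). now apply J2. }
assert (HL : (0 <= L)%R) by (unfold L; lra).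
assert (Hp : forall n, (0 < (/ 2) ^ n)%R) by (intros n; apply pow_lt; lra).
assert (HLp : forall n, (0 <= 2 * L * (/ 2) ^ n)%R).
{ intros n. pose proof (Hp n). repeat apply Rmult_le_pos; lra. }
(* The steps [L / 2^n] telescope as differences of [2 L / 2^n]. *)
assert (Hcauchy : forall n p, (Cmod (va (T (n + p)%nat) - va (T n)) <= 2 * L * (/ 2) ^ n - 2 * L * (/ 2) ^ (n + p))%R).
{ intros n. induction p as [| p IH].
  - rewrite Nat.add_0_r. replace (va (T n) - va (T n)) with (RtoC 0) by ring. rewrite Cmod_0. lra.
  - rewrite Nat.add_succ_r.
    replace (va (T (S (n + p))) - va (T n)) with ((va (T (S (n + p))) - va (T (n + p)%nat)) + (va (T (n + p)%nat) - va (T n))) by ring.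
    eapply Rle_trans; [apply Cmod_triangle |].
    pose proof (Hstep (n + p)%nat). rewrite <- tech_pow_Rmult. lra. }
destruct (C_cauchy_lim (fun n => va (T n))) as [z0 Hz0].
{ intros eps. destruct (pow2_inv_small (2 * L) eps) as [N HN]. exists N.
  intros n Hn. replace n with (N + (n - N))%nat by lia.
  eapply Rle_lt_trans; [apply Hcauchy |].
  pose proof (HLp (N + (n - N))%nat). lra. }
assert (Dz0 : D z0).
{ apply (HC (fun n => va (T n))).
  - intros n. apply (HT n).
  - intros eps. destruct (Hz0 eps) as [N HN]. exists N. now apply HN. }
assert (Hnear : forall n, (Cmod (va (T n) - z0) <= 2 * L * (/ 2) ^ n)%R).
{ intros n. apply le_epsilon. intros eps Heps.
  destruct (Hz0 (mkposreal eps Heps)) as [N HN]. simpl in HN.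
  specialize (HN (n + N)%nat ltac:(lia)).
  replace (va (T n) - z0) with (- (va (T (n + N)%nat) - va (T n)) + (va (T (n + N)%nat) - z0)) by ring.
  eapply Rle_trans; [apply Cmod_triangle |]. rewrite Cmod_opp.
  pose proof (Hcauchy n N). pose proof (HLp (n + N)%nat). lra. }
apply Cmod_eq_0. apply Rle_antisym; [| apply Cmod_ge_0].
apply le_epsilon. intros eps Heps. rewrite Rplus_0_l.
(* The final estimate is [4^n] times three sides of length [L h] times values [e * 3 L h], with
   [h = 1 / 2^n], that is [9 L^2 e]; the [+ 1] covers the degenerate triangle [L = 0]. *)
assert (Heps' : (0 < eps / (9 * L ^ 2 + 1))%R) by (apply Rdiv_lt_0_compat; nra).
destruct (Hf z0 Dz0) as [l Hl]. rewrite is_derive_C_eps in Hl.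
destruct (Hl (mkposreal _ Heps')) as [d Hd]. simpl in Hd.
destruct (pow2_inv_small (3 * L) d) as [n Hn].
destruct (HT n) as ((D1 & D2 & D3) & (S1 & S2 & S3) & I3).
eapply Rle_trans; [exact I3 |].
set (h := ((/ 2) ^ n)%R) in *. pose proof (Hp n) as Hh. fold h in Hh.
set (e := (eps / (9 * L ^ 2 + 1))%R) in *.
(* [f] minus its tangent at [z0]: the same integral over a closed triangle, but values of size
   [o(h)]. *)
pose (g := fun z => f z + ((l * z0 - f z0) + (- l) * z)).
assert (Sf : forall x y, D x -> D y -> seg_cont f x y) by (intros; eapply seg_cont_holomorphic; eauto).
assert (Eq : tri_of f (T n) = tri_of g (T n)).
{ assert (Sp : forall x y, D x -> D y ->
    seg g x y = seg f x y + seg (fun z => (l * z0 - f z0) + (- l) * z) x y).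
  { intros x y Dx Dy. apply seg_plus; auto using seg_cont_affine. }
  unfold tri_of, tri. rewrite !Sp by assumption.
  pose proof (tri_affine (l * z0 - f z0) (- l) (va (T n)) (vb (T n)) (vc (T n))) as E.
  unfold tri in E.
  transitivity (seg f (va (T n)) (vb (T n)) + seg f (vb (T n)) (vc (T n)) + seg f (vc (T n)) (va (T n)) + 0).
  - ring.
  - rewrite <- E. ring. }
assert (Near : forall x, (Cmod (x - z0) <= 3 * L * h)%R -> (Cmod (g x) <= e * (3 * L * h))%R).
{ intros x Hx. unfold g.
  replace (f x + (l * z0 - f z0 + - l * x)) with (f x - f z0 - (x - z0) * l) by ring.
  eapply Rle_trans; [apply Hd; lra |]. apply Rmult_le_compat_l; lra. }
assert (Bseg : forall x y, D x -> D y -> (Cmod (x - z0) <= 3 * L * h)%R -> (Cmod (y - z0) <= 3 * L * h)%R ->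
   (Cmod (y - x) <= L * h)%R -> (Cmod (seg g x y) <= L * h * (e * (3 * L * h)))%R).
{ intros x y Dx Dy Hx Hy Hxy.
  eapply Rle_trans; [apply (seg_bound g x y (e * (3 * L * h))) |].
  - intros s Hs. unfold g. apply ccont_plus; [now apply (Sf x y) | now apply (seg_cont_affine _ _ x y s)].
  - intros s Hs. apply Near.
    replace (x + (y - x) * s - z0) with ((x - z0) * RtoC (1 - s) + (y - z0) * RtoC s)
      by (rewrite RtoC_minus; ring).
    eapply Rle_trans; [apply Cmod_triangle |]. rewrite !Cmod_mult, !Cmod_R, !Rabs_pos_eq by lra.
    nra.
  - apply Rmult_le_compat_r; [| exact Hxy].
    apply Rmult_le_pos; [lra |]. nra. }
assert (Na : (Cmod (va (T n) - z0) <= 2 * L * h)%R) by apply Hnear.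
assert (Nb : (Cmod (vb (T n) - z0) <= 3 * L * h)%R).
{ replace (vb (T n) - z0) with ((vb (T n) - va (T n)) + (va (T n) - z0)) by ring.
  eapply Rle_trans; [apply Cmod_triangle |]. lra. }
assert (Nc : (Cmod (vc (T n) - z0) <= 3 * L * h)%R).
{ replace (vc (T n) - z0) with (- (va (T n) - vc (T n)) + (va (T n) - z0)) by ring.
  eapply Rle_trans; [apply Cmod_triangle |]. rewrite Cmod_opp. lra. }
assert (Na' : (Cmod (va (T n) - z0) <= 3 * L * h)%R) by nra.
assert (Bt : (Cmod (tri_of g (T n)) <= 3 * (L * h * (e * (3 * L * h))))%R).
{ unfold tri_of, tri.
  eapply Rle_trans; [apply Cmod_triangle |].
  pose proof (Cmod_triangle (seg g (va (T n)) (vb (T n))) (seg g (vb (T n)) (vc (T n)))).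
  pose proof (Bseg _ _ D1 D2 Na' Nb S1). pose proof (Bseg _ _ D2 D3 Nb Nc S2).
  pose proof (Bseg _ _ D3 D1 Nc Na' S3). lra. }
rewrite Eq.
assert (H4 : (4 ^ n * (h * h) = 1)%R).
{ unfold h. rewrite <- !Rpow_mult_distr. replace (4 * (/ 2 * / 2))%R with 1%R by field. apply pow1. }
apply Rle_trans with (4 ^ n * (3 * (L * h * (e * (3 * L * h)))))%R.
{ apply Rmult_le_compat_l; [apply pow_le; lra | exact Bt]. }
replace (4 ^ n * (3 * (L * h * (e * (3 * L * h)))))%R with ((4 ^ n * (h * h)) * (9 * L ^ 2 * e))%R by ring.
rewrite H4, Rmult_1_l.
apply Rle_trans with ((9 * L ^ 2 + 1) * e)%R; [nra |].
unfold e. right. field. nra.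
Qed.

(** * Improper integrals and rotation of the contour *)

(** A dominated second derivative makes the Taylor remainder [O(|q - p|^2)] under the integral, so
    no dominated convergence theorem is called upon. [Hbound] abstracts the integral of the weight
    [w], so that the same argument serves [[0, 1]] (Gaussian integral) and [[0, oo)] (rotated
    ray). *)
Lemma is_derive_RC_integral (Fb : (R -> Prop) -> Prop) (FF : ProperFilter Fb)
  (S : R -> Prop) (w : R -> R) (c : R)
  (Hbound : forall (g : R -> C) (l : C) (M : R),
     is_RInt_gen (V := C_R_NormedModule) g (at_point 0) Fb l ->
     (forall s, S s -> (Cmod (g s) <= M * w s)%R) -> (Cmod l <= M * c)%R)
  (f df ddf : R -> R -> C) (p : R) (d : posreal) (M : R) :
  (forall q, (Rabs (q - p) < d)%R ->
     ex_RInt_gen (V := C_R_NormedModule) (f q) (at_point 0) Fb) ->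
  ex_RInt_gen (V := C_R_NormedModule) (df p) (at_point 0) Fb ->
  (forall q s, (Rabs (q - p) < d)%R -> S s ->
     is_derive_RC (fun q => f q s) q (df q s) /\
     is_derive_RC (fun q => df q s) q (ddf q s) /\
     ccont (fun q => ddf q s) q /\
     (Cmod (ddf q s) <= M * w s)%R) ->
  is_derive_RC (fun q => RInt_gen (V := CV) (f q) (at_point 0) Fb) p
    (RInt_gen (V := CV) (df p) (at_point 0) Fb).
Proof.
intros Hf Hdf H. apply is_derive_RC_eps. intros eps.
assert (HMc : (0 < Rabs (M * c) + 1)%R) by (pose proof (Rabs_pos (M * c)); lra).
assert (Hd : (0 < Rmin d (eps / (Rabs (M * c) + 1)))%R).
{ apply Rmin_pos; [apply cond_pos | apply Rdiv_lt_0_compat; [apply cond_pos | lra]]. }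
exists (mkposreal _ Hd). simpl. intros q Hq.
pose proof (Rmin_l d (eps / (Rabs (M * c) + 1))) as M1.
pose proof (Rmin_r d (eps / (Rabs (M * c) + 1))) as M2.
assert (Hp : (Rabs (p - p) < d)%R).
{ replace (p - p)%R with 0%R by ring. rewrite Rabs_R0. apply cond_pos. }
set (I := fun g => RInt_gen (V := CV) g (at_point 0) Fb).
assert (G : is_RInt_gen (V := C_R_NormedModule)
   (fun s => minus (minus (f q s) (f p s)) (scal (q - p)%R (df p s)))
   (at_point 0) Fb (minus (minus (I (f q)) (I (f p))) (scal (q - p)%R (I (df p))))).
{ apply (is_RInt_gen_minus (V := C_R_NormedModule));
    [apply (is_RInt_gen_minus (V := C_R_NormedModule)) | apply (is_RInt_gen_scal (V := C_R_NormedModule))];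
    apply (RInt_gen_correct (V := CV)); auto; apply Hf; auto; lra. }
apply Hbound with (M := (M * Rabs (q - p) ^ 2)%R) in G.
- unfold I in G. rewrite Rmult_1_scal in G.
  eapply Rle_trans; [exact G |].
  assert (Hle : (Rabs (q - p) <= eps / (Rabs (M * c) + 1))%R) by lra.
  pose proof (Rabs_pos (q - p)) as Hr. set (r := Rabs (q - p)) in *.
  apply Rle_trans with ((Rabs (M * c) + 1) * (eps / (Rabs (M * c) + 1)) * r)%R.
  + replace (M * r ^ 2 * c)%R with ((M * c) * (r * r))%R by ring.
    pose proof (Rle_abs (M * c)).
    apply Rle_trans with ((Rabs (M * c) + 1) * (r * r))%R.
    * apply Rmult_le_compat_r; [nra | lra].
    * rewrite Rmult_assoc. apply Rmult_le_compat_l; [lra |]. apply Rmult_le_compat_r; lra.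
  + right. field. lra.
- intros s Hs.
  assert (Hin : forall x, (Rmin p q <= x <= Rmax p q)%R -> (Rabs (x - p) < d)%R).
  { intros x Hx. apply Rle_lt_trans with (Rabs (q - p)); [| lra].
    revert Hx. unfold Rmin, Rmax, Rabs.
    destruct (Rle_dec p q), (Rcase_abs (x - p)), (Rcase_abs (q - p)); lra. }
  rewrite Rmult_1_scal.
  replace (M * Rabs (q - p) ^ 2 * w s)%R with (M * w s * Rabs (q - p) ^ 2)%R by ring.
  apply (taylor_bound (fun q => f q s) (fun q => df q s) (fun q => ddf q s));
    intros x Hx; apply (H x s (Hin x Hx) Hs).
Qed.

(** * Integrals over a half line and exponential bounds *)

Notation is_I f l := (is_RInt_gen (V := C_R_NormedModule) f (at_point 0) (Rbar_locally p_infty) l).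
Notation ex_I f := (ex_RInt_gen (V := C_R_NormedModule) f (at_point 0) (Rbar_locally p_infty)).
Notation I0 f := (RInt_gen (V := C_R_CompleteNormedModule) f (at_point 0) (Rbar_locally p_infty)).

Lemma is_I_eps (f : R -> C) (l : C) :
  (forall r, (0 <= r)%R -> ex_CInt f 0 r) ->
  (forall eps : posreal, exists M : R, forall r, (M < r)%R -> (0 <= r)%R -> (Cmod (CInt f 0 r - l) < eps)%R) ->
  is_I f l.
Proof.
intros Hf H P HP. apply locally_C in HP. destruct HP as [eps HP].
destruct (H eps) as [M HM].
refine (Filter_prod _ _ _ (fun a => a = 0%R) (fun b => (Rmax M 0 < b)%R) _ _ _).
- reflexivity.
- exists (Rmax M 0). auto.
- intros a b -> Hb. pose proof (Rmax_l M 0). pose proof (Rmax_r M 0). simpl.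
  exists (CInt f 0 b). split.
  + apply (RInt_correct (V := CV)), Hf. lra.
  + apply HP. apply (HM b); lra.
Qed.

Lemma is_I_lim (f : R -> C) (l : C) :
  is_I f l -> forall eps : posreal, exists M : R, forall r, (M < r)%R ->
    ex_CInt f 0 r /\ (Cmod (CInt f 0 r - l) < eps)%R.
Proof.
intros H eps.
destruct (H (fun z => Cmod (z - l) < eps)%R) as [Q1 Q2 HQ1 [M HM] HQ].
{ apply locally_C. exists eps. intros y Hy. exact Hy. }
exists M. intros r Hr. destruct (HQ 0%R r HQ1 (HM r Hr)) as [y [Hy1 Hy2]]. simpl in Hy1.
split; [now exists y |].
replace (CInt f 0 r) with y; [exact Hy2 |]. symmetry. apply (is_RInt_unique (V := CV)). exact Hy1.
Qed.

Lemma is_I_unique (f : R -> C) (l : C) : is_I f l -> I0 f = l.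
Proof. apply (is_RInt_gen_unique (V := CV)). Qed.

Lemma is_I_correct (f : R -> C) : ex_I f -> is_I f (I0 f).
Proof. apply (RInt_gen_correct (V := CV)). Qed.

Lemma is_I_ext (f g : R -> C) (l : C) :
  (forall s, (0 < s)%R -> f s = g s) -> is_I f l -> is_I g l.
Proof.
intros H. apply (is_RInt_gen_ext (V := C_R_NormedModule)).
refine (Filter_prod _ _ _ (fun a => a = 0%R) (fun b => (0 < b)%R) _ _ _).
- reflexivity.
- exists 0%R. auto.
- intros a b -> Hb. simpl. intros x Hx. rewrite Rmin_left in Hx by lra. apply H. lra.
Qed.

Lemma is_I_plus (f g : R -> C) (l m : C) :
  is_I f l -> is_I g m -> is_I (fun s => f s + g s) (l + m).
Proof. exact (is_RInt_gen_plus (V := C_R_NormedModule) f g l m). Qed.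

Lemma is_RInt_gen_Cmult (Fa Fb : (R -> Prop) -> Prop) (FFa : Filter Fa) (FFb : Filter Fb)
  (c : C) (f : R -> C) (l : C) :
  is_RInt_gen (V := C_R_NormedModule) f Fa Fb l ->
  is_RInt_gen (V := C_R_NormedModule) (fun s => c * f s) Fa Fb (c * l).
Proof.
intros H P HP. apply locally_C in HP. destruct HP as [eps HP].
assert (He : (0 < eps / (Cmod c + 1))%R).
{ apply Rdiv_lt_0_compat; [apply cond_pos |]. pose proof (Cmod_ge_0 c). lra. }
assert (HQ : locally (T := C_UniformSpace) l (fun z => P (c * z))).
{ apply locally_C. exists (mkposreal _ He). intros y Hy. apply HP.
  change (Cmod (y - l) < eps / (Cmod c + 1))%R in Hy.
  change (Cmod (c * y - c * l) < eps)%R.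
  replace (c * y - c * l) with (c * (y - l)) by ring. rewrite Cmod_mult.
  pose proof (Cmod_ge_0 c). pose proof (Cmod_ge_0 (y - l)).
  apply Rle_lt_trans with ((Cmod c) * (eps / (Cmod c + 1)))%R.
  - apply Rmult_le_compat_l; lra.
  - apply Rlt_le_trans with ((Cmod c + 1) * (eps / (Cmod c + 1)))%R.
    + apply Rmult_lt_compat_r; lra.
    + right. field. lra. }
specialize (H _ HQ). unfold filtermapi in *.
revert H. apply filter_imp. intros [a b] [y [Hy1 Hy2]].
exists (c * y). split; [now apply is_CInt_mult | exact Hy2].
Qed.

Lemma is_I_mult (c : C) (f : R -> C) (l : C) : is_I f l -> is_I (fun s => c * f s) (c * l).
Proof. apply is_RInt_gen_Cmult; typeclasses eauto. Qed.

Lemma is_I_bound (f : R -> C) (l : C) (M : R) :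
  is_I f l -> (forall r, (0 <= r)%R -> ex_CInt f 0 r -> (Cmod (CInt f 0 r) <= M)%R) -> (Cmod l <= M)%R.
Proof.
intros H HM. apply le_epsilon. intros eps Heps.
destruct (is_I_lim f l H (mkposreal eps Heps)) as [N HN]. simpl in HN.
pose proof (Rmax_l N 0) as X1. pose proof (Rmax_r N 0) as X2.
destruct (HN (Rmax N 0 + 1)%R ltac:(lra)) as [E1 E2].
specialize (HM (Rmax N 0 + 1)%R ltac:(lra) E1).
set (J := CInt f 0 (Rmax N 0 + 1)) in *.
replace l with (J + - (J - l)) by ring.
eapply Rle_trans; [apply Cmod_triangle |]. rewrite Cmod_opp. lra.
Qed.

Lemma is_RInt_exp (k a b : R) : (k <> 0)%R ->
  is_RInt (fun s => exp (- k * s)) a b ((exp (- k * a) - exp (- k * b)) / k)%R.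
Proof.
intros Hk.
replace ((exp (- k * a) - exp (- k * b)) / k)%R
  with (minus ((fun s => - exp (- k * s) / k) b) ((fun s => - exp (- k * s) / k) a))%R
  by (unfold minus, plus, opp; simpl; field; exact Hk).
apply (is_RInt_derive (V := R_CompleteNormedModule) (fun s => - exp (- k * s) / k)%R).
- intros x _. auto_derive; [auto | field; exact Hk].
- intros x _. apply continuous_of_derive. auto_derive. auto.
Qed.

Lemma Cmod_CInt_exp_le (f : R -> C) (M k r a : R) :
  (0 < k)%R -> (0 <= M)%R -> (a <= r)%R -> ex_CInt f a r ->
  (forall s, (a <= s <= r)%R -> (Cmod (f s) <= M * exp (- k * s))%R) ->
  (Cmod (CInt f a r) <= M * exp (- k * a) / k)%R.
Proof.
intros Hk HM Hr Hf H.
pose proof (is_RInt_scal (V := R_NormedModule) _ a r M _ (is_RInt_exp k a r ltac:(lra))) as E.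
eapply Rle_trans; [apply (Cmod_CInt_le f (fun s => M * exp (- k * s))%R); auto |].
- eexists. exact E.
- apply (is_RInt_unique (V := R_CompleteNormedModule)) in E.
  match type of E with _ = ?v => replace (RInt _ _ _) with v by (symmetry; exact E) end.
  unfold scal; simpl; unfold mult; simpl.
  unfold Rdiv. rewrite <- Rmult_assoc. apply Rmult_le_compat_r.
  + left. now apply Rinv_0_lt_compat.
  + apply Rmult_le_compat_l; [exact HM |]. pose proof (exp_pos (- k * r)). lra.
Qed.

Lemma is_I_bound_exp (f : R -> C) (l : C) (M k : R) :
  (0 < k)%R -> (0 <= M)%R -> is_I f l ->
  (forall s, (0 <= s)%R -> (Cmod (f s) <= M * exp (- k * s))%R) -> (Cmod l <= M / k)%R.
Proof.
intros Hk HM Hf H. apply (is_I_bound f); [exact Hf |].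
intros r Hr Hr'.
replace M with (M * exp (- k * 0))%R by (rewrite Rmult_0_r, exp_0; ring).
apply Cmod_CInt_exp_le; auto. intros s Hs. apply H. lra.
Qed.

Lemma exp_decay_small (M : R) (eps : posreal) : exists N : R, forall r, (N < r)%R -> (M * exp (- r) < eps)%R.
Proof.
exists (Rabs M / eps)%R. intros r Hr.
pose proof (Rabs_pos M) as HM. pose proof (cond_pos eps) as He.
assert (H0 : (0 <= Rabs M / eps)%R) by (apply Rdiv_le_0_compat; lra).
pose proof (exp_ineq1 r ltac:(lra)) as H1.
assert (H2 : (Rabs M < eps * r)%R).
{ replace (Rabs M) with (eps * (Rabs M / eps))%R by (field; lra). apply Rmult_lt_compat_l; lra. }
rewrite exp_Ropp.
apply Rle_lt_trans with (Rabs M * / exp r)%R.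
- apply Rmult_le_compat_r; [left; apply Rinv_0_lt_compat, exp_pos | apply Rle_abs].
- apply Rmult_lt_reg_r with (exp r); [apply exp_pos |].
  rewrite Rmult_assoc, Rinv_l by (pose proof (exp_pos r); lra). nra.
Qed.

Lemma ex_I_exp (f : R -> C) (M : R) :
  (forall s, (0 <= s)%R -> ccont f s) ->
  (forall s, (0 <= s)%R -> (Cmod (f s) <= M * exp (- s))%R) -> ex_I f.
Proof.
intros Hc H.
assert (HM : (0 <= M)%R).
{ specialize (H 0%R ltac:(lra)). rewrite Ropp_0, exp_0 in H. pose proof (Cmod_ge_0 (f 0%R)). lra. }
assert (Hex : forall a r, (0 <= a)%R -> (0 <= r)%R -> ex_CInt f a r).
{ intros a r Ha Hr. apply ex_CInt_cont. intros x Hx. apply Hc.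
  revert Hx. unfold Rmin. destruct (Rle_dec a r); lra. }
destruct (proj1 (filterlim_locally_cauchy (U := C_R_CompleteNormedModule) (F := Rbar_locally p_infty) (fun r => CInt f 0 r))) as [z Hz].
{ intros eps. destruct (exp_decay_small M eps) as [N HN].
  exists (fun r => (Rmax N 0 < r)%R). split; [now exists (Rmax N 0) |].
  assert (W : forall u v : R, (Rmax N 0 < u)%R -> (u <= v)%R -> (Cmod (CInt f 0 v - CInt f 0 u) < eps)%R).
  { intros u v Hu Huv. pose proof (Rmax_l N 0). pose proof (Rmax_r N 0).
    assert (E : CInt f 0 v = CInt f 0 u + CInt f u v).
    { symmetry. apply (RInt_Chasles (V := CV)); apply Hex; lra. }
    assert (Simp : forall z w : C, z + w - z = w) by (intros; ring).
    rewrite E, Simp.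
    apply Rle_lt_trans with (M * exp (- (1) * u) / 1)%R.
    - apply Cmod_CInt_exp_le; try lra; [apply Hex; lra |].
      intros s Hs. replace (- (1) * s)%R with (- s)%R by ring. apply H. lra.
    - replace (M * exp (- (1) * u) / 1)%R with (M * exp (- u))%R by (rewrite Rdiv_1_r; do 2 f_equal; ring).
      apply HN. lra. }
  intros u v Hu Hv. apply C_NormedModule_mixin_compat1. change (Cmod (CInt f 0 v - CInt f 0 u) < eps)%R.
  destruct (Rle_dec u v) as [Huv | Huv]; [now apply W |].
  rewrite <- Cmod_opp, Copp_minus_distr. apply W; [assumption | lra]. }
exists z. apply is_I_eps.
- intros r Hr. apply Hex; lra.
- intros eps. pose proof (proj1 (filterlim_C_eps (Rbar_locally p_infty) _ (fun r => CInt f 0 r) z) Hz eps) as Hz'.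
  destruct Hz' as [N HN]. exists N. intros r Hr _. apply HN. exact Hr.
Qed.

(** The maximum of [- a s^2 + (b + m) s] is [(b + m)^2 / (4a)]. A Gaussian thus absorbs any linear
    exponent [b] and still leaves any prescribed exponential rate [m]. *)
Lemma exp_quadratic_le (a b m s : R) : (0 < a)%R ->
  (exp (- a * s ^ 2 + b * s) <= exp ((b + m) ^ 2 / (4 * a)) * exp (- m * s))%R.
Proof.
intros Ha. rewrite <- exp_plus. apply exp_le. apply Rmult_le_reg_l with (4 * a)%R; [lra |].
replace (4 * a * ((b + m) ^ 2 / (4 * a) + - m * s))%R with ((b + m) ^ 2 - 4 * a * m * s)%R by (field; lra).
pose proof (pow2_ge_0 (2 * a * s - (b + m))). nra.
Qed.

(** * The sector and rotation of the contour inside it *)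

Definition dir (a : R) : C := (cos a, sin a).

Lemma Cmod_dir (a : R) : Cmod (dir a) = 1%R.
Proof.
unfold Cmod, dir; simpl. pose proof (sin2_cos2 a) as E. unfold Rsqr in E.
replace (_ + _)%R with 1%R by lra. apply sqrt_1.
Qed.

(** For [0 < a < pi/2] this is the sector [S_a], written as an intersection of two half planes so
    that convexity and closedness become linear arithmetic. *)
Definition wedge (a : R) (z : C) : Prop :=
  (0 <= Im z)%R /\ (Im z * cos a <= Re z * sin a)%R.

Lemma wedge_convex (a : R) : convex (wedge a).
Proof.
intros [u1 u2] [v1 v2] s [H1 H2] [H3 H4] Hs. unfold wedge, Re, Im in *; simpl in *.
split; nra.
Qed.

Lemma half_plane_closed (p q c : R) (u : nat -> C) (z : C) :
  (forall eps : posreal, exists n, (Cmod (u n - z) < eps)%R) ->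
  (forall n, (0 <= p * Re (u n) + q * Im (u n) + c)%R) -> (0 <= p * Re z + q * Im z + c)%R.
Proof.
intros Hz H. apply le_epsilon. intros eps Heps.
pose proof (Rabs_pos p) as Hp. pose proof (Rabs_pos q) as Hq.
assert (He : (0 < eps / (Rabs p + Rabs q + 1))%R) by (apply Rdiv_lt_0_compat; lra).
destruct (Hz (mkposreal _ He)) as [n Hn]. simpl in Hn. specialize (H n).
pose proof (Rmax_Cmod (u n - z)) as HR.
pose proof (Rmax_l (Rabs (fst (u n - z))) (Rabs (snd (u n - z)))) as R1.
pose proof (Rmax_r (Rabs (fst (u n - z))) (Rabs (snd (u n - z)))) as R2.
set (e := (eps / (Rabs p + Rabs q + 1))%R) in *.
assert (E : (e * (Rabs p + Rabs q + 1) = eps)%R) by (unfold e; field; lra).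
assert (Q : forall v w : R, (Rabs w <= e)%R -> (v * w <= Rabs v * e)%R).
{ intros v w Hw. eapply Rle_trans; [apply Rle_abs |]. rewrite Rabs_mult.
  apply Rmult_le_compat_l; [apply Rabs_pos | exact Hw]. }
pose proof (Q p (Re (u n) - Re z)%R ltac:(change (Re (u n) - Re z)%R with (fst (u n - z)); lra)).
pose proof (Q q (Im (u n) - Im z)%R ltac:(change (Im (u n) - Im z)%R with (snd (u n - z)); lra)).
nra.
Qed.

Lemma wedge_closed (a : R) : seq_closed (wedge a).
Proof.
intros u z Hu Hz.
pose proof (half_plane_closed 0 1 0 u z Hz ltac:(intros n; destruct (Hu n); lra)).
pose proof (half_plane_closed (sin a) (- cos a) 0 u z Hz ltac:(intros n; destruct (Hu n); lra)).
split; lra.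
Qed.

Lemma acute_pos (a : R) : (0 < a < PI / 2)%R -> (0 < cos a /\ 0 < sin a)%R.
Proof.
intros H. pose proof PI_RGT_0. split; [apply cos_gt_0 | apply sin_gt_0]; lra.
Qed.

Lemma wedge_real (a r : R) : (0 < a < PI / 2)%R -> (0 <= r)%R -> wedge a (RtoC r).
Proof.
intros Ha Hr. destruct (acute_pos a Ha). unfold wedge, Re, Im; simpl. nra.
Qed.

Lemma wedge_dir (a r : R) : (0 < a < PI / 2)%R -> (0 <= r)%R -> wedge a (dir a * RtoC r).
Proof.
intros Ha Hr. destruct (acute_pos a Ha). unfold wedge, dir, Re, Im; simpl. nra.
Qed.

Lemma CInt_seg (f : C -> C) (e : C) (r : R) : (0 <= r)%R ->
  (forall s : R, (0 <= s <= r)%R -> ccont (fun s => f (e * RtoC s)) s) ->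
  seg f 0 (e * RtoC r) = e * CInt (fun s => f (e * RtoC s)) 0 r.
Proof.
intros Hr Hc. unfold seg.
destruct (CInt_comp_lin (fun s => f (e * RtoC s)) r 0 0 1) as [E _].
{ apply ex_CInt_cont. intros x Hx. apply Hc.
  rewrite Rmin_left, Rmax_right in Hx by lra. lra. }
replace (r * 0 + 0)%R with 0%R in E by ring. replace (r * 1 + 0)%R with r in E by ring.
rewrite <- E.
replace (CInt (fun s : R => f (0 + (e * r - 0) * s)) 0 1) with (CInt (fun y : R => f (e * (r * y + 0)%R)) 0 1).
- ring.
- apply (RInt_ext (V := CV)). intros x _. f_equal. rewrite RtoC_plus, RtoC_mult. ring.
Qed.

Lemma CInt_seg_real (f : C -> C) (r : R) : (0 <= r)%R ->
  (forall s : R, (0 <= s <= r)%R -> ccont (fun s => f (RtoC s)) s) ->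
  seg f 0 (RtoC r) = CInt (fun s => f (RtoC s)) 0 r.
Proof.
intros Hr Hc. rewrite <- (Cmult_1_l (RtoC r)), CInt_seg.
- rewrite Cmult_1_l. apply (RInt_ext (V := CV)). intros x _. now rewrite Cmult_1_l.
- exact Hr.
- intros s Hs. apply continuous_ext with (f := fun s => f (RtoC s)); [intros; now rewrite Cmult_1_l | auto].
Qed.

(** The chord from [r] to [r e^{ia}] replaces the customary circular arc. *)
Lemma chord_bound (a : R) (g : C -> C) (M k m r : R) :
  (0 < a < PI / 2)%R -> (0 < k)%R -> (0 <= M)%R -> (0 < r)%R -> (m < r * cos a)%R ->
  (forall z, wedge a z -> exists l, is_derive_C g z l) ->
  (forall z, wedge a z -> (Cmod (g z) <= M * exp (- k * Im z * (Re z - m)))%R) ->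
  (Cmod (seg g (RtoC r) (dir a * RtoC r)) <= 2 * M / (k * sin a * (r * cos a - m)))%R.
Proof.
intros Ha Hk HM Hr Hm Hg Hb. destruct (acute_pos a Ha) as [Hc Hs].
pose proof (COS_bound a) as [_ Hc1].
assert (D1 : wedge a (RtoC r)) by (apply wedge_real; auto; lra).
assert (D2 : wedge a (dir a * RtoC r)) by (apply wedge_dir; auto; lra).
unfold seg. rewrite Cmod_mult.
(* On the chord [Im z = s r sin a] and [Re z >= r cos a], so the exponent is at most [- lam s]. The
   parameter integral is then at most [M / lam], and the chord at most [2 r] long. *)
set (lam := (k * sin a * (r * cos a - m) * r)%R).
assert (Hks : (0 < k * sin a)%R) by now apply Rmult_lt_0_compat.
assert (Hks' : (0 < k * sin a * (r * cos a - m))%R) by (apply Rmult_lt_0_compat; lra).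
assert (Hlam : (0 < lam)%R) by (now apply Rmult_lt_0_compat).
assert (Hlen : (Cmod (dir a * RtoC r - RtoC r) <= 2 * r)%R).
{ eapply Rle_trans; [apply Cmod_triangle |]. rewrite Cmod_opp, Cmod_mult, !Cmod_R, Rabs_pos_eq by lra.
  rewrite Cmod_dir. lra. }
assert (Hint : (Cmod (CInt (fun s : R => g (RtoC r + (dir a * RtoC r - RtoC r) * RtoC s)%C) 0 1) <= M / lam)%R).
{ replace M with (M * exp (- lam * 0))%R by (rewrite Rmult_0_r, exp_0; ring).
  apply Cmod_CInt_exp_le; auto; try lra.
  - apply seg_cont_ex; try lra. eapply seg_cont_holomorphic; eauto using wedge_convex.
  - intros s Hss.
    eapply Rle_trans; [apply Hb; apply wedge_convex; auto |].
    apply Rmult_le_compat_l; [exact HM |].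
    apply exp_le. unfold lam, dir, Re, Im; simpl.
    assert (X : (k * (r * sin a * s) * (r * cos a - m) <= k * (r * sin a * s) * (r + (cos a * r - r) * s - m))%R).
    { apply Rmult_le_compat_l.
      - repeat apply Rmult_le_pos; lra.
      - assert (0 <= r * (1 - cos a) * (1 - s))%R by (repeat apply Rmult_le_pos; lra). nra. }
    nra. }
apply Rle_trans with (2 * r * (M / lam))%R.
- apply Rmult_le_compat; auto; apply Cmod_ge_0.
- right. unfold lam. field. repeat split; lra.
Qed.

(** The bound is that of [e^(i (x + z)^2 / 4t) F(z)], with the shift [x] and the growth of [F]
    absorbed into [m]. It gives no decay for real [z] but Gaussian decay on the ray; convergence on
    the real axis is inherited from the ray, because the two truncated integrals differ by the
    chord, which is [O(1 / r)]. *)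
Theorem contour_rotation (a : R) (g : C -> C) (M k m : R) :
  (0 < a < PI / 2)%R -> (0 < k)%R -> (0 <= M)%R ->
  (forall z, wedge a z -> exists l, is_derive_C g z l) ->
  (forall z, wedge a z -> (Cmod (g z) <= M * exp (- k * Im z * (Re z - m)))%R) ->
  exists l, is_I (fun s => dir a * g (dir a * RtoC s)) l /\ is_I (fun y => g (RtoC y)) l.
Proof.
intros Ha Hk HM Hg Hb. destruct (acute_pos a Ha) as [Hc Hs].
assert (Hray : forall s, (0 <= s)%R -> ccont (fun s => g (dir a * RtoC s)) s).
{ intros s Hs0. now apply ccont_ray, Hg, wedge_dir. }
assert (Hreal : forall s, (0 <= s)%R -> ccont (fun s => g (RtoC s)) s).
{ intros s Hs0. now apply ccont_real, Hg, wedge_real. }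
assert (Hex : ex_I (fun s => g (dir a * RtoC s))).
{ assert (Hksc : (0 < k * sin a * cos a)%R) by (repeat apply Rmult_lt_0_compat; lra).
  apply ex_I_exp with (M := (M * exp ((k * sin a * m + 1) ^ 2 / (4 * (k * sin a * cos a))))%R); [exact Hray |].
  intros s Hs0. eapply Rle_trans; [apply Hb; now apply wedge_dir |].
  rewrite (Rmult_assoc M (exp _)). apply Rmult_le_compat_l; [exact HM |].
  replace (- s)%R with (- (1) * s)%R by ring.
  eapply Rle_trans; [| now apply exp_quadratic_le].
  right. f_equal. unfold dir, Re, Im; simpl. ring. }
pose proof (is_I_mult (dir a) _ _ (is_I_correct _ Hex)) as Hrot.
set (l := dir a * I0 (fun s => g (dir a * RtoC s))) in *.
exists l. split; [exact Hrot |].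
apply is_I_eps.
- intros r Hr. apply ex_CInt_cont. intros x Hx. apply Hreal. rewrite Rmin_left in Hx by lra. lra.
- intros eps.
  destruct (is_I_lim _ _ Hrot (pos_div_2 eps)) as [N1 HN1]. simpl in HN1.
  set (K := (2 * M / (k * sin a))%R).
  assert (HK : (0 <= K)%R).
  { unfold K. apply Rdiv_le_0_compat; [lra |]. now apply Rmult_lt_0_compat. }
  (* Beyond [N2] the chord contributes at most [K / (r cos a - m) < eps / 2]. *)
  set (N2 := ((Rabs m + K / (eps / 2) + 1) / cos a)%R).
  exists (Rmax (Rmax N1 N2) 0). intros r Hr _.
  pose proof (Rmax_l (Rmax N1 N2) 0). pose proof (Rmax_r (Rmax N1 N2) 0).
  pose proof (Rmax_l N1 N2). pose proof (Rmax_r N1 N2).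
  destruct (HN1 r ltac:(lra)) as [E1 E2].
  pose proof (goursat (wedge a) g 0 (RtoC r) (dir a * RtoC r) (wedge_convex a) (wedge_closed a) Hg
    (wedge_real a 0 Ha ltac:(lra)) (wedge_real a r Ha ltac:(lra)) (wedge_dir a r Ha ltac:(lra))) as G.
  unfold tri in G.
  assert (S0 : seg_cont g 0 (dir a * RtoC r)).
  { eapply seg_cont_holomorphic; eauto using wedge_convex.
    - apply (wedge_real a 0 Ha); lra.
    - apply wedge_dir; auto; lra. }
  rewrite (seg_swap g 0 (dir a * RtoC r) S0) in G.
  rewrite (CInt_seg g (dir a) r ltac:(lra)) in G by (intros; apply Hray; lra).
  rewrite CInt_seg_real in G by (try lra; intros; apply Hreal; lra).
  rewrite CInt_mult in E2.
  2: { apply ex_CInt_cont. intros x Hx. apply Hray. rewrite Rmin_left in Hx by lra. lra. }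
  set (J1 := CInt (fun s => g (RtoC s)) 0 r) in *.
  set (J2 := CInt (fun s => g (dir a * RtoC s)) 0 r) in *.
  set (J3 := seg g (RtoC r) (dir a * RtoC r)) in *.
  assert (Hrc : (Rabs m + K / (eps / 2) + 1 < r * cos a)%R).
  { replace (Rabs m + K / (eps / 2) + 1)%R with (N2 * cos a)%R
      by (unfold N2; field; pose proof (cond_pos eps); split; lra).
    apply Rmult_lt_compat_r; lra. }
  pose proof (Rle_abs m) as Hm. pose proof (cond_pos eps) as Hep.
  assert (HK2 : (0 <= K / (eps / 2))%R) by (apply Rdiv_le_0_compat; lra).
  assert (HJ3 : (Cmod J3 < eps / 2)%R).
  { eapply Rle_lt_trans; [apply (chord_bound a g M k m r); auto; lra |].
    replace (2 * M / (k * sin a * (r * cos a - m)))%R with (K / (r * cos a - m))%R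
      by (unfold K; field; lra).
    apply Rmult_lt_reg_r with (r * cos a - m)%R; [lra |].
    unfold Rdiv at 1. rewrite Rmult_assoc, Rinv_l, Rmult_1_r by lra.
    replace K with (eps / 2 * (K / (eps / 2)))%R at 1 by (field; lra).
    apply Rmult_lt_compat_l; lra. }
  replace (J1 - l) with ((dir a * J2 - l) + - J3).
  2: { transitivity ((dir a * J2 - l) + - J3 + 0); [ring |]. rewrite <- G. ring. }
  eapply Rle_lt_trans; [apply Cmod_triangle |]. rewrite Cmod_opp. lra.
Qed.

(** * The complementary error function *)

Lemma cexp_pair (z : C) : cexp z = (exp (Re z) * cos (Im z), exp (Re z) * sin (Im z))%R.
Proof. unfold cexp. apply injective_projections; simpl; ring. Qed.

Lemma cexp_plus (z w : C) : cexp (z + w) = cexp z * cexp w.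
Proof.
rewrite !cexp_pair.
change (Re (z + w)) with (Re z + Re w)%R. change (Im (z + w)) with (Im z + Im w)%R.
rewrite exp_plus, cos_plus, sin_plus.
apply injective_projections; simpl; ring.
Qed.

Lemma cexp_0 : cexp 0 = 1.
Proof. rewrite cexp_pair. simpl. rewrite exp_0, cos_0, sin_0. apply injective_projections; simpl; ring. Qed.

Lemma cexp_opp (z : C) : cexp z * cexp (- z) = 1.
Proof. rewrite <- cexp_plus, <- cexp_0. f_equal. ring. Qed.

Lemma cexp_R (x : R) : cexp (RtoC x) = RtoC (exp x).
Proof. rewrite cexp_pair. simpl. rewrite cos_0, sin_0. apply injective_projections; simpl; ring. Qed.

Lemma Cmod_cexp (z : C) : Cmod (cexp z) = exp (Re z).
Proof.
unfold cexp. rewrite Cmod_mult, Cmod_R, Rabs_pos_eq by (left; apply exp_pos).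
replace (Cmod (cos (Im z), sin (Im z))) with 1%R; [ring |].
unfold Cmod; simpl. pose proof (sin2_cos2 (Im z)) as E. unfold Rsqr in E.
replace (_ + _)%R with 1%R by lra. now rewrite sqrt_1.
Qed.

Lemma cexp_neq_0 (z : C) : cexp z <> 0.
Proof. apply Cmod_gt_0. rewrite Cmod_cexp. apply exp_pos. Qed.

Lemma is_derive_RC_cexp_ray (h : C) (p : R) :
  is_derive_RC (fun p => cexp (h * RtoC p)) p (h * cexp (h * RtoC p)).
Proof.
apply is_derive_RC_split. split.
- apply (is_derive_ext (fun p => exp (Re h * p) * cos (Im h * p))%R).
  { intros q. rewrite cexp_pair. unfold Re, Im; simpl. f_equal; f_equal; ring. }
  rewrite cexp_pair. auto_derive; [auto |]. unfold Re, Im; simpl.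
  replace (fst h * p - snd h * 0)%R with (fst h * p)%R by ring.
  replace (fst h * 0 + snd h * p)%R with (snd h * p)%R by ring. ring.
- apply (is_derive_ext (fun p => exp (Re h * p) * sin (Im h * p))%R).
  { intros q. rewrite cexp_pair. unfold Re, Im; simpl. f_equal; f_equal; ring. }
  rewrite cexp_pair. auto_derive; [auto |]. unfold Re, Im; simpl.
  replace (fst h * p - snd h * 0)%R with (fst h * p)%R by ring.
  replace (fst h * 0 + snd h * p)%R with (snd h * p)%R by ring. ring.
Qed.

Lemma Cmod_Re_le (z : C) : (Re z <= Cmod z)%R.
Proof. eapply Rle_trans; [apply Rle_abs | apply re_le_Cmod]. Qed.

(** This is [taylor_bound] for [p |-> e^(hp)] on [[0, 1]]; the factor [Cmod h ^ 2] comes from its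
    second derivative. *)
Lemma cexp_taylor (h : C) : (Cmod (cexp h - 1 - h) <= Cmod h ^ 2 * exp (Cmod h))%R.
Proof.
pose proof (taylor_bound (fun p => cexp (h * RtoC p)) (fun p => h * cexp (h * RtoC p))
  (fun p => h * (h * cexp (h * RtoC p))) 0 1 (Cmod h ^ 2 * exp (Cmod h))) as T.
rewrite Rmin_left, Rmax_right in T by lra.
replace (cexp h - 1 - h) with (cexp (h * 1) - cexp (h * 0) - (1 - 0)%R * (h * cexp (h * 0))).
2: { rewrite Cmult_0_r, cexp_0, Cmult_1_r, Rminus_0_r. ring. }
eapply Rle_trans; [apply T |].
- intros x _. apply is_derive_RC_cexp_ray.
- intros x _. apply is_derive_RC_scal, is_derive_RC_cexp_ray.
- intros x _. eapply is_derive_RC_cont. apply is_derive_RC_scal, is_derive_RC_scal, is_derive_RC_cexp_ray.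
- intros x Hx. rewrite !Cmod_mult, Cmod_cexp.
  replace (Cmod h ^ 2 * exp (Cmod h))%R with (Cmod h * (Cmod h * exp (Cmod h)))%R by ring.
  repeat (apply Rmult_le_compat_l; [apply Cmod_ge_0 |]).
  apply exp_le. eapply Rle_trans; [apply Cmod_Re_le |]. rewrite Cmod_mult, Cmod_R, Rabs_pos_eq by lra.
  pose proof (Cmod_ge_0 h). nra.
- rewrite Rminus_0_r, Rabs_R1. right. ring.
Qed.

Lemma is_derive_C_cexp (z : C) : is_derive_C cexp z (cexp z).
Proof.
apply is_derive_C_eps. intros eps.
set (K := (Cmod (cexp z) * exp 1 + 1)%R).
assert (HK : (1 <= K)%R).
{ unfold K. pose proof (Cmod_ge_0 (cexp z)). pose proof (exp_pos 1). nra. }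
assert (Hd : (0 < Rmin 1 (eps / K))%R).
{ apply Rmin_pos; [lra | apply Rdiv_lt_0_compat; [apply cond_pos | lra]]. }
exists (mkposreal _ Hd). simpl. intros w Hw.
pose proof (Rmin_l 1 (eps / K)). pose proof (Rmin_r 1 (eps / K)).
set (h := w - z) in *.
replace (cexp w) with (cexp z * cexp h) by (rewrite <- cexp_plus; f_equal; unfold h; ring).
replace (cexp z * cexp h - cexp z - h * cexp z) with (cexp z * (cexp h - 1 - h)) by ring.
rewrite Cmod_mult. pose proof (Cmod_ge_0 h) as Hh. pose proof (Cmod_ge_0 (cexp z)) as Hz.
apply Rle_trans with (Cmod (cexp z) * (Cmod h ^ 2 * exp 1))%R.
- apply Rmult_le_compat_l; [exact Hz |]. eapply Rle_trans; [apply cexp_taylor |].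
  apply Rmult_le_compat_l; [nra |]. apply exp_le. lra.
- apply Rle_trans with (K * (eps / K) * Cmod h)%R.
  + replace (Cmod (cexp z) * (Cmod h ^ 2 * exp 1))%R with (Cmod (cexp z) * exp 1 * (Cmod h * Cmod h))%R by ring.
    apply Rle_trans with (K * (Cmod h * Cmod h))%R.
    * apply Rmult_le_compat_r; [nra | unfold K; lra].
    * rewrite Rmult_assoc. apply Rmult_le_compat_l; [lra |]. apply Rmult_le_compat_r; lra.
  + right. field. lra.
Qed.

Lemma is_derive_RC_cexp (f : R -> C) (x : R) (l : C) :
  is_derive_RC f x l -> is_derive_RC (fun y => cexp (f y)) x (l * cexp (f x)).
Proof. apply (is_derive_RC_comp_C cexp f), is_derive_C_cexp. Qed.

(** * Primitives of entire functions and differentiability of erf *)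

Lemma seg_const (c a b : C) : seg (fun _ => c) a b = c * (b - a).
Proof.
rewrite (seg_primitive (fun z => 0 + c * z) (fun _ => c)).
- ring.
- intros s _. apply is_derive_C_affine.
- intros s _. apply ccont_const.
Qed.

Lemma whole_convex : convex (fun _ => True).
Proof. intros a b s _ _ _. exact Logic.I. Qed.

Lemma whole_closed : seq_closed (fun _ => True).
Proof. intros u z _ _. exact Logic.I. Qed.

Lemma seg_cont_entire (f df : C -> C) (a b : C) :
  (forall z, is_derive_C f z (df z)) -> seg_cont f a b.
Proof.
intros Hf. apply (seg_cont_holomorphic (fun _ => True)); auto using whole_convex.
intros z _. now exists (df z).
Qed.

Lemma seg_chasles_entire (f df : C -> C) (a b c : C) :
  (forall z, is_derive_C f z (df z)) -> seg f a b + seg f b c = seg f a c.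
Proof.
intros Hf.
assert (G : tri f a b c = 0).
{ apply (goursat (fun _ => True)); auto using whole_convex, whole_closed.
  intros z _. now exists (df z). }
unfold tri in G. rewrite (seg_swap f a c) in G by now apply (seg_cont_entire f df).
transitivity (seg f a b + seg f b c + - seg f a c + seg f a c); [ring |].
rewrite G. ring.
Qed.

(** By path independence the error of the linear approximation is the integral of [f - f z] over the
    segment from [z] to [w], where [f] is Lipschitz at [z] with constant [Cmod (df z) + 1]. *)
Lemma is_derive_C_seg (f df : C -> C) (z0 z : C) :
  (forall z, is_derive_C f z (df z)) -> is_derive_C (fun w => seg f z0 w) z (f z).
Proof.
intros Hf. apply is_derive_C_eps. intros eps.
pose proof (proj1 (is_derive_C_eps _ _ _) (Hf z) (mkposreal 1 Rlt_0_1)) as [d Hd]. simpl in Hd.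
pose proof (Cmod_ge_0 (df z)) as Hdf.
assert (Hd' : (0 < Rmin d (eps / (Cmod (df z) + 1)))%R).
{ apply Rmin_pos; [apply cond_pos | apply Rdiv_lt_0_compat; [apply cond_pos | lra]]. }
exists (mkposreal _ Hd'). simpl. intros w Hw.
pose proof (Rmin_l d (eps / (Cmod (df z) + 1))). pose proof (Rmin_r d (eps / (Cmod (df z) + 1))).
replace (seg f z0 w - seg f z0 z - (w - z) * f z)
  with (seg (fun y => f y + - f z) z w).
2: { rewrite seg_plus.
     - rewrite seg_const, <- (seg_chasles_entire f df z0 z w) by exact Hf. ring.
     - now apply (seg_cont_entire f df).
     - intros s _. apply ccont_const. }
rewrite Rmult_comm. apply seg_bound.
- intros s Hs. apply ccont_plus; [now apply (seg_cont_entire f df) | apply ccont_const].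
- intros s Hs. set (y := z + (w - z) * s).
  assert (Hy : (Cmod (y - z) <= Cmod (w - z))%R).
  { unfold y. replace (z + (w - z) * s - z) with ((w - z) * s) by ring.
    rewrite Cmod_mult, Cmod_R, Rabs_pos_eq by lra. pose proof (Cmod_ge_0 (w - z)). nra. }
  replace (f y + - f z) with ((f y - f z - (y - z) * df z) + (y - z) * df z) by ring.
  eapply Rle_trans; [apply Cmod_triangle |]. rewrite Cmod_mult.
  specialize (Hd y ltac:(lra)).
  apply Rle_trans with ((eps / (Cmod (df z) + 1)) * (Cmod (df z) + 1))%R.
  + pose proof (Cmod_ge_0 (y - z)). nra.
  + right. field. lra.
Qed.

Definition gauss (z : C) : C := cexp (- z ^ 2).

Lemma is_derive_C_gauss (z : C) : is_derive_C gauss z (- 2 * z * gauss z).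
Proof.
pose proof (is_derive_C_comp cexp (fun z => RtoC (-1) * (z * z)) z _ _ (is_derive_C_cexp _)
  (is_derive_C_mult (fun _ => RtoC (-1)) (fun z => z * z) z _ _ (is_derive_C_const _ z)
    (is_derive_C_mult _ _ z _ _ (is_derive_C_id z) (is_derive_C_id z)))) as H.
assert (E : forall w, RtoC (-1) * (w * w) = - w ^ 2).
{ intros w. apply injective_projections; simpl; ring. }
replace (- 2 * z * gauss z) with ((0 * (z * z) + RtoC (-1) * (1 * z + z * 1)) * cexp (RtoC (-1) * (z * z))).
2: { unfold gauss. rewrite E. f_equal. apply injective_projections; simpl; ring. }
apply (is_derive_ext (K := C_AbsRing) (V := C_NormedModule) (fun z => cexp (RtoC (-1) * (z * z)))); [| exact H].
intros w. unfold gauss. now rewrite E.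
Qed.

Lemma cerf_seg (z : C) : cerf z = 2 / sqrt PI * seg gauss 0 z.
Proof.
unfold cerf, seg. f_equal.
rewrite <- CInt_mult.
- apply (RInt_ext (V := CV)). intros s _. unfold gauss.
  replace (0 + (z - 0) * s) with (s * z) by ring. ceq. ring.
- apply (seg_cont_ex gauss 0 z 0 1); [lra | lra |]. apply (seg_cont_entire gauss _ _ _ is_derive_C_gauss).
Qed.

Lemma is_derive_C_cerf (z : C) : is_derive_C cerf z (2 / sqrt PI * gauss z).
Proof.
pose proof (is_derive_C_mult (fun _ => 2 / sqrt PI) (fun w => seg gauss 0 w) z 0 (gauss z)
  (is_derive_C_const _ z) (is_derive_C_seg gauss _ 0 z is_derive_C_gauss)) as H.
replace (2 / sqrt PI * gauss z) with (0 * seg gauss 0 z + 2 / sqrt PI * gauss z) by ring.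
apply (is_derive_ext (K := C_AbsRing) (V := C_NormedModule) (fun z => 2 / sqrt PI * seg gauss 0 z)); [| exact H].
intros w. symmetry. apply cerf_seg.
Qed.

(** * The Gaussian integral *)

Lemma gauss_R (x : R) : gauss (RtoC x) = RtoC (exp (- x ^ 2)).
Proof. unfold gauss. rewrite <- cexp_R. f_equal. apply injective_projections; simpl; ring. Qed.

Lemma seg_gauss_R (x : R) : seg gauss 0 (RtoC x) = RtoC (x * RInt (fun s => exp (- (x * s) ^ 2)) 0 1)%R.
Proof.
unfold seg. rewrite RtoC_mult. f_equal; [ring |].
assert (E : is_CInt (fun s => RtoC (exp (- (x * s) ^ 2))) 0 1 (RtoC (RInt (fun s => exp (- (x * s) ^ 2)) 0 1))).
{ apply is_RInt_fct_extend_pair; simpl.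
  - apply (RInt_correct (V := R_CompleteNormedModule)). apply (ex_RInt_continuous (V := R_CompleteNormedModule)).
    intros z _. apply continuous_of_derive. auto_derive. auto.
  - pose proof (is_RInt_const (V := R_NormedModule) 0 1 0%R) as H.
    unfold scal in H; simpl in H; unfold mult in H; simpl in H. rewrite Rmult_0_r in H. exact H. }
rewrite <- (is_RInt_unique (V := CV) _ _ _ _ E).
apply (RInt_ext (V := CV)). intros s _. rewrite <- RtoC_minus, <- RtoC_mult, <- RtoC_plus, gauss_R.
f_equal. f_equal. ring.
Qed.

(** Differentiation in [q] cancels the denominator and leaves [- 2 q] times a product of two
    Gaussians, in [q] and in [q s]; at [q = 0] it is the derivative of the arctangent. *)
Definition gauss_aux (q s : R) : R := (exp (- q ^ 2 * (1 + s ^ 2)) / (1 + s ^ 2))%R.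

Definition gauss_aux_int (q : R) : C :=
  RInt_gen (V := CV) (fun s => RtoC (gauss_aux q s)) (at_point 0) (at_point 1).

Lemma ccont_RtoC_derive (f : R -> R) (x : R) : ex_derive f x -> ccont (fun y => RtoC (f y)) x.
Proof. intros H. now apply ccont_RtoC, continuous_of_derive. Qed.

Lemma RInt_gen_01 (f : R -> C) (l : C) : is_CInt f 0 1 l ->
  RInt_gen (V := CV) f (at_point 0) (at_point 1) = l.
Proof.
intros H. apply (is_RInt_gen_unique (V := CV)). now apply is_RInt_gen_at_point.
Qed.

Lemma ex_RInt_gen_01 (f : R -> C) : (forall s, ccont f s) ->
  ex_RInt_gen (V := C_R_NormedModule) f (at_point 0) (at_point 1).
Proof.
intros H. destruct (ex_CInt_cont f 0 1) as [l Hl]; [auto |].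
exists l. now apply is_RInt_gen_at_point.
Qed.

Lemma is_derive_RC_gauss_aux_int (x : R) :
  is_derive_RC gauss_aux_int x (- 2 * gauss (RtoC x) * seg gauss 0 (RtoC x)).
Proof.
set (df := fun q s : R => RtoC (- 2 * q * exp (- q ^ 2 * (1 + s ^ 2)))%R).
assert (Hint : RInt_gen (V := CV) (df x) (at_point 0) (at_point 1) =
   - 2 * gauss (RtoC x) * seg gauss 0 (RtoC x)).
{ unfold seg. apply RInt_gen_01.
  assert (E : is_CInt (fun s => (- 2 * gauss (RtoC x) * RtoC x) * gauss (0 + (RtoC x - 0) * RtoC s)) 0 1
    ((- 2 * gauss (RtoC x) * RtoC x) * CInt (fun s => gauss (0 + (RtoC x - 0) * RtoC s)) 0 1)).
  { apply is_CInt_mult. apply (RInt_correct (V := CV)).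
    apply (seg_cont_ex gauss 0 x 0 1); [lra | lra |]. apply (seg_cont_entire gauss _ _ _ is_derive_C_gauss). }
  replace (- 2 * gauss (RtoC x) * ((RtoC x - 0) * CInt (fun s => gauss (0 + (RtoC x - 0) * RtoC s)) 0 1))
    with ((- 2 * gauss (RtoC x) * RtoC x) * CInt (fun s => gauss (0 + (RtoC x - 0) * RtoC s)) 0 1) by ring.
  revert E. apply is_RInt_ext. intros s _. unfold df.
  rewrite <- RtoC_minus, <- RtoC_mult, <- RtoC_plus, !gauss_R, <- !RtoC_mult. f_equal.
  replace (- 2 * exp (- x ^ 2) * x * exp (- (0 + (x - 0) * s) ^ 2))%R
    with (- 2 * x * (exp (- x ^ 2) * exp (- (0 + (x - 0) * s) ^ 2)))%R by ring.
  rewrite <- exp_plus. f_equal. f_equal. ring. }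
rewrite <- Hint.
refine (is_derive_RC_integral (at_point 1%R) _ (fun s => 0 <= s <= 1)%R (fun _ => 1%R) 1%R _
  (fun q s => RtoC (gauss_aux q s)) df
  (fun q s => RtoC ((- 2 + 4 * (q ^ 2 * (1 + s ^ 2))) * exp (- q ^ 2 * (1 + s ^ 2)))%R)
  x (mkposreal 1 Rlt_0_1) 6%R _ _ _).
- intros g l M Hg HM. apply is_RInt_gen_at_point in Hg.
  rewrite <- (is_RInt_unique (V := CV) _ _ _ _ Hg).
  replace (M * 1)%R with (M * (1 - 0))%R by ring.
  apply Cmod_CInt_le_const; [lra | now exists l |]. intros s Hs. specialize (HM s Hs). lra.
- intros q _. apply ex_RInt_gen_01. intros s. apply ccont_RtoC_derive. unfold gauss_aux.
  auto_derive. nra.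
- apply ex_RInt_gen_01. intros s. apply ccont_RtoC_derive. auto_derive. auto.
- intros q s _ Hs. assert (Hw : (1 + s ^ 2 <> 0)%R) by nra.
  split; [| split; [| split]].
  + apply is_derive_RC_RtoC. unfold gauss_aux. auto_derive; [nra |].
    replace (- (q * (q * 1)) * (1 + s * (s * 1)))%R with (- q ^ 2 * (1 + s ^ 2))%R by ring.
    field. nra.
  + apply is_derive_RC_RtoC. unfold df. auto_derive; [auto |].
    replace (- (q * (q * 1)) * (1 + s * (s * 1)))%R with (- q ^ 2 * (1 + s ^ 2))%R by ring. ring.
  + apply ccont_RtoC_derive. auto_derive. auto.
  + rewrite Cmod_R. replace (- q ^ 2 * (1 + s ^ 2))%R with (- (q ^ 2 * (1 + s ^ 2)))%R by ring.
    (* The constant 6 comes from [2 + 4 u <= 6 (1 + u) <= 6 e^u]. *)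
    set (u := (q ^ 2 * (1 + s ^ 2))%R).
    assert (Hu : (0 <= u)%R) by (unfold u; apply Rmult_le_pos; nra).
    rewrite Rabs_mult, (Rabs_pos_eq (exp _)) by (left; apply exp_pos).
    apply Rle_trans with ((2 + 4 * u) * exp (- u))%R.
    * apply Rmult_le_compat_r; [left; apply exp_pos |]. apply Rabs_le. lra.
    * rewrite exp_Ropp. pose proof (exp_pos u) as He.
      pose proof (exp_ineq1_le u) as H1.
      apply Rmult_le_reg_r with (exp u); [exact He |].
      rewrite Rmult_assoc, Rinv_l, Rmult_1_r by lra. nra.
Qed.

Lemma gauss_aux_int_bound (x : R) : (Cmod (gauss_aux_int x) <= exp (- x ^ 2))%R.
Proof.
assert (Hc : forall s, ccont (fun s => RtoC (gauss_aux x s)) s).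
{ intros s. apply ccont_RtoC_derive. unfold gauss_aux. auto_derive. nra. }
assert (Hex : ex_CInt (fun s => RtoC (gauss_aux x s)) 0 1) by (apply ex_CInt_cont; auto).
unfold gauss_aux_int. rewrite (RInt_gen_01 _ _ (RInt_correct (V := CV) _ _ _ Hex)).
replace (exp (- x ^ 2)) with (exp (- x ^ 2) * (1 - 0))%R by ring.
apply Cmod_CInt_le_const; [lra | exact Hex |].
intros s Hs. rewrite Cmod_R. unfold gauss_aux.
assert (Hw : (1 <= 1 + s ^ 2)%R) by nra.
rewrite Rabs_pos_eq by (apply Rdiv_le_0_compat; [left; apply exp_pos | lra]).
apply Rmult_le_reg_r with (1 + s ^ 2)%R; [lra |].
unfold Rdiv. rewrite Rmult_assoc, Rinv_l, Rmult_1_r by lra.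
assert (He : (exp (- x ^ 2 * (1 + s ^ 2)) <= exp (- x ^ 2))%R).
{ apply exp_le. pose proof (pow2_ge_0 x). nra. }
pose proof (exp_pos (- x ^ 2)). nra.
Qed.

Lemma gauss_aux_int_0 : gauss_aux_int 0 = RtoC (PI / 4).
Proof.
unfold gauss_aux_int. apply RInt_gen_01.
pose proof (is_CInt_derive (fun s => RtoC (atan s)) (fun s => RtoC (gauss_aux 0 s)) 0 1) as H.
cbv beta in H. rewrite atan_1, atan_0 in H.
replace (RtoC (PI / 4)) with (RtoC (PI / 4) - RtoC 0) by ring. apply H.
- intros x _. apply is_derive_RC_RtoC. unfold gauss_aux.
  replace (- 0 ^ 2 * (1 + x ^ 2))%R with 0%R by ring. rewrite exp_0.
  auto_derive; [auto |]. unfold Rsqr. field. nra.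
- intros x _. apply ccont_RtoC_derive. unfold gauss_aux. auto_derive. nra.
Qed.

(** The two summands have opposite derivatives; as [x] tends to infinity the
    second one vanishes, which leaves the Gaussian integral. *)
Lemma gauss_square (x : R) :
  seg gauss 0 (RtoC x) * seg gauss 0 (RtoC x) + gauss_aux_int x = RtoC (PI / 4).
Proof.
set (h := fun x : R => seg gauss 0 (RtoC x) * seg gauss 0 (RtoC x) + gauss_aux_int x).
assert (Hh : forall x, is_derive_RC h x 0).
{ intros y.
  assert (D : is_derive_RC (fun x : R => seg gauss 0 (RtoC x)) y (gauss (RtoC y))).
  { replace (gauss (RtoC y)) with (RtoC 1 * gauss (RtoC y)) by ring.
    apply (is_derive_RC_comp_C (fun w => seg gauss 0 w) RtoC).
    - apply (is_derive_C_seg gauss _ 0 _ is_derive_C_gauss).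
    - apply is_derive_RC_RtoC, (is_derive_id (K := R_AbsRing)). }
  pose proof (is_derive_RC_plus _ _ _ _ _ (is_derive_RC_mult _ _ _ _ _ D D) (is_derive_RC_gauss_aux_int y)) as H.
  derive_eq H. ring. }
assert (E : h x - h 0%R = 0).
{ apply Cmod_eq_0. apply Rle_antisym; [| apply Cmod_ge_0].
  replace 0%R with (0 * Rabs (x - 0))%R at 2 by ring.
  apply (mean_value_bound h (fun _ => RtoC 0)); auto.
  - intros y _. apply ccont_const.
  - intros y _. rewrite Cmod_0. lra. }
assert (E0 : h 0%R = RtoC (PI / 4)).
{ unfold h. rewrite gauss_aux_int_0, seg_gauss_R, Rmult_0_l. ring. }
change (h x = RtoC (PI / 4)). rewrite <- E0.
transitivity (h x - h 0%R + h 0%R); [ring |]. rewrite E. ring.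
Qed.

Lemma sqrt_PI_pos : (0 < sqrt PI)%R.
Proof. apply sqrt_lt_R0, PI_RGT_0. Qed.

Lemma RtoC_neq_0 (x : R) : x <> 0%R -> RtoC x <> 0.
Proof. intros H E. apply H. now injection E. Qed.

(** By [gauss_square], [r^2 - pi/4] is at most [exp (- x^2)] in modulus. It factors as
    [(r - sqrt pi / 2) (r + sqrt pi / 2)], and [r >= 0] keeps the second factor away from zero. *)
Lemma seg_gauss_lim (x : R) : (0 <= x)%R ->
  (Cmod (seg gauss 0 (RtoC x) - RtoC (sqrt PI / 2)) <= 2 / sqrt PI * exp (- x ^ 2))%R.
Proof.
intros Hx. pose proof (gauss_square x) as E. pose proof sqrt_PI_pos as Hpi.
rewrite seg_gauss_R in *.
set (r := (x * RInt (fun s => exp (- (x * s) ^ 2)) 0 1)%R) in *.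
assert (Hr : (0 <= r)%R).
{ apply Rmult_le_pos; [exact Hx |].
  apply RInt_ge_0; [lra | | intros; left; apply exp_pos].
  apply (ex_RInt_continuous (V := R_CompleteNormedModule)).
  intros z _. apply continuous_of_derive. auto_derive. auto. }
rewrite <- RtoC_minus, Cmod_R.
assert (E1 : gauss_aux_int x = RtoC (- ((r - sqrt PI / 2) * (r + sqrt PI / 2)))).
{ replace (gauss_aux_int x) with (r * r + gauss_aux_int x - r * r) by ring. rewrite E.
  rewrite <- RtoC_mult, <- RtoC_minus. f_equal.
  assert (Hs : (sqrt PI * sqrt PI = PI)%R) by (apply sqrt_sqrt; left; apply PI_RGT_0).
  rewrite <- Hs at 1. field. }
pose proof (gauss_aux_int_bound x) as B. rewrite E1, Cmod_R, Rabs_Ropp, Rabs_mult in B.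
rewrite (Rabs_pos_eq (r + sqrt PI / 2)) in B by lra.
set (u := Rabs (r - sqrt PI / 2)) in *.
assert (Hu : (0 <= u)%R) by apply Rabs_pos.
apply Rmult_le_reg_r with (sqrt PI / 2)%R; [lra |].
apply Rle_trans with (exp (- x ^ 2)); [nra | right; field; lra].
Qed.

(** The path to [n + z] follows the real axis up to [n] and then goes straight; on the second piece
    the imaginary part stays bounded by that of [z] while the real part is large. *)
Lemma cerf_shift_lim (z : C) (eps : posreal) :
  exists N : R, forall n, (N < n)%R -> (Cmod (1 - cerf (RtoC n + z)) < eps)%R.
Proof.
pose proof sqrt_PI_pos as Hpi.
set (K := (2 / sqrt PI * (2 / sqrt PI + Cmod z * exp (Im z ^ 2) * exp (Rabs (Re z))))%R).
destruct (exp_decay_small K eps) as [N HN].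
exists (Rmax N (Rabs (Re z) + 1)). intros n Hn.
pose proof (Rmax_l N (Rabs (Re z) + 1)). pose proof (Rmax_r N (Rabs (Re z) + 1)).
pose proof (Rabs_pos (Re z)) as Ha.
eapply Rle_lt_trans; [| apply (HN n); lra].
rewrite cerf_seg, <- (seg_chasles_entire gauss _ 0 (RtoC n) (RtoC n + z) is_derive_C_gauss).
assert (Hne : RtoC (sqrt PI) <> 0) by (apply RtoC_neq_0; lra).
replace (1 - 2 / sqrt PI * (seg gauss 0 n + seg gauss n (n + z)))
  with (- (2 / sqrt PI) * ((seg gauss 0 n - RtoC (sqrt PI / 2)) + seg gauss n (n + z))).
2: { rewrite RtoC_div by lra. field. exact Hne. }
rewrite Cmod_mult, Cmod_opp, Cmod_div, !Cmod_R, !Rabs_pos_eq by (lra || exact Hne).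
unfold K. rewrite Rmult_assoc. apply Rmult_le_compat_l.
{ apply Rdiv_le_0_compat; lra. }
rewrite Rmult_plus_distr_r.
eapply Rle_trans; [apply Cmod_triangle |]. apply Rplus_le_compat.
- eapply Rle_trans; [apply seg_gauss_lim; lra |]. apply Rmult_le_compat_l.
  + apply Rdiv_le_0_compat; lra.
  + apply exp_le. nra.
- rewrite !Rmult_assoc. replace z with (n + z - n) at 2 by ring. apply seg_bound.
  + apply (seg_cont_entire gauss _ _ _ is_derive_C_gauss).
  + intros s Hs. unfold gauss. rewrite Cmod_cexp, <- !exp_plus. apply exp_le.
    unfold Re, Im in *; simpl.
    set (a := fst z) in *. set (b := snd z) in *.
    assert (Q : (n - Rabs a <= n + a * s)%R).
    { destruct (Rcase_abs a) as [Ha' | Ha'].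
      - rewrite (Rabs_left a) by lra. nra.
      - rewrite (Rabs_right a) by lra. nra. }
    assert (Q2 : (s * s * (b * b) <= b * b)%R).
    { assert (0 <= b * b)%R by nra. assert (s * s <= 1)%R by nra. nra. }
    (* As [n - Rabs a >= 1], the square dominates the number itself; linear decay in [n] is all that
       is needed. *)
    assert (Q3 : ((n - Rabs a) <= (n + a * s) * (n + a * s))%R) by nra.
    nra.
Qed.

(** Up to [2 / sqrt pi], [1 - erf z] is the Gaussian integrated from [z] to the right along a
    horizontal line, and [e^(z^2) e^(-(z + u)^2) = e^(-2zu - u^2)] is integrable in [u], uniformly
    for [Re z >= - c]. The line is cut at [n + z], with [n] so large that the remainder is below
    [eps]. *)
Lemma Lambda_bound (c : R) : (0 <= c)%R ->
  exists K : R, (0 <= K)%R /\ forall z, (- c <= Re z)%R -> (Cmod (Lambda z) <= K)%R.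
Proof.
intros Hc. pose proof sqrt_PI_pos as Hpi.
(* From [exp_quadratic_le] with quadratic coefficient 1, growth [2 c] and target rate 1. *)
set (K := exp ((2 * c + 1) ^ 2 / (4 * 1))).
assert (HK : (0 < K)%R) by apply exp_pos.
exists (2 / sqrt PI * K)%R. split.
{ apply Rmult_le_pos; [apply Rdiv_le_0_compat; lra | lra]. }
intros z Hz. apply le_epsilon. intros eps Heps.
assert (Hez : (0 < Cmod (cexp (z ^ 2)))%R) by (rewrite Cmod_cexp; apply exp_pos).
assert (He : (0 < eps / Cmod (cexp (z ^ 2)))%R) by (now apply Rdiv_lt_0_compat).
destruct (cerf_shift_lim z (mkposreal _ He)) as [N HN]. simpl in HN.
set (n := (Rmax N 0 + 1)%R).
pose proof (Rmax_l N 0). pose proof (Rmax_r N 0).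
assert (Hn : (0 < n)%R) by (unfold n; lra).
specialize (HN n ltac:(unfold n; lra)).
assert (E : cerf (n + z) = cerf z + 2 / sqrt PI * seg gauss z (n + z)).
{ rewrite !cerf_seg, <- (seg_chasles_entire gauss _ 0 z (n + z) is_derive_C_gauss). ring. }
unfold Lambda.
replace (cexp (z ^ 2) * (1 - cerf z))
  with (2 / sqrt PI * (cexp (z ^ 2) * seg gauss z (n + z)) + cexp (z ^ 2) * (1 - cerf (n + z))).
2: { rewrite E. ring. }
eapply Rle_trans; [apply Cmod_triangle |]. apply Rplus_le_compat.
- rewrite Cmod_mult.
  assert (Hne : RtoC (sqrt PI) <> 0) by (apply RtoC_neq_0; lra).
  rewrite Cmod_div, !Cmod_R, !Rabs_pos_eq by (lra || exact Hne).
  apply Rmult_le_compat_l; [apply Rdiv_le_0_compat; lra |].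
  unfold seg. replace (n + z - z) with (RtoC n) by ring.
  replace (cexp (z ^ 2) * (n * CInt (fun s => gauss (z + n * s)) 0 1))
    with (n * (cexp (z ^ 2) * CInt (fun s => gauss (z + n * s)) 0 1)) by ring.
  assert (Hex : ex_CInt (fun s => gauss (z + n * s)) 0 1).
  { apply ex_CInt_cont. intros x _. apply ccont_line. eexists. apply is_derive_C_gauss. }
  rewrite <- CInt_mult by exact Hex.
  rewrite Cmod_mult, Cmod_R, Rabs_pos_eq by lra.
  apply Rle_trans with (n * (K * exp (- n * 0) / n))%R.
  + apply Rmult_le_compat_l; [lra |]. apply Cmod_CInt_exp_le; try lra.
    * destruct Hex as [l Hl]. exists (cexp (z ^ 2) * l). now apply is_CInt_mult.
    * intros s Hs. unfold gauss. rewrite <- cexp_plus, Cmod_cexp.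
      replace (- n * s)%R with (- (1) * (n * s))%R by ring.
      eapply Rle_trans; [| apply exp_quadratic_le; lra]. apply exp_le.
      unfold Re, Im in *; simpl. assert (0 <= n * s)%R by (apply Rmult_le_pos; lra). nra.
  + rewrite Rmult_0_r, exp_0. right. field. lra.
- rewrite Cmod_mult.
  apply Rle_trans with (Cmod (cexp (z ^ 2)) * (eps / Cmod (cexp (z ^ 2))))%R.
  + apply Rmult_le_compat_l; [lra | left; exact HN].
  + right. field. lra.
Qed.

(** * The kernels *)

Definition theta : C := cexp (Ci * (PI / 4)).

(** The distance [r] is a complex variable, as it will run along the rotated ray. *)
Definition kern (t : R) (r : C) : C :=
  / (2 * csqrt_i (PI * t)) * cexp (- (r ^ 2 / (4 * Ci * t))).

Definition ekern (w t : R) (r : C) : C :=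
  Lambda (r / (2 * csqrt_i t) + w * csqrt_i t) * cexp (- (r ^ 2 / (4 * Ci * t))).

Lemma theta_pair : theta = (/ sqrt 2, / sqrt 2)%R.
Proof.
unfold theta. rewrite cexp_pair.
replace (Ci * (PI / 4)) with ((0, PI / 4)%R : C).
- simpl. rewrite exp_0, cos_PI4, sin_PI4. apply injective_projections; simpl; field; apply Rgt_not_eq, Rlt_sqrt2_0.
- rewrite <- RtoC_div by lra. apply injective_projections; simpl; ring.
Qed.

Lemma theta_sqr : theta * theta = Ci.
Proof.
rewrite theta_pair. pose proof Rlt_sqrt2_0 as H2.
assert (E : (/ sqrt 2 * / sqrt 2 = / 2)%R).
{ rewrite <- Rinv_mult, sqrt_sqrt by lra. reflexivity. }
apply injective_projections; simpl; lra.
Qed.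

Lemma theta_neq_0 : theta <> 0.
Proof. apply cexp_neq_0. Qed.

Lemma Cinv_theta : / theta = - Ci * theta.
Proof.
pose proof theta_neq_0 as H. pose proof theta_sqr as E.
transitivity (- Ci * (theta * theta) * / theta).
- rewrite E. replace (- Ci * Ci) with (RtoC 1) by (apply injective_projections; simpl; ring). ring.
- field. exact H.
Qed.

Lemma Ci_sqr : Ci * Ci = - 1.
Proof. apply injective_projections; simpl; ring. Qed.

Lemma Ci_neq_0 : Ci <> 0.
Proof. intros E. injection E. lra. Qed.

Lemma Cinv_Ci : / Ci = - Ci.
Proof.
pose proof Ci_neq_0 as H. transitivity (- (Ci * Ci) * / Ci).
- rewrite Ci_sqr. ring.
- field. exact H.
Qed.

Lemma sqrt_PI_neq_0 : RtoC (sqrt PI) <> 0.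
Proof. apply RtoC_neq_0. pose proof sqrt_PI_pos. lra. Qed.

Ltac nonzero := repeat split;
  first [apply theta_neq_0 | apply sqrt_PI_neq_0 | apply Ci_neq_0 | apply RtoC_neq_0; lra].

Lemma phase_eq (t : R) (r : C) : (0 < t)%R ->
  - (r ^ 2 / (4 * Ci * t)) = Ci * (r * r) * RtoC (/ (4 * t)).
Proof.
intros Ht. assert (Ht' : RtoC t <> 0) by (apply RtoC_neq_0; lra).
rewrite RtoC_inv, RtoC_mult by lra.
transitivity (- (r * r * / Ci * / (4 * t))).
- field. nonzero.
- rewrite Cinv_Ci. ring.
Qed.

Definition kern_const : C := / (2 * theta * sqrt PI).

Lemma kern_eq (t : R) (r : C) : (0 < t)%R ->
  kern t r = kern_const * RtoC (/ sqrt t) * cexp (Ci * (r * r) * RtoC (/ (4 * t))).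
Proof.
intros Ht. unfold kern, kern_const, csqrt_i. fold theta. rewrite phase_eq by exact Ht. f_equal.
pose proof PI_RGT_0. pose proof (sqrt_lt_R0 t Ht) as Hs.
rewrite sqrt_mult, RtoC_mult, RtoC_inv by lra.
field. nonzero.
Qed.

Definition earg (w t : R) (r : C) : C :=
  r * / theta * RtoC (/ (2 * sqrt t)) + w * theta * sqrt t.

(** The square contains [r^2 / (4it)], the opposite of the exponent of the phase. What remains is
    linear in [r] and in [t], so that [ekern] is a plain exponential times [1 - erf], the form in
    which it is differentiated. *)
Lemma earg_sqr (w t : R) (r : C) : (0 < t)%R ->
  earg w t r ^ 2 + Ci * (r * r) * RtoC (/ (4 * t)) = w * r + Ci * RtoC (w * w) * t.
Proof.
intros Ht. pose proof (sqrt_lt_R0 t Ht) as Hs.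
assert (E : RtoC t = RtoC (sqrt t) * RtoC (sqrt t)) by (rewrite <- RtoC_mult, sqrt_sqrt; [reflexivity | lra]).
set (q := RtoC (sqrt t)) in *.
assert (Hq : q <> 0) by (apply RtoC_neq_0; lra).
unfold earg. rewrite Cinv_theta, !RtoC_inv, !RtoC_mult by lra. fold q. rewrite E.
(* [field] treats [theta] and [Ci] as indeterminates, so [theta^2 = i] and [i^2 = -1] enter by
   explicit rewriting. *)
transitivity (theta * theta * (Ci * Ci * (r * r) * / (4 * q * q) - Ci * w * r + w * w * q * q)
  + Ci * (r * r) * / (4 * q * q)).
- field. exact Hq.
- rewrite theta_sqr, Ci_sqr. transitivity (- (Ci * Ci) * w * r + Ci * (w * w) * (q * q)).
  + field. exact Hq.
  + rewrite Ci_sqr. ring.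
Qed.

Lemma ekern_Lambda (w t : R) (r : C) : (0 < t)%R ->
  ekern w t r = Lambda (earg w t r) * cexp (Ci * (r * r) * RtoC (/ (4 * t))).
Proof.
intros Ht. unfold ekern, csqrt_i. fold theta. rewrite phase_eq by exact Ht.
pose proof (sqrt_lt_R0 t Ht) as Hs.
replace (r / (2 * (theta * sqrt t)) + w * (theta * sqrt t)) with (earg w t r); [reflexivity |].
unfold earg. rewrite RtoC_inv, RtoC_mult by lra. field. nonzero.
Qed.

Lemma ekern_eq (w t : R) (r : C) : (0 < t)%R ->
  ekern w t r = cexp (w * r + Ci * RtoC (w * w) * t) * (1 - cerf (earg w t r)).
Proof.
intros Ht. rewrite ekern_Lambda, <- earg_sqr by exact Ht. unfold Lambda. rewrite cexp_plus. ring.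
Qed.

(** The Gaussian produced by differentiating [cerf] recombines with the exponential prefactor into
    the free kernel; this is the source of the [kern] terms in both derivatives of [ekern]. *)
Lemma ekern_gauss (w t : R) (r : C) : (0 < t)%R ->
  cexp (w * r + Ci * RtoC (w * w) * t) * (2 / sqrt PI * gauss (earg w t r)) =
  4 * theta * sqrt t * kern t r.
Proof.
intros Ht. rewrite kern_eq, <- earg_sqr by exact Ht. unfold gauss.
pose proof (sqrt_lt_R0 t Ht) as Hs.
assert (Hs' : RtoC (sqrt t) <> 0) by (apply RtoC_neq_0; lra).
rewrite cexp_plus, (RtoC_inv (sqrt t)) by lra. unfold kern_const.
transitivity (cexp (earg w t r ^ 2) * cexp (- earg w t r ^ 2) * (2 / sqrt PI) * cexp (Ci * (r * r) * RtoC (/ (4 * t)))).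
- ring.
- rewrite cexp_opp. field. nonzero.
Qed.

Lemma is_derive_C_ext (f g : C -> C) (z l : C) :
  (forall z, f z = g z) -> is_derive_C f z l -> is_derive_C g z l.
Proof. intros E. apply (is_derive_ext (K := C_AbsRing) (V := C_NormedModule)). exact E. Qed.

Lemma is_derive_C_scal (c : C) (f : C -> C) (z l : C) :
  is_derive_C f z l -> is_derive_C (fun z => c * f z) z (c * l).
Proof.
intros H. replace (c * l) with (0 * f z + c * l) by ring.
apply (is_derive_C_mult (fun _ => c) f); [apply is_derive_C_const | exact H].
Qed.

Lemma is_derive_C_kern (t : R) (r : C) : (0 < t)%R ->
  is_derive_C (kern t) r (Ci / 2 * (RtoC (/ t) * (r * kern t r))).
Proof.
intros Ht.
assert (D : is_derive_C (fun r => Ci * RtoC (/ (4 * t)) * (r * r)) r (Ci * RtoC (/ (4 * t)) * (1 * r + r * 1))).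
{ apply is_derive_C_scal, (is_derive_C_mult (fun z => z) (fun z => z)); apply is_derive_C_id. }
pose proof (is_derive_C_scal (kern_const * RtoC (/ sqrt t)) _ r _
  (is_derive_C_comp cexp _ r _ _ (is_derive_C_cexp _) D)) as H.
assert (E : forall r, Ci * RtoC (/ (4 * t)) * (r * r) = Ci * (r * r) * RtoC (/ (4 * t))) by (intros; ring).
apply is_derive_C_ext with (g := kern t) in H.
- derive_eq H.
  pose proof (sqrt_lt_R0 t Ht) as Hs.
  rewrite kern_eq by exact Ht. rewrite E, !RtoC_inv, RtoC_mult by lra.
  field. nonzero.
- intros z. rewrite kern_eq by exact Ht. now rewrite E.
Qed.

Lemma is_derive_C_ekern (w t : R) (r : C) : (0 < t)%R ->
  is_derive_C (ekern w t) r (w * ekern w t r + - 2 * kern t r).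
Proof.
intros Ht.
assert (D1 : is_derive_C (fun r => Ci * RtoC (w * w) * t + w * r) r w) by apply is_derive_C_affine.
assert (D2 : is_derive_C (fun r => w * theta * sqrt t + / theta * RtoC (/ (2 * sqrt t)) * r) r
   (/ theta * RtoC (/ (2 * sqrt t)))) by apply is_derive_C_affine.
pose proof (is_derive_C_comp cexp _ r _ _ (is_derive_C_cexp _) D1) as H1.
pose proof (is_derive_C_plus (fun _ => RtoC 1) _ r _ _ (is_derive_C_const _ r)
  (is_derive_C_scal (RtoC (-1)) _ r _ (is_derive_C_comp cerf _ r _ _ (is_derive_C_cerf _) D2))) as H2.
pose proof (is_derive_C_mult _ _ _ _ _ H1 H2) as H. clear H1 H2 D1 D2.
assert (E1 : forall r, Ci * RtoC (w * w) * t + w * r = w * r + Ci * RtoC (w * w) * t) by (intros; ring).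
assert (E2 : forall r, w * theta * sqrt t + / theta * RtoC (/ (2 * sqrt t)) * r = earg w t r)
  by (intros; unfold earg; ring).
apply is_derive_C_ext with (g := ekern w t) in H.
- derive_eq H.
  rewrite E1, E2, RtoC_m1, ekern_eq by exact Ht.
  pose proof (ekern_gauss w t r Ht) as G.
  set (X := cexp (w * r + Ci * RtoC (w * w) * t)) in *.
  set (Y := 2 / sqrt PI * gauss (earg w t r)) in *.
  transitivity (w * (X * (1 - cerf (earg w t r))) - (/ theta * RtoC (/ (2 * sqrt t))) * (X * Y)); [ring |].
  rewrite G. pose proof (sqrt_lt_R0 t Ht) as Hs. rewrite RtoC_inv, RtoC_mult by lra.
  rewrite RtoC_m2. field. nonzero.
- intros z. rewrite ekern_eq, E1, E2, RtoC_m1 by exact Ht. ring.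
Qed.

Lemma is_derive_RC_ext_pos (f g : R -> C) (t : R) (l : C) : (0 < t)%R ->
  (forall s, (0 < s)%R -> f s = g s) -> is_derive_RC f t l -> is_derive_RC g t l.
Proof.
intros Ht E. apply (is_derive_ext_loc (V := C_R_NormedModule)).
exists (mkposreal t Ht). intros s Hs. apply E.
change (Rabs (s - t) < t)%R in Hs. apply Rabs_def2 in Hs. lra.
Qed.

Lemma is_derive_RC_kern (t : R) (r : C) : (0 < t)%R ->
  is_derive_RC (fun t => kern t r) t
    (RtoC (- / 2) * (RtoC (/ t) * kern t r) +
     (- Ci / 4) * (RtoC (/ t) * (RtoC (/ t) * (r * (r * kern t r))))).
Proof.
intros Ht. pose proof (sqrt_lt_R0 t Ht) as Hs.
assert (D1 : is_derive_RC (fun t => RtoC (/ sqrt t)) t (RtoC (- / 2 * / t * / sqrt t))).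
{ apply is_derive_RC_RtoC. auto_derive; [split; [lra | split; [lra | auto]] |].
  transitivity (- / (2 * (sqrt t * sqrt t) * sqrt t))%R; [field; lra |].
  rewrite sqrt_sqrt by lra. field. split; lra. }
assert (D2 : is_derive_RC (fun t => RtoC (/ (4 * t))) t (RtoC (- / 4 * / t * / t))).
{ apply is_derive_RC_RtoC. auto_derive; [lra |]. field. lra. }
pose proof (is_derive_RC_mult _ _ _ _ _ (is_derive_RC_scal kern_const _ _ _ D1)
  (is_derive_RC_cexp _ _ _ (is_derive_RC_scal (Ci * (r * r)) _ _ _ D2))) as H.
apply (is_derive_RC_ext_pos _ (fun t => kern t r)) in H; auto.
- derive_eq H.
  rewrite kern_eq by exact Ht.
  rewrite !RtoC_mult, !RtoC_opp, !RtoC_inv by lra. field. nonzero.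
- intros s Hs'. rewrite kern_eq by exact Hs'. reflexivity.
Qed.

Lemma is_derive_RC_ekern (w t : R) (r : C) : (0 < t)%R ->
  is_derive_RC (fun t => ekern w t r) t
    (Ci * RtoC (w * w) * ekern w t r + (RtoC (/ t) * (r * kern t r) + (- 2 * Ci * w) * kern t r)).
Proof.
intros Ht. pose proof (sqrt_lt_R0 t Ht) as Hs.
assert (D1 : is_derive_RC (fun t => RtoC (/ (2 * sqrt t))) t (RtoC (- / 4 * / t * / sqrt t))).
{ apply is_derive_RC_RtoC. auto_derive; [split; [lra | split; [lra | auto]] |].
  transitivity (- / (4 * (sqrt t * sqrt t) * sqrt t))%R; [field; lra |].
  rewrite sqrt_sqrt by lra. field. split; lra. }
assert (D2 : is_derive_RC (fun t => RtoC (sqrt t)) t (RtoC (/ (2 * sqrt t)))).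
{ apply is_derive_RC_RtoC. auto_derive; [lra |]. field. lra. }
pose proof (is_derive_RC_plus _ _ _ _ _ (is_derive_RC_scal (r * / theta) _ _ _ D1)
  (is_derive_RC_scal (w * theta) _ _ _ D2)) as D3.
pose proof (is_derive_RC_comp_C cerf _ _ _ _ (is_derive_C_cerf _) D3) as D4.
pose proof (is_derive_RC_mult _ _ _ _ _
  (is_derive_RC_cexp _ _ _ (is_derive_RC_affine (w * r) (Ci * RtoC (w * w)) t))
  (is_derive_RC_plus _ _ _ _ _ (is_derive_RC_const 1 t) (is_derive_RC_scal (RtoC (-1)) _ _ _ D4))) as H.
apply (is_derive_RC_ext_pos _ (fun t => ekern w t r)) in H; auto.
- derive_eq H.
  clear H D4 D3 D2 D1. rewrite ekern_eq by exact Ht. fold (earg w t r). rewrite RtoC_m1, RtoC_m2.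
  pose proof (ekern_gauss w t r Ht) as G.
  set (X := cexp (w * r + Ci * RtoC (w * w) * t)) in *.
  set (Y := 2 / sqrt PI * gauss (earg w t r)) in *.
  transitivity (Ci * RtoC (w * w) * (X * (1 - cerf (earg w t r)))
     - (r * / theta * RtoC (- / 4 * / t * / sqrt t) + w * theta * RtoC (/ (2 * sqrt t))) * (X * Y)); [ring |].
  rewrite G. rewrite <- theta_sqr, !RtoC_mult, !RtoC_opp, !RtoC_inv, RtoC_mult by lra.
  field. nonzero.
- intros s Hs'. rewrite ekern_eq by exact Hs'. fold (earg w s r). rewrite RtoC_m1. ring.
Qed.

(** A class of kernels closed under both derivatives, [kdr] and [kdt] being the
    symbolic ones. *)
Inductive kexpr : Type :=
| KE (w : R)
| KK
| Kadd (e1 e2 : kexpr)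
| Kscal (c : C) (e : kexpr)
| Kmulr (e : kexpr)
| Kdivt (e : kexpr).

Fixpoint kval (e : kexpr) (t : R) (r : C) : C :=
  match e with
  | KE w => ekern w t r
  | KK => kern t r
  | Kadd e1 e2 => kval e1 t r + kval e2 t r
  | Kscal c e => c * kval e t r
  | Kmulr e => r * kval e t r
  | Kdivt e => RtoC (/ t) * kval e t r
  end.

Fixpoint kdr (e : kexpr) : kexpr :=
  match e with
  | KE w => Kadd (Kscal w (KE w)) (Kscal (- 2) KK)
  | KK => Kscal (Ci / 2) (Kdivt (Kmulr KK))
  | Kadd e1 e2 => Kadd (kdr e1) (kdr e2)
  | Kscal c e => Kscal c (kdr e)
  | Kmulr e => Kadd e (Kmulr (kdr e))
  | Kdivt e => Kdivt (kdr e)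
  end.

Fixpoint kdt (e : kexpr) : kexpr :=
  match e with
  | KE w => Kadd (Kscal (Ci * RtoC (w * w)) (KE w)) (Kadd (Kdivt (Kmulr KK)) (Kscal (- 2 * Ci * w) KK))
  | KK => Kadd (Kscal (RtoC (- / 2)) (Kdivt KK)) (Kscal (- Ci / 4) (Kdivt (Kdivt (Kmulr (Kmulr KK)))))
  | Kadd e1 e2 => Kadd (kdt e1) (kdt e2)
  | Kscal c e => Kscal c (kdt e)
  | Kmulr e => Kmulr (kdt e)
  | Kdivt e => Kadd (Kscal (RtoC (-1)) (Kdivt (Kdivt e))) (Kdivt (kdt e))
  end.

Lemma is_derive_C_kval (e : kexpr) (t : R) (r : C) : (0 < t)%R ->
  is_derive_C (kval e t) r (kval (kdr e) t r).
Proof.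
intros Ht. induction e as [w | | e1 IH1 e2 IH2 | c e IH | e IH | e IH]; simpl.
- now apply is_derive_C_ekern.
- now apply is_derive_C_kern.
- now apply is_derive_C_plus.
- now apply is_derive_C_scal.
- replace (kval e t r + r * kval (kdr e) t r) with (1 * kval e t r + r * kval (kdr e) t r) by ring.
  apply (is_derive_C_mult (fun r => r) (kval e t)); [apply is_derive_C_id | exact IH].
- now apply is_derive_C_scal.
Qed.

Lemma is_derive_RC_kval (e : kexpr) (t : R) (r : C) : (0 < t)%R ->
  is_derive_RC (fun t => kval e t r) t (kval (kdt e) t r).
Proof.
intros Ht. induction e as [w | | e1 IH1 e2 IH2 | c e IH | e IH | e IH]; simpl.
- now apply is_derive_RC_ekern.
- now apply is_derive_RC_kern.
- now apply is_derive_RC_plus.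
- now apply is_derive_RC_scal.
- now apply is_derive_RC_scal.
- assert (D : is_derive_RC (fun t => RtoC (/ t)) t (RtoC (-1) * (RtoC (/ t) * RtoC (/ t)))).
  { rewrite <- !RtoC_mult. apply is_derive_RC_RtoC. auto_derive; [lra |]. field. lra. }
  pose proof (is_derive_RC_mult _ _ _ _ _ D IH) as H.
  derive_eq H.
  ring.
Qed.

Lemma kern_schrodinger (t : R) (r : C) : (0 < t)%R -> kval (kdt KK) t r = Ci * kval (kdr (kdr KK)) t r.
Proof.
intros Ht. simpl. assert (Ht' : RtoC t <> 0) by (apply RtoC_neq_0; lra).
rewrite RtoC_opp, !RtoC_inv by lra.
transitivity (Ci * Ci * / 2 * / t * kern t r + - Ci / 4 * / t * / t * r * r * kern t r).
- rewrite Ci_sqr. field. exact Ht'.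
- transitivity (Ci * Ci * / 2 * / t * kern t r + (Ci * Ci) * Ci / 4 * / t * / t * r * r * kern t r).
  + rewrite Ci_sqr. field. exact Ht'.
  + field. exact Ht'.
Qed.

Lemma ekern_schrodinger (w t : R) (r : C) : (0 < t)%R ->
  kval (kdt (KE w)) t r = Ci * kval (kdr (kdr (KE w))) t r.
Proof.
intros Ht. simpl. assert (Ht' : RtoC t <> 0) by (apply RtoC_neq_0; lra).
rewrite RtoC_m2, RtoC_mult, RtoC_inv by lra.
transitivity (Ci * (w * w) * ekern w t r + (- (Ci * Ci) * (/ t * (r * kern t r)) + - (2) * Ci * w * kern t r)).
- rewrite Ci_sqr. ring.
- field. exact Ht'.
Qed.

(** * Integrals along the rotated ray *)

Lemma Cmod_phase (t : R) (r : C) : (0 < t)%R ->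
  Cmod (cexp (Ci * (r * r) * RtoC (/ (4 * t)))) = exp (- (Re r * Im r) * / (2 * t)).
Proof.
intros Ht. rewrite Cmod_cexp. f_equal. unfold Re, Im; simpl. field. lra.
Qed.

Lemma Cmod_kern (t : R) (r : C) : (0 < t)%R ->
  Cmod (kern t r) = (Cmod kern_const * / sqrt t * exp (- (Re r * Im r) * / (2 * t)))%R.
Proof.
intros Ht. pose proof (sqrt_lt_R0 t Ht) as Hs.
rewrite kern_eq, !Cmod_mult, Cmod_phase, Cmod_R, Rabs_pos_eq; auto.
left. now apply Rinv_0_lt_compat.
Qed.

Lemma Re_earg (w t : R) (r : C) :
  Re (earg w t r) = ((Re r + Im r) * / sqrt 2 * / (2 * sqrt t) + w * / sqrt 2 * sqrt t)%R.
Proof.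
unfold earg. rewrite Cinv_theta, theta_pair. unfold Re, Im; simpl. ring.
Qed.

Lemma ekern_bound (c : R) : (0 <= c)%R ->
  exists K, (0 <= K)%R /\ forall w t r, (0 < t)%R -> (- c <= Re (earg w t r))%R ->
    (Cmod (ekern w t r) <= K * exp (- (Re r * Im r) * / (2 * t)))%R.
Proof.
intros Hc. destruct (Lambda_bound c Hc) as [K [HK H]].
exists K. split; [exact HK |]. intros w t r Ht Hr.
rewrite ekern_Lambda, Cmod_mult, Cmod_phase by exact Ht.
apply Rmult_le_compat_r; [left; apply exp_pos | now apply H].
Qed.

Lemma inv_sqrt_2 : (0 < / sqrt 2 <= 1)%R.
Proof.
pose proof Rlt_sqrt2_0 as H. split; [now apply Rinv_0_lt_compat |].
rewrite <- Rinv_1. apply Rinv_le_contravar; [lra |].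
rewrite <- sqrt_1. apply sqrt_le_1_alt. lra.
Qed.

(** [Lambda_bound] needs a half plane. The lower bound is uniform in [t], so that one constant
    serves a whole time interval; the term in [X] allows [x] to be negative. *)
Lemma Re_earg_ge (X w t t1 t2 : R) (r : C) :
  (0 <= X)%R -> (0 < t1)%R -> (t1 <= t <= t2)%R -> (- X <= Re r + Im r)%R ->
  (- (X * / (2 * sqrt t1) + Rabs w * sqrt t2) <= Re (earg w t r))%R.
Proof.
intros HX Ht1 Ht Hr. rewrite Re_earg. pose proof inv_sqrt_2 as H2.
pose proof (sqrt_lt_R0 t1 Ht1) as Hs1. pose proof (sqrt_lt_R0 t ltac:(lra)) as Hs.
assert (Hst1 : (sqrt t1 <= sqrt t)%R) by (apply sqrt_le_1_alt; lra).
assert (Hst2 : (sqrt t <= sqrt t2)%R) by (apply sqrt_le_1_alt; lra).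
assert (Hi : (0 < / (2 * sqrt t) <= / (2 * sqrt t1))%R).
{ split; [apply Rinv_0_lt_compat; lra |]. apply Rinv_le_contravar; lra. }
assert (A1 : (- (X * / (2 * sqrt t1)) <= (Re r + Im r) * / sqrt 2 * / (2 * sqrt t))%R).
{ assert (B : (0 <= / sqrt 2 * / (2 * sqrt t) <= / (2 * sqrt t1))%R).
  { split; [apply Rmult_le_pos; lra |].
    apply Rle_trans with (1 * / (2 * sqrt t))%R; [apply Rmult_le_compat_r; lra | lra]. }
  rewrite Rmult_assoc. set (u := (/ sqrt 2 * / (2 * sqrt t))%R) in *. nra. }
assert (A2 : (- (Rabs w * sqrt t2) <= w * / sqrt 2 * sqrt t)%R).
{ assert (B : (0 <= / sqrt 2 * sqrt t <= sqrt t2)%R).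
  { split; [apply Rmult_le_pos; lra |].
    apply Rle_trans with (1 * sqrt t)%R; [apply Rmult_le_compat_r; lra | lra]. }
  rewrite Rmult_assoc. set (u := (/ sqrt 2 * sqrt t)%R) in *.
  pose proof (Rle_abs (- w)) as C1. rewrite Rabs_Ropp in C1. pose proof (Rabs_pos w). nra. }
lra.
Qed.

(** Uniformity over compact sets of [t] and [x] is what differentiation under the integral requires.
    The rate [M] is arbitrary, in order to beat the growth of [F] and to pay for polynomial factors
    in [r]. *)
Definition tame (a : R) (N : R -> C -> C) : Prop :=
  forall t1 t2 X M : R, (0 < t1)%R -> exists K : R, forall t x s : R,
    (t1 <= t <= t2)%R -> (Rabs x <= X)%R -> (0 <= s)%R ->
    (Cmod (N t (RtoC x + dir a * RtoC s)%C) <= K * exp (- M * s))%R.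

Lemma Re_ray (a x s : R) : Re (RtoC x + dir a * RtoC s) = (x + cos a * s)%R.
Proof. unfold dir, Re; simpl. ring. Qed.

Lemma Im_ray (a x s : R) : Im (RtoC x + dir a * RtoC s) = (sin a * s)%R.
Proof. unfold dir, Im; simpl. ring. Qed.

Lemma phase_tame (a : R) : (0 < a < PI / 2)%R ->
  tame a (fun t r => RtoC (exp (- (Re r * Im r) * / (2 * t)))).
Proof.
intros Ha t1 t2 X M Ht1. destruct (acute_pos a Ha) as [Hc Hs].
destruct (Rle_dec t1 t2) as [Ht12 | Ht12].
2: { exists 0%R. intros. lra. }
(* Worst cases over the time interval: the quadratic decay is weakest at [t2], while the linear
   growth caused by negative [x] (the [b] below) is strongest at [t1]. *)
set (k := (cos a * sin a * / (2 * t2))%R).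
assert (Hk : (0 < k)%R).
{ unfold k. repeat apply Rmult_lt_0_compat; auto. apply Rinv_0_lt_compat. lra. }
set (b := (X * sin a * / (2 * t1))%R).
exists (exp ((b + M) ^ 2 / (4 * k))). intros t x s Ht Hx Hs0.
rewrite Cmod_R, Rabs_pos_eq by (left; apply exp_pos).
eapply Rle_trans; [| apply exp_quadratic_le; exact Hk].
apply exp_le. rewrite Re_ray, Im_ray.
assert (Hi : (/ (2 * t2) <= / (2 * t) <= / (2 * t1))%R) by (split; apply Rinv_le_contravar; lra).
assert (Hi2 : (0 < / (2 * t2))%R) by (apply Rinv_0_lt_compat; lra).
set (u := (/ (2 * t))%R) in *. set (u1 := (/ (2 * t1))%R) in *. set (u2 := (/ (2 * t2))%R) in *.
pose proof (Rle_abs (- x)) as Hx'. rewrite Rabs_Ropp in Hx'. pose proof (Rabs_pos x).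
assert (Q1 : (u2 * (cos a * sin a * (s * s)) <= u * (cos a * sin a * (s * s)))%R).
{ apply Rmult_le_compat_r; [| lra]. apply Rmult_le_pos; [| nra]. apply Rmult_le_pos; lra. }
assert (Q2 : (- x * u * (sin a * s) <= X * u1 * (sin a * s))%R).
{ apply Rmult_le_compat_r; [apply Rmult_le_pos; lra |].
  apply Rle_trans with (X * u)%R; [apply Rmult_le_compat_r; lra | apply Rmult_le_compat_l; lra]. }
unfold k, b. nra.
Qed.

Lemma tame_kval (a : R) (e : kexpr) : (0 < a < PI / 2)%R -> tame a (kval e).
Proof.
intros Ha. destruct (acute_pos a Ha) as [Hc Hs].
induction e as [w | | e1 IH1 e2 IH2 | c e IH | e IH | e IH]; intros t1 t2 X M Ht1; simpl.
- destruct (phase_tame a Ha t1 t2 X M Ht1) as [K1 HK1].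
  destruct (Rle_dec 0 X) as [HX | HX].
  2: { exists 0%R. intros t x s _ Hx. pose proof (Rabs_pos x). lra. }
  set (c := (X * / (2 * sqrt t1) + Rabs w * sqrt t2)%R).
  assert (Hc0 : (0 <= c)%R).
  { pose proof (sqrt_lt_R0 t1 Ht1). unfold c. apply Rplus_le_le_0_compat; apply Rmult_le_pos; auto.
    - left. apply Rinv_0_lt_compat. lra.
    - apply Rabs_pos.
    - apply sqrt_pos. }
  destruct (ekern_bound c Hc0) as [K [HK H]].
  exists (K * K1)%R. intros t x s Ht Hx Hs0.
  eapply Rle_trans; [apply H; [lra |] |].
  + apply Re_earg_ge; auto. rewrite Re_ray, Im_ray.
    pose proof (Rle_abs (- x)) as Hx'. rewrite Rabs_Ropp in Hx'.
    assert (0 <= cos a * s)%R by (apply Rmult_le_pos; lra).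
    assert (0 <= sin a * s)%R by (apply Rmult_le_pos; lra). lra.
  + rewrite Rmult_assoc. apply Rmult_le_compat_l; [exact HK |].
    specialize (HK1 t x s Ht Hx Hs0). rewrite Cmod_R, Rabs_pos_eq in HK1 by (left; apply exp_pos).
    exact HK1.
- destruct (phase_tame a Ha t1 t2 X M Ht1) as [K1 HK1].
  pose proof (sqrt_lt_R0 t1 Ht1) as Hs1.
  exists (Cmod kern_const * / sqrt t1 * K1)%R. intros t x s Ht Hx Hs0.
  rewrite Cmod_kern by lra. rewrite (Rmult_assoc _ K1).
  specialize (HK1 t x s Ht Hx Hs0). rewrite Cmod_R, Rabs_pos_eq in HK1 by (left; apply exp_pos).
  assert (Hst : (sqrt t1 <= sqrt t)%R) by (apply sqrt_le_1_alt; lra).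
  apply Rmult_le_compat; [| left; apply exp_pos | | exact HK1].
  + apply Rmult_le_pos; [apply Cmod_ge_0 | left; apply Rinv_0_lt_compat; lra].
  + apply Rmult_le_compat_l; [apply Cmod_ge_0 |]. apply Rinv_le_contravar; lra.
- destruct (IH1 t1 t2 X M Ht1) as [K1 HK1]. destruct (IH2 t1 t2 X M Ht1) as [K2 HK2].
  exists (K1 + K2)%R. intros t x s Ht Hx Hs0.
  eapply Rle_trans; [apply Cmod_triangle |]. rewrite Rmult_plus_distr_r.
  apply Rplus_le_compat; auto.
- destruct (IH t1 t2 X M Ht1) as [K HK].
  exists (Cmod c * K)%R. intros t x s Ht Hx Hs0.
  rewrite Cmod_mult, Rmult_assoc. apply Rmult_le_compat_l; [apply Cmod_ge_0 | auto].
(* The factor [|r| <= (X + 1) e^s] costs one unit of the rate. *)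
- destruct (IH t1 t2 X (M + 1)%R Ht1) as [K HK].
  exists ((X + 1) * K)%R. intros t x s Ht Hx Hs0.
  rewrite Cmod_mult. specialize (HK t x s Ht Hx Hs0).
  pose proof (Rabs_pos x) as Hx0.
  assert (Hr : (Cmod (RtoC x + dir a * RtoC s) <= (X + 1) * exp s)%R).
  { eapply Rle_trans; [apply Cmod_triangle |]. rewrite Cmod_mult, !Cmod_R, (Rabs_pos_eq s) by lra.
    rewrite Cmod_dir. pose proof (exp_ineq1_le s).
    nra. }
  eapply Rle_trans; [apply Rmult_le_compat; [apply Cmod_ge_0 | apply Cmod_ge_0 | exact Hr | exact HK] |].
  right. replace (- (M + 1) * s)%R with (- M * s + - s)%R by ring.
  rewrite exp_plus. rewrite (exp_Ropp s). field. pose proof (exp_pos s). lra.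
- destruct (IH t1 t2 X M Ht1) as [K HK].
  exists (/ t1 * K)%R. intros t x s Ht Hx Hs0.
  rewrite Cmod_mult, Cmod_R, Rmult_assoc.
  assert (Hi : (0 < / t <= / t1)%R).
  { split; [apply Rinv_0_lt_compat; lra | apply Rinv_le_contravar; lra]. }
  rewrite Rabs_pos_eq by lra. apply Rmult_le_compat; [lra | apply Cmod_ge_0 | lra | auto].
Qed.

(** The hypotheses on [F] as seen from one half line. Besides [signed F 1] and [signed F (-1)],
    their translates by [x >= 0] satisfy it as well. *)
Definition admissible (a A B : R) (f : C -> C) : Prop :=
  (forall z, wedge a z -> exists l, is_derive_C f z l) /\
  (forall z, wedge a z -> (Cmod (f z) <= A * exp (B * Im z))%R).

Definition Tker (a : R) (f : C -> C) (e : kexpr) (t x s : R) : C :=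
  dir a * (kval e t (RtoC x + dir a * RtoC s) * f (dir a * RtoC s)).

(** Here [x] is any real number: positive for the kernels at [|x| + y], negative for the free kernel
    at [y - |x|], and zero for the boundary values. *)
Definition Tint (a : R) (f : C -> C) (e : kexpr) (t x : R) : C := I0 (Tker a f e t x).

Lemma admissible_nonneg (a A B : R) (f : C -> C) : (0 < a < PI / 2)%R -> admissible a A B f -> (0 <= A)%R.
Proof.
intros Ha [_ H]. specialize (H (RtoC 0) (wedge_real a 0 Ha ltac:(lra))).
simpl in H. rewrite Rmult_0_r, exp_0 in H. pose proof (Cmod_ge_0 (f 0)). lra.
Qed.

Lemma Tker_bound (a A B : R) (f : C -> C) (e : kexpr) (t1 t2 X : R) :
  (0 < a < PI / 2)%R -> (0 <= B)%R -> admissible a A B f -> (0 < t1)%R ->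
  exists K : R, forall t x s : R,
    (t1 <= t <= t2)%R -> (Rabs x <= X)%R -> (0 <= s)%R ->
    (Cmod (Tker a f e t x s) <= K * exp (- s))%R.
Proof.
intros Ha HB Hf Ht1. pose proof (admissible_nonneg a A B f Ha Hf) as HA. destruct Hf as [_ Hf].
destruct (tame_kval a e Ha t1 t2 X (B + 1)%R Ht1) as [K HK].
exists (K * A)%R. intros t x s Ht Hx Hs. unfold Tker.
rewrite !Cmod_mult, Cmod_dir, Rmult_1_l.
specialize (HK t x s Ht Hx Hs). specialize (Hf _ (wedge_dir a s Ha Hs)).
replace (K * A * exp (- s))%R with ((K * exp (- (B + 1) * s)) * (A * exp (B * s)))%R.
- apply Rmult_le_compat; try apply Cmod_ge_0; auto.
  eapply Rle_trans; [exact Hf |]. apply Rmult_le_compat_l; [exact HA |]. apply exp_le.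
  apply Rmult_le_compat_l; [exact HB |]. unfold dir, Im; simpl. pose proof (SIN_bound a). nra.
- replace (- s)%R with (- (B + 1) * s + B * s)%R by ring. rewrite exp_plus. ring.
Qed.

Lemma Tker_cont (a A B : R) (f : C -> C) (e : kexpr) (t x s : R) :
  (0 < a < PI / 2)%R -> admissible a A B f -> (0 < t)%R -> (0 <= s)%R -> ccont (Tker a f e t x) s.
Proof.
intros Ha [Hf _] Ht Hs. unfold Tker.
apply (ccont_mult (fun _ => dir a)); [apply ccont_const |]. apply ccont_mult.
- apply ccont_line. eexists. now apply is_derive_C_kval.
- now apply ccont_ray, Hf, wedge_dir.
Qed.

Lemma Tint_ex (a A B : R) (f : C -> C) (e : kexpr) (t x : R) :
  (0 < a < PI / 2)%R -> (0 <= B)%R -> admissible a A B f -> (0 < t)%R -> ex_I (Tker a f e t x).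
Proof.
intros Ha HB Hf Ht.
destruct (Tker_bound a A B f e t t (Rabs x) Ha HB Hf Ht) as [K HK].
apply ex_I_exp with (M := K).
- intros s Hs. eapply Tker_cont; eauto.
- intros s Hs. apply HK; auto; lra.
Qed.

Lemma I_norm_exp (g : R -> C) (l : C) (M : R) :
  is_I g l -> (forall s, (0 <= s)%R -> (Cmod (g s) <= M * exp (- s))%R) -> (Cmod l <= M * 1)%R.
Proof.
intros Hg H. replace (M * 1)%R with (M / 1)%R by field.
apply (is_I_bound_exp g l M 1); auto; try lra.
- specialize (H 0%R ltac:(lra)). rewrite Ropp_0, exp_0 in H. pose proof (Cmod_ge_0 (g 0%R)). lra.
- intros s Hs. replace (- (1) * s)%R with (- s)%R by ring. now apply H.
Qed.

Lemma is_derive_RC_Tker (a : R) (f : C -> C) (e : kexpr) (t s q : R) : (0 < t)%R ->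
  is_derive_RC (fun q => Tker a f e t q s) q (Tker a f (kdr e) t q s).
Proof.
intros Ht. unfold Tker.
pose proof (is_derive_RC_comp_C (kval e t) (fun q => RtoC q + dir a * RtoC s) q
  (kval (kdr e) t (RtoC q + dir a * RtoC s)) (RtoC 1 + 0)) as H.
apply is_derive_RC_scal.
pose proof (is_derive_RC_mult _ (fun _ => f (dir a * RtoC s)) q _ _ (H (is_derive_C_kval e t _ Ht)
  (is_derive_RC_plus RtoC (fun _ => dir a * RtoC s) q _ _
     (is_derive_RC_RtoC (fun q => q) q 1 (is_derive_id (K := R_AbsRing) q))
     (is_derive_RC_const _ q))) (is_derive_RC_const _ q)) as H'.
derive_eq H'.
ring.
Qed.

Lemma is_derive_RC_Tker_t (a : R) (f : C -> C) (e : kexpr) (x s q : R) : (0 < q)%R ->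
  is_derive_RC (fun q => Tker a f e q x s) q (Tker a f (kdt e) q x s).
Proof.
intros Hq. unfold Tker. apply is_derive_RC_scal.
pose proof (is_derive_RC_mult _ (fun _ => f (dir a * RtoC s)) q _ _
  (is_derive_RC_kval e q (RtoC x + dir a * RtoC s) Hq) (is_derive_RC_const _ q)) as H'.
derive_eq H'.
ring.
Qed.

(** The second derivative to be dominated is again given by a [kexpr], hence again covered by
    [Tker_bound]. *)
Lemma is_derive_RC_Tint (a A B : R) (f : C -> C) (e : kexpr) (t x : R) :
  (0 < a < PI / 2)%R -> (0 <= B)%R -> admissible a A B f -> (0 < t)%R ->
  is_derive_RC (Tint a f e t) x (Tint a f (kdr e) t x).
Proof.
intros Ha HB Hf Ht.
destruct (Tker_bound a A B f (kdr (kdr e)) t t (Rabs x + 1)%R Ha HB Hf Ht) as [K HK].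
refine (is_derive_RC_integral (Rbar_locally p_infty) _ (fun s => 0 <= s)%R (fun s => exp (- s)) 1%R _
  (fun q s => Tker a f e t q s) (fun q s => Tker a f (kdr e) t q s)
  (fun q s => Tker a f (kdr (kdr e)) t q s) x (mkposreal 1 Rlt_0_1) K _ _ _).
- intros g l M. apply I_norm_exp.
- intros q _. eapply Tint_ex; eauto.
- eapply Tint_ex; eauto.
- intros q s Hq Hs. simpl in Hq.
  split; [| split; [| split]].
  + now apply is_derive_RC_Tker.
  + now apply is_derive_RC_Tker.
  + eapply is_derive_RC_cont. now apply is_derive_RC_Tker.
  + apply HK; auto; [lra |].
    replace q with (x + (q - x))%R by ring. eapply Rle_trans; [apply Rabs_triang |]. lra.
Qed.

Lemma is_derive_RC_Tint_t (a A B : R) (f : C -> C) (e : kexpr) (t x : R) :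
  (0 < a < PI / 2)%R -> (0 <= B)%R -> admissible a A B f -> (0 < t)%R ->
  is_derive_RC (fun t => Tint a f e t x) t (Tint a f (kdt e) t x).
Proof.
intros Ha HB Hf Ht. assert (Ht2 : (0 < t / 2)%R) by lra.
destruct (Tker_bound a A B f (kdt (kdt e)) (t / 2)%R (2 * t)%R (Rabs x) Ha HB Hf Ht2) as [K HK].
assert (Hin : forall q, (Rabs (q - t) < t / 2 -> t / 2 <= q <= 2 * t)%R).
{ intros q Hq. apply Rabs_def2 in Hq. lra. }
refine (is_derive_RC_integral (Rbar_locally p_infty) _ (fun s => 0 <= s)%R (fun s => exp (- s)) 1%R _
  (fun q s => Tker a f e q x s) (fun q s => Tker a f (kdt e) q x s)
  (fun q s => Tker a f (kdt (kdt e)) q x s) t (mkposreal (t / 2)%R Ht2) K _ _ _).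
- intros g l M. apply I_norm_exp.
- intros q Hq. simpl in Hq. specialize (Hin q Hq). eapply Tint_ex; eauto. lra.
- eapply Tint_ex; eauto.
- intros q s Hq Hs. simpl in Hq. specialize (Hin q Hq). assert (0 < q)%R by lra.
  split; [| split; [| split]].
  + now apply is_derive_RC_Tker_t.
  + now apply is_derive_RC_Tker_t.
  + eapply is_derive_RC_cont. now apply is_derive_RC_Tker_t.
  + apply HK; auto. lra.
Qed.

Lemma Tint_ext (a : R) (f : C -> C) (e1 e2 : kexpr) (t x : R) :
  (forall r, kval e1 t r = kval e2 t r) -> Tint a f e1 t x = Tint a f e2 t x.
Proof.
intros E. unfold Tint. f_equal.
apply FunctionalExtensionality.functional_extensionality. intros s. unfold Tker. now rewrite E.
Qed.

Lemma Tint_add (a A B : R) (f : C -> C) (e1 e2 : kexpr) (t x : R) :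
  (0 < a < PI / 2)%R -> (0 <= B)%R -> admissible a A B f -> (0 < t)%R ->
  Tint a f (Kadd e1 e2) t x = Tint a f e1 t x + Tint a f e2 t x.
Proof.
intros Ha HB Hf Ht. apply is_I_unique.
apply (is_I_ext (fun s => Tker a f e1 t x s + Tker a f e2 t x s)).
- intros s _. unfold Tker. simpl. ring.
- apply is_I_plus; apply is_I_correct; eapply Tint_ex; eauto.
Qed.

Lemma Tint_scal (a A B : R) (f : C -> C) (c : C) (e : kexpr) (t x : R) :
  (0 < a < PI / 2)%R -> (0 <= B)%R -> admissible a A B f -> (0 < t)%R ->
  Tint a f (Kscal c e) t x = c * Tint a f e t x.
Proof.
intros Ha HB Hf Ht. apply is_I_unique.
apply (is_I_ext (fun s => c * Tker a f e t x s)).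
- intros s _. unfold Tker. simpl. ring.
- apply is_I_mult; apply is_I_correct; eapply Tint_ex; eauto.
Qed.

(** Rotation needs a bound on the whole wedge and not only on the ray. A factor [r] would spoil it
    near the real axis, so only the undifferentiated kernels are moved; derivatives are taken on the
    ray. *)
Definition gaussian_bounded (a : R) (e : kexpr) : Prop :=
  forall t x : R, (0 < t)%R -> exists K : R, (0 <= K)%R /\ forall z, wedge a z ->
    (Cmod (kval e t (RtoC x + z)%C) <= K * exp (- ((x + Re z) * Im z) * / (2 * t)))%R.

Lemma wedge_Re (a : R) (z : C) : (0 < a < PI / 2)%R -> wedge a z -> (0 <= Re z)%R.
Proof. intros Ha [H1 H2]. destruct (acute_pos a Ha). nra. Qed.

Lemma gaussian_KE (a w : R) : (0 < a < PI / 2)%R -> gaussian_bounded a (KE w).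
Proof.
intros Ha t x Ht.
set (c := (Rabs x * / (2 * sqrt t) + Rabs w * sqrt t)%R).
assert (Hc0 : (0 <= c)%R).
{ pose proof (sqrt_lt_R0 t Ht). unfold c. apply Rplus_le_le_0_compat; apply Rmult_le_pos; try apply Rabs_pos.
  - left. apply Rinv_0_lt_compat. lra.
  - apply sqrt_pos. }
destruct (ekern_bound c Hc0) as [K [HK H]].
exists K. split; [exact HK |]. intros z Hz. simpl.
assert (E1 : Re (RtoC x + z) = (x + Re z)%R) by reflexivity.
assert (E2 : Im (RtoC x + z) = Im z) by (unfold Im; simpl; ring).
rewrite <- E1, <- E2. apply H; [exact Ht |]. apply Re_earg_ge; auto; try lra; [apply Rabs_pos |].
rewrite E1, E2. pose proof (wedge_Re a z Ha Hz). destruct Hz.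
pose proof (Rle_abs (- x)) as Hx'. rewrite Rabs_Ropp in Hx'. lra.
Qed.

Lemma gaussian_KK (a : R) : gaussian_bounded a KK.
Proof.
intros t x Ht. exists (Cmod kern_const * / sqrt t)%R. pose proof (sqrt_lt_R0 t Ht) as Hs. split.
- apply Rmult_le_pos; [apply Cmod_ge_0 | left; now apply Rinv_0_lt_compat].
- intros z _. simpl. rewrite Cmod_kern by exact Ht. right.
  replace (Re (RtoC x + z)) with (x + Re z)%R by reflexivity.
  replace (Im (RtoC x + z)) with (Im z) by (unfold Im; simpl; ring). reflexivity.
Qed.

Lemma gaussian_Kadd (a : R) (e1 e2 : kexpr) :
  gaussian_bounded a e1 -> gaussian_bounded a e2 -> gaussian_bounded a (Kadd e1 e2).
Proof.
intros H1 H2 t x Ht. destruct (H1 t x Ht) as [K1 [P1 Q1]]. destruct (H2 t x Ht) as [K2 [P2 Q2]].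
exists (K1 + K2)%R. split; [lra |]. intros z Hz. simpl.
eapply Rle_trans; [apply Cmod_triangle |]. rewrite Rmult_plus_distr_r. apply Rplus_le_compat; auto.
Qed.

Lemma gaussian_Kscal (a : R) (c : C) (e : kexpr) :
  gaussian_bounded a e -> gaussian_bounded a (Kscal c e).
Proof.
intros H t x Ht. destruct (H t x Ht) as [K [P Q]].
exists (Cmod c * K)%R. split; [apply Rmult_le_pos; [apply Cmod_ge_0 | exact P] |]. intros z Hz. simpl.
rewrite Cmod_mult, Rmult_assoc. apply Rmult_le_compat_l; [apply Cmod_ge_0 | auto].
Qed.

Lemma Tint_contour (a A B : R) (f : C -> C) (e : kexpr) (t x : R) :
  (0 < a < PI / 2)%R -> (0 <= B)%R -> admissible a A B f -> gaussian_bounded a e -> (0 < t)%R ->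
  is_I (fun y => kval e t (RtoC x + RtoC y) * f (RtoC y)) (Tint a f e t x).
Proof.
intros Ha HB Hf He Ht. pose proof (admissible_nonneg a A B f Ha Hf) as HA.
destruct (He t x Ht) as [K [HK Hb]].
(* [m = 2 t B - x] solves [- (x + Re z) Im z / (2t) + B Im z = - Im z (Re z - m) / (2t)]. *)
destruct (contour_rotation a (fun z => kval e t (RtoC x + z) * f z) (K * A)%R (/ (2 * t))%R (2 * t * B - x)%R) as [l [H1 H2]].
- exact Ha.
- apply Rinv_0_lt_compat. lra.
- now apply Rmult_le_pos.
- intros z Hz. destruct (proj1 Hf z Hz) as [l Hl].
  eexists. apply (is_derive_C_mult (fun z => kval e t (RtoC x + z)) f); [| exact Hl].
  apply (is_derive_C_comp (kval e t) (fun z => RtoC x + z)).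
  + now apply is_derive_C_kval.
  + apply (is_derive_C_plus (fun _ => RtoC x) (fun z => z)); [apply is_derive_C_const | apply is_derive_C_id].
- intros z Hz. rewrite Cmod_mult.
  eapply Rle_trans; [apply Rmult_le_compat; [apply Cmod_ge_0 | apply Cmod_ge_0 | now apply Hb | now apply Hf] |].
  right.
  transitivity (K * A * (exp (- ((x + Re z) * Im z) * / (2 * t)) * exp (B * Im z)))%R; [ring |].
  rewrite <- exp_plus. f_equal. f_equal. field. lra.
- replace (Tint a f e t x) with l; [exact H2 |].
  symmetry. apply is_I_unique. exact H1.
Qed.

(** * The initial condition *)

(** Every piece converges at this rate; keeping the rate makes sums and remainders a matter of
    adding constants. *)
Definition sqrt_close (g : R -> C) (l : C) : Prop :=
  exists K t0 : R, (0 < t0)%R /\ forall t, (0 < t < t0)%R -> (Cmod (g t - l) <= K * sqrt t)%R.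

Lemma sqrt_close_tends (g : R -> C) (l : C) : sqrt_close g l -> tends_to g (at_right 0) l.
Proof.
intros (K & t0 & Ht0 & H). apply filterlim_C_eps; [typeclasses eauto |]. intros eps.
pose proof (Rabs_pos K) as HK. pose proof (cond_pos eps) as He.
set (e := (eps / (Rabs K + 1))%R).
assert (Hep : (0 < e)%R) by (apply Rdiv_lt_0_compat; lra).
assert (Hd : (0 < Rmin t0 (e * e))%R) by (apply Rmin_pos; [exact Ht0 | nra]).
exists (mkposreal _ Hd). intros t Ht Htp.
change (Rabs (t - 0) < Rmin t0 (e * e))%R in Ht. rewrite Rminus_0_r, Rabs_pos_eq in Ht by lra.
pose proof (Rmin_l t0 (e * e)). pose proof (Rmin_r t0 (e * e)).
eapply Rle_lt_trans; [apply H; lra |].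
assert (Hs : (sqrt t < e)%R).
{ rewrite <- (sqrt_square e) by lra. apply sqrt_lt_1; nra. }
pose proof (Rle_abs K). pose proof (sqrt_lt_R0 t Htp).
apply Rle_lt_trans with (Rabs K * e)%R; [nra |].
apply Rlt_le_trans with ((Rabs K + 1) * e)%R; [nra |].
right. unfold e. field. lra.
Qed.

Lemma sqrt_close_plus (g h : R -> C) (l m : C) :
  sqrt_close g l -> sqrt_close h m -> sqrt_close (fun t => g t + h t) (l + m).
Proof.
intros (K1 & t1 & Ht1 & H1) (K2 & t2 & Ht2 & H2).
exists (K1 + K2)%R, (Rmin t1 t2). split; [now apply Rmin_pos |].
intros t Ht. pose proof (Rmin_l t1 t2). pose proof (Rmin_r t1 t2).
replace (g t + h t - (l + m)) with ((g t - l) + (h t - m)) by ring.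
eapply Rle_trans; [apply Cmod_triangle |].
specialize (H1 t ltac:(lra)). specialize (H2 t ltac:(lra)). lra.
Qed.

Lemma sqrt_close_scal (c : C) (g : R -> C) (l : C) :
  sqrt_close g l -> sqrt_close (fun t => c * g t) (c * l).
Proof.
intros (K & t0 & Ht0 & H). exists (Cmod c * K)%R, t0. split; [exact Ht0 |].
intros t Ht. replace (c * g t - c * l) with (c * (g t - l)) by ring.
rewrite Cmod_mult, Rmult_assoc. apply Rmult_le_compat_l; [apply Cmod_ge_0 | auto].
Qed.

Lemma sqrt_close_ext (g h : R -> C) (l : C) :
  (forall t, (0 < t)%R -> g t = h t) -> sqrt_close g l -> sqrt_close h l.
Proof.
intros E (K & t0 & Ht0 & H). exists K, t0. split; [exact Ht0 |].
intros t Ht. rewrite <- E by lra. now apply H.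
Qed.

Lemma inv_sqrt_mult (t : R) : (0 < t)%R -> (/ sqrt t * t = sqrt t)%R.
Proof.
intros Ht. pose proof (sqrt_lt_R0 t Ht) as Hs.
rewrite <- (sqrt_sqrt t) at 2 by lra. field. lra.
Qed.

(** For small [t], half of the decay rate [p / t] suffices to absorb the growth rate [q] of the
    function. *)
Lemma small_time (p q : R) : (0 < p)%R -> exists t0, (0 < t0 <= 1)%R /\
  forall t, (0 < t < t0)%R -> (p / 2 * / t <= p * / t - q)%R.
Proof.
intros Hp. pose proof (Rabs_pos q) as Hq.
exists (Rmin 1 (p / (2 * (Rabs q + 1))))%R. split.
{ split; [| apply Rmin_l]. apply Rmin_pos; [lra | apply Rdiv_lt_0_compat; lra]. }
intros t Ht. pose proof (Rmin_r 1 (p / (2 * (Rabs q + 1)))) as H.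
assert (H1 : (t * (2 * (Rabs q + 1)) <= p)%R).
{ replace p with (p / (2 * (Rabs q + 1)) * (2 * (Rabs q + 1)))%R by (field; lra).
  apply Rmult_le_compat_r; lra. }
assert (H2 : (q <= p / 2 * / t)%R); [| lra].
eapply Rle_trans; [apply Rle_abs |].
apply Rmult_le_reg_r with t; [lra |]. rewrite Rmult_assoc, Rinv_l by lra. nra.
Qed.

(** [p / t - q] is the decay rate of an integrand of size [D / sqrt t]. *)
Lemma exp_over_t (D p q t : R) : (0 <= D)%R -> (0 < p)%R -> (0 < t)%R ->
  (p / 2 * / t <= p * / t - q)%R ->
  (0 < p * / t - q /\ D * / sqrt t / (p * / t - q) <= 2 * D / p * sqrt t)%R.
Proof.
intros HD Hp Ht H. pose proof (sqrt_lt_R0 t Ht) as Hs.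
assert (Hpt : (0 < p / 2 * / t)%R).
{ apply Rmult_lt_0_compat; [lra | now apply Rinv_0_lt_compat]. }
split; [lra |].
apply Rle_trans with (D * / sqrt t / (p / 2 * / t))%R.
- apply Rmult_le_compat_l.
  + apply Rmult_le_pos; [exact HD | left; now apply Rinv_0_lt_compat].
  + apply Rinv_le_contravar; lra.
- right. transitivity (2 * D / p * (/ sqrt t * t))%R; [field; repeat split; lra |].
  now rewrite inv_sqrt_mult.
Qed.

(** At distance [x > 0] from the singularity the integrand on the ray has size [D A / sqrt t] and
    decay rate of order [1 / t], so its integral is [O(sqrt t)]. *)
Lemma Tint_initial (a A B : R) (f : C -> C) (e : kexpr) (x D : R) :
  (0 < a < PI / 2)%R -> (0 <= B)%R -> admissible a A B f -> (0 < x)%R -> (0 <= D)%R ->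
  (forall t r, (0 < t <= 1)%R -> (0 <= Re r)%R -> (0 <= Im r)%R ->
     (Cmod (kval e t r) <= D * / sqrt t * exp (- (Re r * Im r) * / (2 * t)))%R) ->
  sqrt_close (fun t => Tint a f e t x) 0.
Proof.
intros Ha HB Hf Hx HD He. pose proof (admissible_nonneg a A B f Ha Hf) as HA.
destruct (acute_pos a Ha) as [Hc Hs].
(* The rate comes from the cross term [x * s sin a / (2t)] of the exponent; the quadratic term in
   [s] only helps. *)
set (p := (x * sin a / 2)%R).
assert (Hp : (0 < p)%R) by (unfold p; nra).
destruct (small_time p B Hp) as [t0 [Ht0 Ht0']].
exists (2 * (D * A) / p)%R, t0. split; [lra |].
intros t Ht. specialize (Ht0' t Ht).
assert (HDA : (0 <= D * A)%R) by now apply Rmult_le_pos.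
destruct (exp_over_t (D * A) p B t HDA Hp ltac:(lra) Ht0') as [Hk Hle].
replace (Tint a f e t x - 0) with (Tint a f e t x) by ring.
eapply Rle_trans; [| exact Hle].
pose proof (sqrt_lt_R0 t ltac:(lra)) as Hst.
apply (is_I_bound_exp (Tker a f e t x)).
- exact Hk.
- apply Rmult_le_pos; [exact HDA | left; now apply Rinv_0_lt_compat].
- apply is_I_correct. apply (Tint_ex a A B); auto. lra.
- intros s Hs0. unfold Tker. rewrite !Cmod_mult, Cmod_dir, Rmult_1_l.
  assert (P1 : (0 <= cos a * s)%R) by (apply Rmult_le_pos; lra).
  assert (P2 : (0 <= sin a * s)%R) by (apply Rmult_le_pos; lra).
  assert (Q1 := He t (RtoC x + dir a * RtoC s) ltac:(lra)).
  rewrite Re_ray, Im_ray in Q1. specialize (Q1 ltac:(lra) P2).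
  pose proof (proj2 Hf _ (wedge_dir a s Ha Hs0)) as Q2.
  replace (Im (dir a * RtoC s)) with (sin a * s)%R in Q2 by (unfold dir, Im; simpl; ring).
  eapply Rle_trans; [apply Rmult_le_compat; [apply Cmod_ge_0 | apply Cmod_ge_0 | exact Q1 | exact Q2] |].
  apply Rle_trans with (D * A * / sqrt t * (exp (- ((x + cos a * s) * (sin a * s)) * / (2 * t)) * exp (B * (sin a * s))))%R.
  { right. ring. }
  apply Rmult_le_compat_l.
  { apply Rmult_le_pos; [exact HDA | left; now apply Rinv_0_lt_compat]. }
  rewrite <- exp_plus. apply exp_le.
  assert (Hti : (0 < / t)%R) by (apply Rinv_0_lt_compat; lra).
  replace (/ (2 * t))%R with (/ t / 2)%R by (field; lra).
  pose proof (SIN_bound a) as Hsb. unfold p.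
  assert (Q3 : (B * (sin a * s) <= B * s)%R) by (apply Rmult_le_compat_l; nra).
  assert (Q4 : (0 <= cos a * s * (sin a * s) * (/ t / 2))%R) by (repeat apply Rmult_le_pos; lra).
  nra.
Qed.

Lemma Tint_initial_KK (a A B : R) (f : C -> C) (x : R) :
  (0 < a < PI / 2)%R -> (0 <= B)%R -> admissible a A B f -> (0 < x)%R ->
  sqrt_close (fun t => Tint a f KK t x) 0.
Proof.
intros Ha HB Hf Hx. apply (Tint_initial a A B f KK x (Cmod kern_const)); auto using Cmod_ge_0.
intros t r Ht _ _. simpl. rewrite Cmod_kern by lra. lra.
Qed.

Lemma Tint_initial_KE (a A B : R) (f : C -> C) (w x : R) :
  (0 < a < PI / 2)%R -> (0 <= B)%R -> admissible a A B f -> (0 < x)%R ->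
  sqrt_close (fun t => Tint a f (KE w) t x) 0.
Proof.
intros Ha HB Hf Hx.
destruct (ekern_bound (Rabs w) (Rabs_pos w)) as [K [HK H]].
apply (Tint_initial a A B f (KE w) x K); auto.
intros t r Ht Hr Hi. simpl. pose proof (sqrt_lt_R0 t ltac:(lra)) as Hs.
eapply Rle_trans; [apply H; [lra |] |].
- pose proof (Re_earg_ge 0 w t t 1 r ltac:(lra) ltac:(lra) ltac:(lra) ltac:(lra)) as Q.
  rewrite sqrt_1, Rmult_0_l, Rplus_0_l, Rmult_1_r in Q. exact Q.
- apply Rmult_le_compat_r; [left; apply exp_pos |].
  (* For [t <= 1] the factor [/ sqrt t] may be inserted, to fit the shape asked by
     [Tint_initial]. *)
  assert (1 <= / sqrt t)%R.
  { rewrite <- Rinv_1. apply Rinv_le_contravar; [exact Hs |].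
    rewrite <- sqrt_1. apply sqrt_le_1_alt. lra. }
  nra.
Qed.

(** * The free kernel integrated away from its singularity *)

Lemma kern_ray_bound (a t s : R) : (0 < t)%R ->
  (Cmod (kern t (dir a * RtoC s)) = Cmod kern_const * / sqrt t * exp (- (cos a * sin a / 2 * / t) * s ^ 2))%R.
Proof.
intros Ht. rewrite Cmod_kern by exact Ht. f_equal. f_equal. unfold dir, Re, Im; simpl. field. lra.
Qed.

(** Since [d/dr E_0 = - 2 k], [- E_0 / 2] is a primitive of [kern], with [E_0(t, 0) = 1]. This takes
    the place of the Fresnel integral and is where the value 1/2 originates. *)
Lemma seg_kern (t : R) (z : C) : (0 < t)%R -> seg (kern t) 0 z = / 2 * (1 - ekern 0 t z).
Proof.
intros Ht.
rewrite (seg_primitive (fun z => - / 2 * ekern 0 t z) (kern t)).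
- assert (E : ekern 0 t 0 = 1).
  { rewrite ekern_eq by exact Ht.
    replace (earg 0 t 0) with (RtoC 0) by (unfold earg; ring).
    rewrite cerf_seg. unfold seg. replace (0 * 0 + Ci * RtoC (0 * 0) * t) with (RtoC 0).
    - rewrite cexp_0. ring.
    - rewrite Rmult_0_l. ring. }
  rewrite E. ring.
- intros s _. set (r := 0 + (z - 0) * s).
  replace (kern t r) with (- / 2 * (0%R * ekern 0 t r + - 2 * kern t r)).
  + now apply is_derive_C_scal, is_derive_C_ekern.
  + rewrite RtoC_m2. field.
- intros s _. apply ccont_line. eexists. now apply is_derive_C_kern.
Qed.

Lemma kern_ray_cont (a t s : R) : (0 < t)%R -> ccont (fun s => kern t (dir a * RtoC s)) s.
Proof.
intros Ht. apply ccont_ray. eexists. now apply is_derive_C_kern.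
Qed.

(** With [h0] in place of [h] the integral is [h0 (1 - E_0) / 2], and [E_0] at [d e^(ia)] is
    exponentially small in [1 / t]. The Lipschitz error [M s] gains a factor [s], of effective size
    [sqrt t] under the Gaussian. *)
Lemma kern_approx (a d M : R) (h0 : C) (h : R -> C) :
  (0 < a < PI / 2)%R -> (0 < d)%R -> (0 <= M)%R ->
  (forall s, (0 <= s <= d)%R -> ccont h s) ->
  (forall s, (0 <= s <= d)%R -> (Cmod (h s - h0) <= M * s)%R) ->
  sqrt_close (fun t => dir a * CInt (fun s => kern t (dir a * RtoC s) * h s) 0 d) (h0 / 2).
Proof.
intros Ha Hd HM Hc Hl. destruct (acute_pos a Ha) as [Hca Hsa].
set (k := (cos a * sin a / 2)%R).
assert (Hk : (0 < k)%R) by (unfold k; nra).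
destruct (ekern_bound 0 ltac:(lra)) as [K [HK HE]].
set (D := Cmod kern_const).
assert (HD : (0 <= D)%R) by apply Cmod_ge_0.
(* The first summand uses [e^(-u) <= 1 / u] with [u = k d^2 / t], then [t <= sqrt t]; the second
   uses that [s e^(- q s^2)] has integral at most [1 / (2q)], with [q = k / t]. *)
exists (Cmod h0 * K / (k * d ^ 2) + D * M / (2 * k))%R, 1%R. split; [lra |].
intros t Ht. pose proof (sqrt_lt_R0 t ltac:(lra)) as Hst.
assert (Hti : (0 < / t)%R) by (apply Rinv_0_lt_compat; lra).
assert (Hsi : (0 < / sqrt t)%R) by (now apply Rinv_0_lt_compat).
assert (C1 : forall s, ccont (fun s => kern t (dir a * RtoC s)) s) by (intros; apply kern_ray_cont; lra).
assert (C2 : forall s, (0 <= s <= d)%R -> ccont (fun s => h s + - h0) s).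
{ intros s Hs. apply ccont_plus; [auto | apply ccont_const]. }
assert (X1 : ex_CInt (fun s => h0 * kern t (dir a * RtoC s)) 0 d).
{ apply ex_CInt_cont. intros s _. apply (ccont_mult (fun _ => h0)); [apply ccont_const | apply C1]. }
assert (X2 : ex_CInt (fun s => kern t (dir a * RtoC s) * (h s + - h0)) 0 d).
{ apply ex_CInt_cont. intros s Hs. rewrite Rmin_left, Rmax_right in Hs by lra. apply ccont_mult; auto. }
assert (E : CInt (fun s => kern t (dir a * RtoC s) * h s) 0 d =
  CInt (fun s => h0 * kern t (dir a * RtoC s)) 0 d + CInt (fun s => kern t (dir a * RtoC s) * (h s + - h0)) 0 d).
{ transitivity (CInt (fun s => h0 * kern t (dir a * RtoC s) + kern t (dir a * RtoC s) * (h s + - h0)) 0 d).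
  - apply (RInt_ext (V := CV)). intros s _. ceq. ring.
  - exact (RInt_plus (V := CV) _ _ 0 d X1 X2). }
rewrite E, CInt_mult by (apply ex_CInt_cont; auto).
pose proof (CInt_seg (kern t) (dir a) d ltac:(lra) ltac:(auto)) as E2.
rewrite seg_kern in E2 by lra.
set (J := CInt (fun s => kern t (dir a * RtoC s) * (h s + - h0)) 0 d) in *.
set (J0 := CInt (fun s => kern t (dir a * RtoC s)) 0 d) in *.
replace (dir a * (h0 * J0 + J) - h0 / 2) with (h0 * (dir a * J0) - h0 / 2 + dir a * J) by ring.
rewrite <- E2.
replace (h0 * (/ 2 * (1 - ekern 0 t (dir a * d))) - h0 / 2 + dir a * J)
  with (- (h0 * / 2 * ekern 0 t (dir a * d)) + dir a * J) by (unfold Cdiv; ring).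
eapply Rle_trans; [apply Cmod_triangle |]. rewrite Rmult_plus_distr_r.
apply Rplus_le_compat.
- rewrite Cmod_opp, !Cmod_mult, <- RtoC_inv, Cmod_R, Rabs_pos_eq by lra.
  assert (Hb : (Cmod (ekern 0 t (dir a * d)) <= K * (t * / (k * d ^ 2)))%R).
  { assert (R1 : Re (dir a * d) = (cos a * d)%R) by (unfold dir, Re; simpl; ring).
    assert (R2 : Im (dir a * d) = (sin a * d)%R) by (unfold dir, Im; simpl; ring).
    eapply Rle_trans; [apply HE; [lra |] |].
    - pose proof (Re_earg_ge 0 0 t t t (dir a * d) ltac:(lra) ltac:(lra) ltac:(lra)) as Q.
      rewrite R1, R2, Rabs_R0, !Rmult_0_l, Rplus_0_l in Q. apply Q.
      assert (0 <= cos a * d)%R by (apply Rmult_le_pos; lra).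
      assert (0 <= sin a * d)%R by (apply Rmult_le_pos; lra). lra.
    - apply Rmult_le_compat_l; [exact HK |]. rewrite R1, R2.
      replace (- (cos a * d * (sin a * d)) * / (2 * t))%R with (- (k * d ^ 2 * / t))%R by (unfold k; field; lra).
      assert (Hu : (0 < k * d ^ 2)%R) by (apply Rmult_lt_0_compat; [lra | nra]).
      set (u := (k * d ^ 2)%R) in *.
      assert (Hut : (0 < u * / t)%R) by (now apply Rmult_lt_0_compat).
      rewrite exp_Ropp. replace (t * / u)%R with (/ (u * / t))%R by (field; lra).
      apply Rinv_le_contravar; [exact Hut |].
      pose proof (exp_ineq1_le (u * / t)). lra. }
  assert (Htt : (t <= sqrt t)%R).
  { rewrite <- (sqrt_sqrt t) at 1 by lra.
    assert (sqrt t <= 1)%R by (rewrite <- sqrt_1; apply sqrt_le_1_alt; lra). nra. }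
  assert (Hu : (0 < / (k * d ^ 2))%R) by (apply Rinv_0_lt_compat, Rmult_lt_0_compat; [lra | nra]).
  pose proof (Cmod_ge_0 h0) as Hh0.
  apply Rle_trans with (Cmod h0 * (K * (sqrt t * / (k * d ^ 2))))%R.
  + rewrite Rmult_assoc. apply Rmult_le_compat_l; [exact Hh0 |].
    pose proof (Cmod_ge_0 (ekern 0 t (dir a * d))).
    apply Rle_trans with (K * (t * / (k * d ^ 2)))%R; [lra |].
    apply Rmult_le_compat_l; [exact HK |]. apply Rmult_le_compat_r; lra.
  + right. unfold Rdiv. ring.
- rewrite Cmod_mult, Cmod_dir, Rmult_1_l.
  set (q := (k * / t)%R).
  assert (Hq : (0 < q)%R) by (now apply Rmult_lt_0_compat).
  set (g := fun s : R => (D * / sqrt t * M * (s * exp (- q * s ^ 2)))%R).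
  assert (Ig : is_RInt g 0 d (D * / sqrt t * M * ((1 - exp (- q * d ^ 2)) / (2 * q)))%R).
  { replace (D * / sqrt t * M * ((1 - exp (- q * d ^ 2)) / (2 * q)))%R
      with (minus ((fun s => - (D * / sqrt t * M * (exp (- q * s ^ 2) / (2 * q)))) d)
                  ((fun s => - (D * / sqrt t * M * (exp (- q * s ^ 2) / (2 * q)))) 0))%R.
    - apply (is_RInt_derive (V := R_CompleteNormedModule) (fun s => - (D * / sqrt t * M * (exp (- q * s ^ 2) / (2 * q))))%R g).
      + intros s _. unfold g. auto_derive; [auto |]. simpl. field. lra.
      + intros s _. apply continuous_of_derive. unfold g. auto_derive. auto.
    - unfold minus, plus, opp; simpl. rewrite !Rmult_0_l, Rmult_0_r, exp_0. field. lra. }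
  eapply Rle_trans; [apply (Cmod_CInt_le _ g 0 d); [lra | exact X2 | eexists; exact Ig |] |].
  + intros s Hs. unfold g. rewrite Cmod_mult, kern_ray_bound by lra. fold D k q.
    specialize (Hl s Hs). change (h s + - h0) with (h s - h0).
    replace (D * / sqrt t * M * (s * exp (- q * s ^ 2)))%R with (D * / sqrt t * exp (- q * s ^ 2) * (M * s))%R by ring.
    apply Rmult_le_compat_l; [| exact Hl].
    repeat apply Rmult_le_pos; try lra. left. apply exp_pos.
  + apply (is_RInt_unique (V := R_CompleteNormedModule)) in Ig.
    match type of Ig with _ = ?v => replace (RInt _ _ _) with v by (symmetry; exact Ig) end.
    apply Rle_trans with (D * / sqrt t * M * (1 / (2 * q)))%R.
    * apply Rmult_le_compat_l; [repeat apply Rmult_le_pos; lra |].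
      apply Rmult_le_compat_r; [left; apply Rinv_0_lt_compat; lra |].
      pose proof (exp_pos (- q * d ^ 2)). lra.
    * right. transitivity (D * M / (2 * k) * (/ sqrt t * t))%R; [unfold q; field; repeat split; lra |].
      now rewrite inv_sqrt_mult by lra.
Qed.

Lemma derive_lipschitz (f : C -> C) (z l e : C) : Cmod e = 1%R -> is_derive_C f z l ->
  exists d, (0 < d)%R /\ forall s, (0 <= s <= d)%R ->
    (Cmod (f (z + e * RtoC s)%C - f z) <= (Cmod l + 1) * s)%R.
Proof.
intros He Hl. destruct (proj1 (is_derive_C_eps _ _ _) Hl (mkposreal 1 Rlt_0_1)) as [d Hd]. simpl in Hd.
pose proof (cond_pos d) as Hd0.
exists (d / 2)%R. split; [lra |]. intros s Hs.
assert (E : Cmod (z + e * s - z) = s).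
{ replace (z + e * s - z) with (e * s) by ring. rewrite Cmod_mult, He, Cmod_R, Rabs_pos_eq; lra. }
specialize (Hd (z + e * s)). rewrite E in Hd. specialize (Hd ltac:(lra)).
replace (f (z + e * s) - f z) with ((f (z + e * s) - f z - (z + e * s - z) * l) + (z + e * s - z) * l) by ring.
eapply Rle_trans; [apply Cmod_triangle |]. rewrite (Cmod_mult _ l), E. lra.
Qed.

(** Differentiability at [0] gives the Lipschitz bound only for [s <= d]; there [kern_approx]
    applies, and the rest of the ray is negligible. *)
Lemma Tint_half (a A B : R) (f : C -> C) :
  (0 < a < PI / 2)%R -> (0 <= B)%R -> admissible a A B f ->
  sqrt_close (fun t => Tint a f KK t 0) (f 0 / 2).
Proof.
intros Ha HB Hf. pose proof (admissible_nonneg a A B f Ha Hf) as HA.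
destruct (acute_pos a Ha) as [Hca Hsa].
destruct (proj1 Hf (RtoC 0) (wedge_real a 0 Ha ltac:(lra))) as [l Hl].
destruct (derive_lipschitz f 0 l (dir a) (Cmod_dir a) Hl) as [d [Hd HL]].
assert (Hfc : forall s, (0 <= s)%R -> ccont (fun s => f (dir a * RtoC s)) s).
{ intros s Hs. now apply ccont_ray, Hf, wedge_dir. }
pose proof (Cmod_ge_0 l) as Hl0.
assert (Near : sqrt_close (fun t => dir a * CInt (fun s => kern t (dir a * RtoC s) * f (dir a * RtoC s)) 0 d) (f 0 / 2)).
{ apply (kern_approx a d (Cmod l + 1)); auto; try lra.
  - intros s Hs. apply Hfc. lra.
  - intros s Hs. specialize (HL s Hs).
    replace (0 + dir a * s) with (dir a * s) in HL by ring. exact HL. }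
set (k := (cos a * sin a / 2)%R).
assert (Hk : (0 < k)%R) by (unfold k; nra).
(* For [s >= d] the Gaussian exponent satisfies [k s^2 / t >= (k d / t) s], an exponential rate
   [p / t]. *)
set (p := (k * d)%R). assert (Hp : (0 < p)%R) by (now apply Rmult_lt_0_compat).
set (D := (Cmod kern_const * A)%R).
assert (HD : (0 <= D)%R) by (apply Rmult_le_pos; [apply Cmod_ge_0 | exact HA]).
destruct (small_time p B Hp) as [t0 [Ht0 Ht0']].
assert (Far : sqrt_close (fun t => Tint a f KK t 0 -
   dir a * CInt (fun s => kern t (dir a * RtoC s) * f (dir a * RtoC s)) 0 d) 0).
{ exists (2 * D / p)%R, t0. split; [lra |]. intros t Ht. specialize (Ht0' t Ht).
  destruct (exp_over_t D p B t HD Hp ltac:(lra) Ht0') as [Hq Hle].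
  pose proof (sqrt_lt_R0 t ltac:(lra)) as Hst.
  assert (Hti : (0 < / t)%R) by (apply Rinv_0_lt_compat; lra).
  assert (Hsi : (0 < / sqrt t)%R) by (now apply Rinv_0_lt_compat).
  set (g := Tker a f KK t 0).
  assert (Hg : forall s, (0 <= s)%R -> ccont g s) by (intros; apply (Tker_cont a A B); auto; lra).
  assert (Gex : forall u v, (0 <= u)%R -> (0 <= v)%R -> ex_CInt g u v).
  { intros u v Hu Hv. apply ex_CInt_cont. intros s Hs. apply Hg.
    revert Hs. unfold Rmin. destruct (Rle_dec u v); lra. }
  assert (Ed : dir a * CInt (fun s => kern t (dir a * RtoC s) * f (dir a * RtoC s)) 0 d = CInt g 0 d).
  { rewrite <- CInt_mult.
    - apply (RInt_ext (V := CV)). intros s _. unfold g, Tker. simpl.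
      replace (0 + dir a * s) with (dir a * s) by ring. reflexivity.
    - apply ex_CInt_cont. intros s Hs. rewrite Rmin_left in Hs by lra.
      apply ccont_mult; [apply kern_ray_cont; lra | apply Hfc; lra]. }
  rewrite Ed.
  assert (HI : is_I g (Tint a f KK t 0)).
  { apply is_I_correct. apply (Tint_ex a A B); auto. lra. }
  apply le_epsilon. intros eps Heps.
  destruct (is_I_lim g _ HI (mkposreal eps Heps)) as [N HN]. simpl in HN.
  set (r := (Rmax N d + 1)%R). pose proof (Rmax_l N d). pose proof (Rmax_r N d).
  destruct (HN r ltac:(unfold r; lra)) as [_ HN'].
  assert (Echas : CInt g 0 r = CInt g 0 d + CInt g d r).
  { symmetry. apply (RInt_Chasles (V := CV)); apply Gex; unfold r; lra. }
  assert (Tail : (Cmod (CInt g d r) <= D * / sqrt t / (p * / t - B))%R).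
  { eapply Rle_trans; [apply (Cmod_CInt_exp_le g (D * / sqrt t) (p * / t - B) r d); try (unfold r; lra) |].
    - now apply Rmult_le_pos; [| lra].
    - apply Gex; unfold r; lra.
    - intros s Hs. unfold g, Tker. simpl. replace (0 + dir a * s) with (dir a * s) by ring.
      rewrite !Cmod_mult, Cmod_dir, Rmult_1_l, kern_ray_bound by lra. fold k.
      pose proof (proj2 Hf _ (wedge_dir a s Ha ltac:(lra))) as Q2.
      replace (Im (dir a * RtoC s)) with (sin a * s)%R in Q2 by (unfold dir, Im; simpl; ring).
      eapply Rle_trans; [apply Rmult_le_compat_l; [| exact Q2] |].
      { repeat apply Rmult_le_pos; try apply Cmod_ge_0; try lra. left. apply exp_pos. }
      apply Rle_trans with (D * / sqrt t * (exp (- (k * / t) * s ^ 2) * exp (B * (sin a * s))))%R.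
      { right. unfold D. ring. }
      apply Rmult_le_compat_l; [apply Rmult_le_pos; lra |].
      rewrite <- exp_plus. apply exp_le. pose proof (SIN_bound a) as Hsb.
      assert (Q3 : (B * (sin a * s) <= B * s)%R) by (apply Rmult_le_compat_l; nra).
      assert (Hkt : (0 < k * / t)%R) by (now apply Rmult_lt_0_compat).
      assert (Q4 : (k * / t * (d * s) <= k * / t * s ^ 2)%R) by (apply Rmult_le_compat_l; nra).
      unfold p. nra.
    - unfold Rdiv. apply Rmult_le_compat_r; [left; now apply Rinv_0_lt_compat |].
      rewrite <- (Rmult_1_r (D * / sqrt t)) at 2. apply Rmult_le_compat_l; [apply Rmult_le_pos; lra |].
      rewrite <- exp_0. apply exp_le. nra. }
  replace (Tint a f KK t 0 - CInt g 0 d - 0) with (- (CInt g 0 r - Tint a f KK t 0) + CInt g d r).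
  2: { rewrite Echas. ceq. ring. }
  eapply Rle_trans; [apply Cmod_triangle |]. rewrite Cmod_opp. lra. }
pose proof (sqrt_close_plus _ _ _ _ Near Far) as S.
replace (f 0 / 2 + 0) with (f 0 / 2) in S by ring.
revert S. apply sqrt_close_ext. intros t _. ring.
Qed.

(** * The bounded piece between the origin and the diagonal *)

Definition box (x y : R) (u : C) : Prop := (0 <= Re u <= x /\ 0 <= Im u <= y)%R.

Lemma box_convex (x y : R) : convex (box x y).
Proof.
intros [u1 u2] [v1 v2] s [H1 H2] [H3 H4] Hs. unfold box, Re, Im in *; simpl in *.
split; split; nra.
Qed.

Lemma box_closed (x y : R) : seq_closed (box x y).
Proof.
intros u z Hu Hz.
pose proof (half_plane_closed 1 0 0 u z Hz ltac:(intros n; destruct (Hu n); lra)).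
pose proof (half_plane_closed 0 1 0 u z Hz ltac:(intros n; destruct (Hu n); lra)).
pose proof (half_plane_closed (-1) 0 x u z Hz ltac:(intros n; destruct (Hu n); lra)).
pose proof (half_plane_closed 0 (-1) y u z Hz ltac:(intros n; destruct (Hu n); lra)).
unfold box. lra.
Qed.

Lemma ccont_bounded (h : R -> C) (u v : R) :
  (forall s, (u <= s <= v)%R -> ccont h s) ->
  exists M, (0 <= M)%R /\ forall s, (u <= s <= v)%R -> (Cmod (h s) <= M)%R.
Proof.
intros H. destruct (bounded_continuity (V := C_R_NormedModule) h u v) as [M HM].
{ intros s Hs. exact (H s Hs). }
exists (Rmax M 0). split; [apply Rmax_r |]. intros s Hs.
eapply Rle_trans; [| apply Rmax_l]. left. rewrite Cmod_norm. exact (HM s Hs).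
Qed.

Lemma kern_even (t : R) (r : C) : kern t (- r) = kern t r.
Proof. unfold kern. replace ((- r) ^ 2) with (r ^ 2) by ring. reflexivity. Qed.

(** With [u = x - s] the integrand becomes [k(u) f(x - u)], singular at [u = 0]. The segment
    [[0, x]] is replaced by a piece of the ray from [0] to [p], treated by [kern_approx], and the
    side from [p] to [x]; the triangle lies in a box that [x - u] maps below the real axis. *)
Lemma left_half (a : R) (f : C -> C) (x y : R) :
  (0 < a < PI / 2)%R -> (0 < x)%R -> (0 < y)%R ->
  (forall u, (0 <= Re u <= x)%R -> (- y <= Im u <= y)%R -> exists l, is_derive_C f u l) ->
  sqrt_close (fun t => CInt (fun s => kern t (- RtoC x + RtoC s) * f (RtoC s)) 0 x) (f (RtoC x) / 2).
Proof.
intros Ha Hx Hy Hf. destruct (acute_pos a Ha) as [Hca Hsa].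
pose proof (COS_bound a) as Hcb. pose proof (SIN_bound a) as Hsb.
assert (Hm : Cmod (- dir a) = 1%R) by (rewrite Cmod_opp; apply Cmod_dir).
destruct (Hf (RtoC x)) as [l Hl]; [simpl; lra | simpl; lra |].
destruct (derive_lipschitz f (RtoC x) l (- dir a) Hm Hl) as [d0 [Hd0 HL]].
(* Below [d0] for the Lipschitz bound, below [x] and [y] for the ray to stay in the box. *)
set (d := Rmin d0 (Rmin x y)).
assert (Hd : (0 < d)%R) by (unfold d; repeat apply Rmin_pos; lra).
assert (Hdd : (d <= d0 /\ d <= x /\ d <= y)%R).
{ unfold d. pose proof (Rmin_l d0 (Rmin x y)). pose proof (Rmin_r d0 (Rmin x y)).
  pose proof (Rmin_l x y). pose proof (Rmin_r x y). lra. }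
set (p := dir a * RtoC d).
assert (Rp : Re p = (cos a * d)%R) by (unfold p, dir, Re; simpl; ring).
assert (Ip : Im p = (sin a * d)%R) by (unfold p, dir, Im; simpl; ring).
assert (Bray : forall s, (0 <= s <= d)%R -> box x y (dir a * RtoC s)).
{ intros s Hs. unfold box, dir, Re, Im; simpl. split; split; nra. }
assert (Bx : box x y (RtoC x)) by (unfold box, Re, Im; simpl; lra).
assert (B0 : box x y (RtoC 0)) by (unfold box, Re, Im; simpl; lra).
assert (Bp : box x y p) by (apply Bray; lra).
assert (Hfb : forall u, box x y u -> exists l, is_derive_C (fun u => f (RtoC x - u)) u l).
{ intros u [Hu1 Hu2].
  destruct (Hf (RtoC x - u)) as [l' Hl'].
  - unfold Re in *; simpl. lra.
  - unfold Im in *; simpl. lra.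
  - exists (RtoC (-1) * l').
    assert (E : forall u, RtoC x + RtoC (-1) * u = RtoC x - u) by (intros; apply injective_projections; simpl; ring).
    apply (is_derive_C_ext (fun u => f (RtoC x + RtoC (-1) * u))); [intros; now rewrite E |].
    apply (is_derive_C_comp f (fun u => RtoC x + RtoC (-1) * u)); [now rewrite E | apply is_derive_C_affine]. }
assert (Near : sqrt_close (fun t => dir a * CInt (fun s => kern t (dir a * RtoC s) * f (RtoC x - dir a * RtoC s)) 0 d) (f (RtoC x) / 2)).
{ apply (kern_approx a d (Cmod l + 1) (f (RtoC x)) (fun s => f (RtoC x - dir a * RtoC s))); auto.
  - pose proof (Cmod_ge_0 l). lra.
  - intros s Hs. apply (ccont_ray (fun u => f (RtoC x - u))). auto.
  - intros s Hs. specialize (HL s ltac:(lra)).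
    replace (RtoC x - dir a * s) with (RtoC x + - dir a * s) by ring. exact HL. }
assert (Hseg : forall s, (0 <= s <= 1)%R -> ccont (fun s => f (RtoC x - (RtoC x + (p - RtoC x) * RtoC s))) s).
{ apply (seg_cont_holomorphic (box x y) (fun u => f (RtoC x - u))); auto using box_convex. }
destruct (ccont_bounded _ 0 1 Hseg) as [Mf [HMf Hbf]].
(* On the side from [x] to [p] one has [Re u >= d cos a] and [Im u = s d sin a], so the kernel
   decays like [exp (- k s / t)]. At [x] itself nothing decays; it is the integration in [s] that
   gains the factor [t]. *)
set (k := (d * cos a * (d * sin a) / 2)%R).
assert (Hk : (0 < k)%R) by (unfold k; assert (0 < d * cos a)%R by nra; assert (0 < d * sin a)%R by nra; nra).
set (D := (Cmod kern_const * Mf)%R).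
assert (HD : (0 <= D)%R) by (apply Rmult_le_pos; [apply Cmod_ge_0 | exact HMf]).
assert (Far : sqrt_close (fun t => CInt (fun s => kern t (- RtoC x + RtoC s) * f (RtoC s)) 0 x -
   dir a * CInt (fun s => kern t (dir a * RtoC s) * f (RtoC x - dir a * RtoC s)) 0 d) 0).
{ exists (Cmod (p - RtoC x) * (D / k))%R, 1%R. split; [lra |]. intros t Ht.
  pose proof (sqrt_lt_R0 t ltac:(lra)) as Hst.
  assert (Hti : (0 < / t)%R) by (apply Rinv_0_lt_compat; lra).
  assert (Hsi : (0 < / sqrt t)%R) by (now apply Rinv_0_lt_compat).
  set (G := fun u => kern t u * f (RtoC x - u)).
  assert (HG : forall u, box x y u -> exists l, is_derive_C G u l).
  { intros u Hu. destruct (Hfb u Hu) as [l' Hl']. eexists.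
    apply (is_derive_C_mult (kern t) (fun u => f (RtoC x - u))); [apply is_derive_C_kern; lra | exact Hl']. }
  assert (HGs : forall u v, box x y u -> box x y v -> seg_cont G u v).
  { intros u v Hu Hv. apply (seg_cont_holomorphic (box x y)); auto using box_convex. }
  pose proof (goursat (box x y) G 0 p (RtoC x) (box_convex x y) (box_closed x y) HG B0 Bp Bx) as Gz.
  unfold tri in Gz.
  rewrite (seg_swap G 0 (RtoC x)), (seg_swap G (RtoC x) p) in Gz by auto.
  assert (E1 : seg G 0 p = dir a * CInt (fun s => kern t (dir a * RtoC s) * f (RtoC x - dir a * RtoC s)) 0 d).
  { unfold p. rewrite CInt_seg; [reflexivity | lra |]. intros s Hs. apply ccont_ray. auto. }
  assert (CG : forall s, (0 <= s <= x)%R -> ccont (fun s => G (RtoC s)) s).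
  { intros s Hs. apply ccont_real, HG. unfold box, Re, Im; simpl; lra. }
  pose proof (CInt_seg_real G x ltac:(lra) CG) as E2.
  assert (E3 : CInt (fun s => kern t (- RtoC x + RtoC s) * f (RtoC s)) 0 x = CInt (fun s => G (RtoC s)) 0 x).
  { destruct (CInt_comp_lin (fun s => G (RtoC s)) (-1) x 0 x) as [L _].
    { replace (-1 * 0 + x)%R with x by ring. replace (-1 * x + x)%R with 0%R by ring.
      apply ex_CInt_cont. intros s Hs. apply CG. rewrite Rmin_right, Rmax_left in Hs by lra. lra. }
    replace (-1 * 0 + x)%R with x in L by ring. replace (-1 * x + x)%R with 0%R in L by ring.
    assert (Sw : CInt (fun s => G (RtoC s)) x 0 = - CInt (fun s => G (RtoC s)) 0 x).
    { symmetry. apply (opp_RInt_swap (V := CV)). apply ex_CInt_cont.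
      intros s Hs. apply CG. rewrite Rmin_left, Rmax_right in Hs by lra. lra. }
    rewrite Sw, RtoC_m1 in L.
    transitivity (CInt (fun s => G (RtoC (-1 * s + x)%R)) 0 x).
    - apply (RInt_ext (V := CV)). intros s _. unfold G.
      rewrite RtoC_plus, RtoC_mult, RtoC_m1. rewrite <- kern_even. f_equal; f_equal; ring.
    - assert (Neg : forall z w : C, - RtoC 1 * z = - w -> z = w).
      { intros z w Hzw. transitivity (- (- RtoC 1 * z)); [ring |]. rewrite Hzw. ring. }
      exact (Neg _ _ L). }
  rewrite E3, <- E2, <- E1.
  replace (seg G 0 x - seg G 0 p - 0) with (- seg G (RtoC x) p).
  2: { transitivity (seg G 0 p + - seg G x p + - seg G 0 x + (seg G 0 x - seg G 0 p)); [ring |].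
       rewrite Gz. ring. }
  rewrite Cmod_opp. unfold seg. rewrite Cmod_mult, Rmult_assoc.
  apply Rmult_le_compat_l; [apply Cmod_ge_0 |].
  assert (Hkt : (0 < k * / t)%R) by (now apply Rmult_lt_0_compat).
  eapply Rle_trans; [apply (Cmod_CInt_exp_le _ (D * / sqrt t) (k * / t) 1 0); try lra |].
  - apply Rmult_le_pos; lra.
  - apply seg_cont_ex; auto; lra.
  - intros s Hs. unfold G. rewrite Cmod_mult, Cmod_kern by lra.
    set (u := RtoC x + (p - RtoC x) * s).
    assert (Ru : Re u = (x + (cos a * d - x) * s)%R) by (rewrite <- Rp; unfold u, Re; simpl; ring).
    assert (Iu : Im u = (sin a * d * s)%R) by (rewrite <- Ip; unfold u, Im; simpl; ring).
    rewrite Ru, Iu.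
    replace (D * / sqrt t * exp (- (k * / t) * s))%R with (Cmod kern_const * / sqrt t * exp (- (k * / t) * s) * Mf)%R by (unfold D; ring).
    apply Rmult_le_compat; [| apply Cmod_ge_0 | | now apply Hbf].
    + repeat apply Rmult_le_pos; try apply Cmod_ge_0; try lra. left. apply exp_pos.
    + apply Rmult_le_compat_l; [apply Rmult_le_pos; [apply Cmod_ge_0 | lra] |].
      apply exp_le. replace (/ (2 * t))%R with (/ t / 2)%R by (field; lra).
      assert (Q0 : (0 <= (x - cos a * d) * (1 - s))%R) by (apply Rmult_le_pos; nra).
      assert (Q1 : (cos a * d <= x + (cos a * d - x) * s)%R) by nra.
      assert (Q2 : (0 <= sin a * d * s)%R) by (repeat apply Rmult_le_pos; lra).
      assert (Q3 : (cos a * d * (sin a * d * s) <= (x + (cos a * d - x) * s) * (sin a * d * s))%R)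
        by (apply Rmult_le_compat_r; lra).
      set (W := ((x + (cos a * d - x) * s) * (sin a * d * s))%R) in *.
      assert (Q4 : (cos a * d * (sin a * d * s) * / t <= W * / t)%R) by (apply Rmult_le_compat_r; lra).
      unfold k. nra.
  - rewrite Rmult_0_r, exp_0. right.
    transitivity (D / k * (/ sqrt t * t))%R; [field; repeat split; lra |].
    now rewrite inv_sqrt_mult by lra. }
pose proof (sqrt_close_plus _ _ _ _ Near Far) as S.
replace (f (RtoC x) / 2 + 0) with (f (RtoC x) / 2) in S by ring.
assert (Simp : forall z w : C, w + (z - w) = z) by (intros; ring).
revert S. apply sqrt_close_ext. intros t _. apply Simp.
Qed.

Lemma admissible_shift (a A B : R) (f : C -> C) (x : R) :
  (0 < a < PI / 2)%R -> (0 <= x)%R -> admissible a A B f -> admissible a A B (fun z => f (RtoC x + z)).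
Proof.
intros Ha Hx [H1 H2]. destruct (acute_pos a Ha) as [Hc Hs].
assert (W : forall z, wedge a z -> wedge a (RtoC x + z)).
{ intros z [W1 W2]. unfold wedge, Re, Im in *; simpl. split; nra. }
split.
- intros z Hz. destruct (H1 _ (W z Hz)) as [l Hl]. exists (1 * l).
  apply (is_derive_C_comp f (fun z => RtoC x + z)); [exact Hl |].
  pose proof (is_derive_C_plus (fun _ => RtoC x) (fun z => z) z _ _ (is_derive_C_const _ z) (is_derive_C_id z)) as D.
  replace (0 + 1) with (RtoC 1) in D by ring. exact D.
- intros z Hz. replace (Im z) with (Im (RtoC x + z)) by (unfold Im; simpl; ring). now apply H2, W.
Qed.

(** The ray issued from [0] cannot be cut at [y = x]; so both rotated integrals are moved back to
    the real axis by [Tint_contour], where the cut is additivity of the integral. *)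
Lemma Tint_split (a A B : R) (f : C -> C) (t x : R) :
  (0 < a < PI / 2)%R -> (0 <= B)%R -> (0 < x)%R -> admissible a A B f -> (0 < t)%R ->
  Tint a f KK t (- x) =
  CInt (fun s => kern t (- RtoC x + RtoC s) * f (RtoC s)) 0 x + Tint a (fun z => f (RtoC x + z)) KK t 0.
Proof.
intros Ha HB Hx Hf Ht.
pose proof (Tint_contour a A B f KK t (- x) Ha HB Hf (gaussian_KK a) Ht) as H1.
pose proof (Tint_contour a A B _ KK t 0 Ha HB (admissible_shift a A B f x Ha ltac:(lra) Hf) (gaussian_KK a) Ht) as H2.
simpl in H1, H2.
set (l2 := Tint a (fun z => f (RtoC x + z)) KK t 0) in *.
rewrite <- (is_I_unique _ _ H1). apply is_I_unique.
set (g := fun s => kern t (- RtoC x + RtoC s) * f (RtoC s)).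
assert (Cg : forall s, (0 <= s)%R -> ccont g s).
{ intros s Hs. apply (ccont_real (fun u => kern t (- RtoC x + u) * f u)).
  destruct (proj1 Hf (RtoC s) (wedge_real a s Ha Hs)) as [l Hl]. eexists.
  apply (is_derive_C_mult (fun u => kern t (- RtoC x + u)) f); [| exact Hl].
  apply (is_derive_C_comp (kern t) (fun u => - RtoC x + u)); [now apply is_derive_C_kern |].
  apply (is_derive_C_plus (fun _ => - RtoC x) (fun u => u)); [apply is_derive_C_const | apply is_derive_C_id]. }
assert (Gex : forall u v, (0 <= u)%R -> (0 <= v)%R -> ex_CInt g u v).
{ intros u v Hu Hv. apply ex_CInt_cont. intros s Hs. apply Cg.
  revert Hs. unfold Rmin. destruct (Rle_dec u v); lra. }
apply (is_I_ext g).
{ intros s _. unfold g. now rewrite RtoC_opp. }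
apply is_I_eps; [intros r Hr; apply Gex; lra |].
intros eps. destruct (is_I_lim _ _ H2 eps) as [N HN].
exists (Rmax N 0 + x)%R. intros r Hr _. pose proof (Rmax_l N 0). pose proof (Rmax_r N 0).
destruct (HN (r - x)%R ltac:(lra)) as [X1 X2].
assert (Ech : CInt g 0 r = CInt g 0 x + CInt g x r).
{ symmetry. apply (RInt_Chasles (V := CV)); apply Gex; lra. }
destruct (CInt_comp_lin g 1 x 0 (r - x)) as [L _].
{ apply Gex; lra. }
replace (1 * 0 + x)%R with x in L by ring. replace (1 * (r - x) + x)%R with r in L by ring.
rewrite Cmult_1_l in L.
assert (E : CInt (fun y => g (1 * y + x)%R) 0 (r - x) = CInt (fun y => kern t (RtoC 0 + RtoC y) * f (RtoC x + RtoC y)) 0 (r - x)).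
{ apply (RInt_ext (V := CV)). intros s _. unfold g. rewrite RtoC_plus, RtoC_mult. f_equal; f_equal; ring. }
rewrite Ech, <- L, E. fold g.
set (J := CInt (fun y => kern t (RtoC 0 + RtoC y) * f (RtoC x + RtoC y)) 0 (r - x)) in *.
set (J0 := CInt g 0 x).
replace (J0 + J - (J0 + l2)) with (J - l2) by (ceq; ring).
exact X2.
Qed.

Lemma Tint_initial_main (a A B : R) (f : C -> C) (x y : R) :
  (0 < a < PI / 2)%R -> (0 <= B)%R -> admissible a A B f -> (0 < x)%R -> (0 < y)%R ->
  (forall u, (0 <= Re u <= x)%R -> (- y <= Im u <= y)%R -> exists l, is_derive_C f u l) ->
  sqrt_close (fun t => Tint a f KK t (- x)) (f (RtoC x)).
Proof.
intros Ha HB Hf Hx Hy Hd.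
pose proof (left_half a f x y Ha Hx Hy Hd) as H1.
pose proof (Tint_half a A B _ Ha HB (admissible_shift a A B f x Ha ltac:(lra) Hf)) as H2.
pose proof (sqrt_close_plus _ _ _ _ H1 H2) as H. cbv beta in H.
replace (f (RtoC x) / 2 + f (RtoC x + 0) / 2) with (f (RtoC x)) in H.
- revert H. apply sqrt_close_ext. intros t Ht. symmetry. now apply (Tint_split a A B).
- replace (RtoC x + 0) with (RtoC x) by ring. field.
Qed.

(** Each point of the interval has a square neighbourhood inside [Omega]; compactness makes the
    radius uniform. The interval is symmetric so as to serve both signs of [x]. *)
Lemma tube (Omega : C -> Prop) (x : R) :
  open (T := C_UniformSpace) Omega -> (forall s, (- x <= s <= x)%R -> Omega (RtoC s)) ->
  exists y, (0 < y)%R /\ forall u, (- x <= Re u <= x)%R -> (- y <= Im u <= y)%R -> Omega u.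
Proof.
intros HO HS.
assert (Hd : forall s, exists e : posreal, (- x <= s <= x)%R ->
   forall u : C, (Rabs (Re u - s) < e)%R -> (Rabs (Im u) < e)%R -> Omega u).
{ intros s. destruct (classic (- x <= s <= x)%R) as [Hs | Hs].
  - destruct (HO (RtoC s) (HS s Hs)) as [e He]. exists e. intros _ u H1 H2. apply He. split.
    + exact H1.
    + change (Rabs (Im u - 0) < e)%R. now rewrite Rminus_0_r.
  - exists (mkposreal 1 Rlt_0_1). tauto. }
pose (delta := fun s => proj1_sig (constructive_indefinite_description _ (Hd s))).
assert (Hdelta : forall s, (- x <= s <= x)%R ->
   forall u : C, (Rabs (Re u - s) < delta s)%R -> (Rabs (Im u) < delta s)%R -> Omega u).
{ intros s. exact (proj2_sig (constructive_indefinite_description _ (Hd s))). }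
(* For every point, [Hc] doubly negates the existence of a centre [s] with [|Re u - s| < delta s]
   and [d <= delta s], hence the classical step below. *)
destruct (compactness_value_1d (- x) x delta) as [d Hc].
exists (d / 2)%R. pose proof (cond_pos d) as Hd0. split; [lra |].
intros u H1 H2. apply NNPP. intros Hn. apply (Hc (Re u) H1). intros [s (S1 & S2 & S3)].
apply Hn, (Hdelta s S1); [exact S2 |]. apply Rle_lt_trans with (d / 2)%R; [apply Rabs_le; lra | lra].
Qed.

(** * The boundary condition *)

(** The vector [(1 - a1 h, i b h)] is an eigenvector of the matrix with rows [(a + i a1, - bb)] and
    [(b, a - i a1)], for the eigenvalue [a - i q]. Here [h] stands for [1 / q], or for [0] if
    [q = 0]: the hypotheses hold in both cases. [bb] is kept apart from [b] so that the other column
    follows by substitution. *)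
Lemma eigenvector_eq (a a1 q h b bb : C) :
  q * q * h = q -> q * h * a1 = a1 -> q * h * b = b -> q * q = a1 * a1 + b * bb ->
  (a + Ci * a1) * (1 - a1 * h) - bb * (Ci * b * h) = (a - Ci * q) * (1 - a1 * h) /\
  b * (1 - a1 * h) + (a - Ci * a1) * (Ci * b * h) = (a - Ci * q) * (Ci * b * h).
Proof.
intros H1 H2 H3 H4. split.
- transitivity ((a - Ci * q) * (1 - a1 * h) +
    Ci * ((a1 - q * h * a1) + (q - q * q * h) + (q * q - (a1 * a1 + b * bb)) * h)); [ring |].
  rewrite H2, H1, H4. ring.
- transitivity ((a - Ci * q) * (Ci * b * h) + (b - q * h * b) + (Ci * Ci + 1) * (q * b * h - a1 * b * h)); [ring |].
  rewrite H3, Ci_sqr. ring.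
Qed.

(** One row of [(I - J) v = i w (I + J) v], the boundary condition for a profile whose outward
    derivative is [w] times its value. *)
Definition bc_row (m1 m2 w v1 v2 v : C) : Prop :=
  v - (m1 * v1 + m2 * v2) = Ci * w * (v + (m1 * v1 + m2 * v2)).

Lemma bc_row_eigen (m1 m2 w v1 v2 v lam : C) :
  m1 * v1 + m2 * v2 = lam * v -> 1 - lam = Ci * w * (1 + lam) -> bc_row m1 m2 w v1 v2 v.
Proof.
intros H1 H2. unfold bc_row. rewrite H1.
transitivity ((1 - lam) * v); [ring |]. rewrite H2. ring.
Qed.

Lemma bc_row_scal (m1 m2 w v1 v2 v k : C) :
  bc_row m1 m2 w v1 v2 v -> bc_row m1 m2 w (k * v1) (k * v2) (k * v).
Proof.
unfold bc_row. intros H.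
transitivity (k * (v - (m1 * v1 + m2 * v2))); [ring |]. rewrite H. ring.
Qed.

(** The origin of [omega]: it is the Cayley transform [- i (1 - lam) / (1 + lam)] of the eigenvalue
    [lam = e^(i phi) (a - i q)]. The sign of [q] is left free, so that both [omega_plus] and
    [omega_minus] are covered. *)
Lemma eigenvalue_generic (c s a q w : R) :
  (c * c + s * s = 1)%R -> (q * q = 1 - a * a)%R -> (c + a <> 0)%R -> (w = (- s + q) / (c + a))%R ->
  1 - (c, s) * (a - Ci * q) = Ci * w * (1 + (c, s) * (a - Ci * q)).
Proof.
intros H1 H2 H3 ->.
assert (Hs : (s * s = 1 - c * c)%R) by lra.
apply injective_projections; simpl.
- apply Rmult_eq_reg_l with (c + a)%R; [| exact H3]. field_simplify; [| exact H3]. ring [Hs H2].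
- apply Rmult_eq_reg_l with (c + a)%R; [| exact H3]. field_simplify; [| exact H3]. ring [Hs H2].
Qed.

(** This explains the factor [- omega / 2] in [mu]: differentiating [mu E_w] produces [- 2 mu k],
    and these terms must balance the value of the remaining free kernels. *)
Lemma mixed_row (m1 m2 wp wm p1 p2 p n1 n2 n : C) :
  bc_row m1 m2 wp p1 p2 p -> bc_row m1 m2 wm n1 n2 n ->
  (p + n) - (m1 * (p1 + n1) + m2 * (p2 + n2)) =
  - (2) * Ci * ((- (wp / 2) * p + - (wm / 2) * n) +
    (m1 * (- (wp / 2) * p1 + - (wm / 2) * n1) + m2 * (- (wp / 2) * p2 + - (wm / 2) * n2))).
Proof.
unfold bc_row. intros H1 H2.
transitivity ((p - (m1 * p1 + m2 * p2)) + (n - (m1 * n1 + m2 * n2))); [ring |].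
rewrite H1, H2. field.
Qed.

(** If [|Re alpha| = 1], normalization forces [Im alpha = beta = 0], and [h = 0] satisfies the same
    identities as [h = 1 / q]; later arguments need not distinguish the two cases. *)
Lemma eta_values (alpha beta : C) : (Cmod alpha ^ 2 + Cmod beta ^ 2 = 1)%R ->
  let q := sqrt (1 - Re alpha ^ 2) in exists h : R,
  (q * q = 1 - Re alpha * Re alpha /\ q * q * h = q /\
   q * h * Im alpha = Im alpha /\ q * h * Re beta = Re beta /\ q * h * Im beta = Im beta)%R /\
  eta alpha beta 1 1 = - Im alpha * h /\ eta alpha beta 1 (-1) = - Ci * Cconj beta * h /\
  eta alpha beta (-1) 1 = Ci * beta * h /\ eta alpha beta (-1) (-1) = Im alpha * h.
Proof.
rewrite !Cmod2_alt. intros Hn q.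
assert (Hq : (q * q = 1 - Re alpha * Re alpha)%R).
{ unfold q. rewrite sqrt_sqrt by nra. ring. }
exists (if Req_dec_T (Rabs (Re alpha)) 1 then 0%R else (/ q)%R).
unfold eta. fold q.
assert (D1 : (0 < 1)%R) by lra. assert (D2 : ~ (0 < -1)%R) by lra.
destruct (Rlt_dec 0 1) as [_ | N]; [| contradiction].
destruct (Rlt_dec 0 (-1)) as [N | _]; [contradiction |].
destruct (Req_dec_T (Rabs (Re alpha)) 1) as [E | E].
- assert (E2 : (Re alpha * Re alpha = 1)%R).
  { change (Rsqr (Re alpha) = 1)%R. rewrite Rsqr_abs, E. unfold Rsqr. ring. }
  assert (q = 0)%R by nra. assert (Im alpha = 0)%R by nra.
  assert (Re beta = 0)%R by nra. assert (Im beta = 0)%R by nra.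
  split; repeat split; lra || ring.
- assert (Hq0 : q <> 0%R).
  { intros H0. apply E. rewrite H0 in Hq.
    assert (E2 : Rsqr (Re alpha) = Rsqr 1) by (unfold Rsqr; lra).
    apply Rsqr_eq_abs_0 in E2. rewrite E2. apply Rabs_R1. }
  rewrite RtoC_inv by exact Hq0.
  split; repeat split; exact Hq || (field; exact Hq0) || ring.
Qed.

Lemma eigen_pair (a a1 q h : R) (b : C) :
  (q * q = 1 - a * a)%R -> (a * a + a1 * a1 + Re b * Re b + Im b * Im b = 1)%R ->
  (q * q * h = q)%R -> (q * h * a1 = a1)%R -> (q * h * Re b = Re b)%R -> (q * h * Im b = Im b)%R ->
  forall e : C,
  e * (a + Ci * a1) * (1 - a1 * h) + e * - Cconj b * (Ci * b * h) = e * (a - Ci * q) * (1 - a1 * h) /\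
  e * b * (1 - a1 * h) + e * (a - Ci * a1) * (Ci * b * h) = e * (a - Ci * q) * (Ci * b * h) /\
  e * (a + Ci * a1) * (- Ci * Cconj b * h) + e * - Cconj b * (1 + a1 * h) = e * (a - Ci * q) * (- Ci * Cconj b * h) /\
  e * b * (- Ci * Cconj b * h) + e * (a - Ci * a1) * (1 + a1 * h) = e * (a - Ci * q) * (1 + a1 * h).
Proof.
intros H0 Hn H1 H2 H3 H4 e.
assert (C1 : RtoC q * q * h = q) by (now rewrite <- !RtoC_mult, H1).
assert (C2 : RtoC q * h * a1 = a1) by (now rewrite <- !RtoC_mult, H2).
assert (C3 : RtoC q * h * b = b).
{ rewrite <- RtoC_mult. apply injective_projections; unfold Re, Im in *; simpl; lra. }
assert (C4 : RtoC q * h * Cconj b = Cconj b).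
{ rewrite <- RtoC_mult. apply injective_projections; unfold Re, Im in *; simpl; lra. }
assert (C5 : RtoC q * q = RtoC a1 * a1 + b * Cconj b).
{ apply injective_projections; unfold Re, Im in *; simpl; lra. }
destruct (eigenvector_eq a a1 q h b (Cconj b) C1 C2 C3 C5) as [E1 E2].
(* The second column is the first one with [a1] replaced by [- a1], [b] by [- Cconj b], and the two
   rows exchanged. *)
destruct (eigenvector_eq a (- a1) q h (- Cconj b) (- b)) as [E3 E4]; auto.
{ transitivity (- (RtoC q * h * a1)); [ring |]. now rewrite C2. }
{ transitivity (- (RtoC q * h * Cconj b)); [ring |]. now rewrite C4. }
{ rewrite C5. ring. }
repeat split.
- transitivity (e * ((a + Ci * a1) * (1 - a1 * h) - Cconj b * (Ci * b * h))); [ring |]. rewrite E1. ring.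
- transitivity (e * (b * (1 - a1 * h) + (a - Ci * a1) * (Ci * b * h))); [ring |]. rewrite E2. ring.
- transitivity (e * (- Cconj b * (1 - - a1 * h) + (a - Ci * - a1) * (Ci * - Cconj b * h))); [ring |]. rewrite E4. ring.
- transitivity (e * ((a + Ci * - a1) * (1 - - a1 * h) - - b * (Ci * - Cconj b * h))); [ring |]. rewrite E3. ring.
Qed.

Lemma cexp_Ci (p : R) : cexp (Ci * p) = (cos p, sin p).
Proof.
rewrite cexp_pair. replace (Re (Ci * p)) with 0%R by (unfold Re; simpl; ring).
replace (Im (Ci * p)) with p by (unfold Im; simpl; ring).
rewrite exp_0. apply injective_projections; simpl; ring.
Qed.

(** The column of coefficients multiplying [F(y)], [y] of sign [tau], splits
    along the eigenvectors of [J], with eigenvalues [e^(i phi) (Re alpha -+ i q)],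
    [q = sqrt (1 - (Re alpha)^2)]. *)
Definition column_ok (phi : R) (alpha beta : C) (tau : R) (j1 j2 : C) (s : R) : Prop :=
  let mp := mu_plus phi alpha beta in
  let mm := mu_minus phi alpha beta in
  let m0 := mu_zero phi alpha beta in
  bc_row j1 j2 (omega_plus phi alpha) (mp 1 tau) (mp (-1) tau) (mp s tau) /\
  bc_row j1 j2 (omega_minus phi alpha) (mm 1 tau) (mm (-1) tau) (mm s tau) /\
  (m0 s tau + 1) - (j1 * (m0 1 tau + 1) + j2 * (m0 (-1) tau + 1)) =
    - (2) * Ci * ((mp s tau + mm s tau) + (j1 * (mp 1 tau + mm 1 tau) + j2 * (mp (-1) tau + mm (-1) tau))) /\
  (m0 s tau - s * tau) + (j1 * (m0 1 tau - tau) + j2 * (m0 (-1) tau + tau)) = 0.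

(** The eigenvalue [-1] has no finite Cayley transform. An eigenvector for it is killed by [I + J],
    so it is unconstrained in the derivative and forbidden in the value; the three cases differ by
    how many of the two eigenvalues are [-1], and [mu_zero] takes over from the missing [mu]. *)
Lemma column_row (phi : R) (alpha beta : C) (tau s : R) (j1 j2 : C) :
  (0 <= phi < PI)%R -> (Cmod alpha ^ 2 + Cmod beta ^ 2 = 1)%R ->
  (tau = 1 \/ tau = -1)%R -> (s = 1 \/ s = -1)%R ->
  let e := (cos phi, sin phi) : C in
  let q := sqrt (1 - Re alpha ^ 2) in
  let T := fun x : R => RtoC (Theta (x * tau)) in
  let et := fun x : R => eta alpha beta x tau in
  j1 * (T 1%R + et 1%R) + j2 * (T (-1)%R + et (-1)%R) = e * (Re alpha - Ci * q) * (T s + et s) ->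
  j1 * (T 1%R - et 1%R) + j2 * (T (-1)%R - et (-1)%R) = e * (Re alpha + Ci * q) * (T s - et s) ->
  column_ok phi alpha beta tau j1 j2 s.
Proof.
intros Hphi Hn Htau Hs e q T et Hp Hm.
assert (Hab : (Re alpha * Re alpha <= 1)%R) by (rewrite !Cmod2_alt in Hn; nra).
assert (Hq : (q * q = 1 - Re alpha * Re alpha)%R) by (unfold q; rewrite sqrt_sqrt by nra; ring).
pose proof (sqrt_pos (1 - Re alpha ^ 2)) as Hq0. fold q in Hq0.
pose proof (sin2_cos2 phi) as Hcs. unfold Rsqr in Hcs.
assert (Hsin : (0 <= sin phi)%R) by (apply sin_ge_0; lra).
assert (HT : forall x, (x = 1 \/ x = -1)%R -> RtoC (x * tau) = 2 * T x - 1 /\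
   RtoC (sign (x * tau)) = 2 * T x - 1 /\ RtoC (Theta (- (x * tau))) = 1 - T x).
{ intros x Hx. unfold T, Theta.
  assert (Hxt : (x * tau = 1 \/ x * tau = -1)%R) by (destruct Hx as [-> | ->], Htau as [-> | ->]; lra).
  destruct Hxt as [-> | ->].
  - rewrite sign_eq_1 by lra. destruct (Rlt_dec 0 1); [| lra]. destruct (Rlt_dec 0 (- (1))); [lra |].
    repeat split; apply injective_projections; simpl; ring.
  - rewrite sign_eq_m1 by lra. destruct (Rlt_dec 0 (-1)); [lra |]. destruct (Rlt_dec 0 (- (-1))); [| lra].
    repeat split; apply injective_projections; simpl; ring. }
destruct (HT 1%R (or_introl eq_refl)) as (A1 & A2 & A3).
destruct (HT (-1)%R (or_intror eq_refl)) as (B1 & B2 & B3).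
destruct (HT s Hs) as (S1 & S2 & S3).
assert (A1' : RtoC tau = 2 * T 1%R - 1) by (rewrite <- A1; f_equal; ring).
assert (B1' : RtoC tau = 1 - 2 * T (-1)%R).
{ transitivity (- RtoC (-1 * tau)); [rewrite <- RtoC_opp; f_equal; ring | rewrite B1; ring]. }
rewrite RtoC_mult in S1.
unfold column_ok, omega_plus, omega_minus, mu_plus, mu_minus, mu_zero, by_case.
change (eta alpha beta 1 tau) with (et 1%R). change (eta alpha beta (-1) tau) with (et (-1)%R).
change (eta alpha beta s tau) with (et s).
change (RtoC (Theta (1 * tau))) with (T 1%R). change (RtoC (Theta (-1 * tau))) with (T (-1)%R).
change (RtoC (Theta (s * tau))) with (T s).
unfold omega_plus, omega_minus, by_case.
destruct (Req_dec_T (Re alpha) (- cos phi)) as [Hc | Hc].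
- destruct (Req_dec_T (Re alpha) (-1)) as [Ha | Ha].
  (* Case III: both eigenvalues are [-1], and the sum of the two eigenvector equations remains. *)
  + assert (Eq0 : q = 0%R) by (rewrite Ha in Hq; nra).
    assert (Hcos : cos phi = 1%R) by lra. assert (Hsin0 : sin phi = 0%R) by (rewrite Hcos in Hcs; nra).
    assert (Ee : e * (Re alpha - Ci * q) = - (1) /\ e * (Re alpha + Ci * q) = - (1)).
    { unfold e. rewrite Hcos, Hsin0, Ha, Eq0. split; apply injective_projections; simpl; ring. }
    destruct Ee as [Ee1 Ee2]. rewrite Ee1 in Hp. rewrite Ee2 in Hm.
    unfold bc_row. rewrite RtoC_m1. repeat split; try ring.
    rewrite S1. replace (- (1) - RtoC tau) with (- (2) * T 1%R) by (rewrite A1'; ring).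
    replace (- (1) + RtoC tau) with (- (2) * T (-1)%R) by (rewrite B1'; ring).
    transitivity (- (2) * T s - ((j1 * (T 1%R + et 1%R) + j2 * (T (-1)%R + et (-1)%R)) + (j1 * (T 1%R - et 1%R) + j2 * (T (-1)%R - et (-1)%R)))); [ring |].
    rewrite Hp, Hm. ring.
  + assert (Hs0 : sin phi <> 0%R).
    { intros H0. rewrite H0 in Hcs. assert (Hphi0 : phi = 0%R).
      { destruct (Req_dec_T phi 0) as [E | E]; [exact E |]. pose proof (sin_gt_0 phi ltac:(lra) ltac:(lra)). lra. }
      rewrite Hphi0, cos_0 in Hc. lra. }
    (* Case II: the column [T - eta] has eigenvalue [-1] and appears only in the derivative of the
       [kern] terms; [T + eta] keeps the finite [omega_plus = cot phi]. *)
    assert (Eq : q = sin phi) by (rewrite Hc in Hq; nra).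
    assert (Lm : e * (Re alpha + Ci * q) = - (1)).
    { unfold e. rewrite Hc, Eq. apply injective_projections; simpl; lra. }
    assert (Lp : 1 - e * (Re alpha - Ci * q) = Ci * RtoC (cos phi / sin phi) * (1 + e * (Re alpha - Ci * q))).
    { unfold e. rewrite Hc, Eq. assert (Hs2 : (sin phi * sin phi = 1 - cos phi * cos phi)%R) by lra.
      apply injective_projections; simpl; field_simplify; try exact Hs0;
        apply Rmult_eq_reg_r with (sin phi); try exact Hs0; field_simplify; try exact Hs0; ring [Hs2]. }
    pose proof (bc_row_eigen _ _ _ _ _ _ _ Hp Lp) as Bp. rewrite Lm in Hm.
    split; [| split; [| split]].
    * now apply bc_row_scal.
    * unfold bc_row. ring.
    * rewrite A3, B3, S3. unfold bc_row in Bp.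
      transitivity ((T s + et s) - (j1 * (T 1%R + et 1%R) + j2 * (T (-1)%R + et (-1)%R))); [ring |].
      rewrite Bp. field.
    * rewrite A3, B3, S3, S1.
      replace (et 1%R - (1 - T 1%R) - RtoC tau) with (- (T 1%R - et 1%R)) by (rewrite A1'; ring).
      replace (et (-1)%R - (1 - T (-1)%R) + RtoC tau) with (- (T (-1)%R - et (-1)%R)) by (rewrite B1'; ring).
      transitivity (- (T s - et s) - (j1 * (T 1%R - et 1%R) + j2 * (T (-1)%R - et (-1)%R))); [ring |].
      rewrite Hm. ring.
(* Case I: both eigenvalues have a finite Cayley transform, and the coefficients of the free kernel
   are governed by [mixed_row]. *)
- assert (Hca : (cos phi + Re alpha <> 0)%R) by lra.
  pose proof (eigenvalue_generic (cos phi) (sin phi) (Re alpha) q _ ltac:(lra) Hq Hca eq_refl) as Lp.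
  pose proof (eigenvalue_generic (cos phi) (sin phi) (Re alpha) (- q) ((- sin phi - q) / (cos phi + Re alpha)) ltac:(lra) ltac:(lra) Hca eq_refl) as Lm.
  fold e in Lp, Lm.
  replace (Re alpha - Ci * RtoC (- q)) with (Re alpha + Ci * q) in Lm by (rewrite RtoC_opp; ring).
  pose proof (bc_row_eigen _ _ _ _ _ _ _ Hp Lp) as Bp.
  pose proof (bc_row_eigen _ _ _ _ _ _ _ Hm Lm) as Bm.
  fold q.
  split; [| split; [| split]].
  + now apply bc_row_scal.
  + now apply bc_row_scal.
  + rewrite A2, B2, S2. pose proof (mixed_row _ _ _ _ _ _ _ _ _ _ Bp Bm) as M.
    etransitivity; [| exact M]. ring.
  + rewrite A2, B2, S2, S1, A1'.
    replace (2 * T (-1)%R - 1 + (2 * T 1%R - 1)) with (RtoC 0) by (rewrite <- A1', B1'; ring). ring.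
Qed.

Lemma columns_ok (phi : R) (alpha beta : C) (tau : R) :
  (0 <= phi < PI)%R -> (Cmod alpha ^ 2 + Cmod beta ^ 2 = 1)%R -> (tau = 1 \/ tau = -1)%R ->
  let e := cexp (Ci * phi) in
  column_ok phi alpha beta tau (e * alpha) (e * - Cconj beta) 1 /\
  column_ok phi alpha beta tau (e * beta) (e * Cconj alpha) (-1).
Proof.
intros Hphi Hn Htau e. unfold e. rewrite cexp_Ci.
destruct (eta_values alpha beta Hn) as (h & (Q1 & Q2 & Q3 & Q4 & Q5) & E11 & E12 & E21 & E22).
set (q := sqrt (1 - Re alpha ^ 2)) in *.
assert (Hn' : (Re alpha * Re alpha + Im alpha * Im alpha + Re beta * Re beta + Im beta * Im beta = 1)%R).
{ rewrite !Cmod2_alt in Hn. lra. }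
destruct (eigen_pair (Re alpha) (Im alpha) q h beta Q1 Hn' Q2 Q3 Q4 Q5 (cos phi, sin phi)) as (P1 & P2 & P3 & P4).
(* The hypotheses are invariant under a simultaneous change of sign of [q] and [h], which yields the
   other eigenvalue. *)
destruct (eigen_pair (Re alpha) (Im alpha) (- q) (- h) beta) with (e := (cos phi, sin phi) : C) as (N1 & N2 & N3 & N4);
  [lra | lra | lra | lra | lra | lra |].
assert (Ea : alpha = Re alpha + Ci * Im alpha) by (apply injective_projections; unfold Re, Im; simpl; ring).
assert (Ea' : Cconj alpha = Re alpha - Ci * Im alpha) by (apply injective_projections; unfold Re, Im; simpl; ring).
rewrite !RtoC_opp in N1, N2, N3, N4.
assert (T1 : Theta (1 * 1) = 1%R) by (unfold Theta; destruct (Rlt_dec 0 (1 * 1)); lra).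
assert (T2 : Theta (1 * -1) = 0%R) by (unfold Theta; destruct (Rlt_dec 0 (1 * -1)); lra).
assert (T3 : Theta (-1 * 1) = 0%R) by (unfold Theta; destruct (Rlt_dec 0 (-1 * 1)); lra).
assert (T4 : Theta (-1 * -1) = 1%R) by (unfold Theta; destruct (Rlt_dec 0 (-1 * -1)); lra).
rewrite <- Ea, <- Ea' in *.
destruct Htau as [-> | ->]; split; apply column_row; auto; fold q;
  rewrite ?T1, ?T2, ?T3, ?T4, ?E11, ?E12, ?E21, ?E22.
- etransitivity; [| etransitivity; [exact P1 |]]; ring.
- etransitivity; [| etransitivity; [exact N1 |]]; ring.
- etransitivity; [| etransitivity; [exact P2 |]]; ring.
- etransitivity; [| etransitivity; [exact N2 |]]; ring.
- etransitivity; [| etransitivity; [exact P3 |]]; ring.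
- etransitivity; [| etransitivity; [exact N3 |]]; ring.
- etransitivity; [| etransitivity; [exact P4 |]]; ring.
- etransitivity; [| etransitivity; [exact N4 |]]; ring.
Qed.

(** * The solution *)

(** The polar angle is the arctangent of the slope [Im z / Re z]; on the wedge [Re z = 0] forces
    [z = 0]. *)
Lemma wedge_sector (a : R) (z : C) : (0 < a < PI / 2)%R -> wedge a z -> sector a z.
Proof.
intros Ha Hz. destruct (acute_pos a Ha) as [Hc Hs]. pose proof (wedge_Re a z Ha Hz) as Hr.
destruct Hz as [Hi Hle]. destruct (Req_dec_T (Re z) 0) as [E | E].
- assert (Ei : Im z = 0%R) by (rewrite E in Hle; nra).
  exists 0%R, 0%R. split; [lra | split; [lra |]].
  rewrite Cmult_0_l. apply injective_projections; [exact E | exact Ei].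
- set (u := (Im z / Re z)%R).
  assert (Hu : (0 <= u)%R) by (unfold u; apply Rdiv_le_0_compat; lra).
  assert (Hta : (u <= tan a)%R).
  { unfold u, tan. apply Rmult_le_reg_r with (Re z * cos a)%R; [nra |].
    replace (Im z / Re z * (Re z * cos a))%R with (Im z * cos a)%R by (field; exact E).
    replace (sin a / cos a * (Re z * cos a))%R with (Re z * sin a)%R by (field; lra). exact Hle. }
  set (w := sqrt (1 + u ^ 2)).
  assert (Hw : (0 < w)%R) by (apply sqrt_lt_R0; nra).
  exists (Re z * w)%R, (atan u). split; [apply Rmult_le_pos; lra |]. split.
  + split.
    * rewrite <- atan_0. destruct Hu as [Hu | <-]; [left; now apply atan_increasing | lra].
    * rewrite <- (atan_tan a) by lra.
      destruct Hta as [Hta | ->]; [left; now apply atan_increasing | lra].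
  + rewrite cexp_Ci, cos_atan, sin_atan. unfold Rsqr.
    replace (1 + u * u)%R with (1 + u ^ 2)%R by ring. fold w.
    apply injective_projections; unfold Re, Im in *; simpl.
    * field. lra.
    * unfold u. field. split; lra.
Qed.

(** With [s = -1] the negative half line, and with it the sector [- S], is reflected onto the
    positive one. *)
Definition signed (F : C -> C) (s : R) : C -> C := fun z => F (RtoC s * z).

Lemma is_derive_C_signed (F : C -> C) (s : R) (z l : C) :
  is_derive_C F (RtoC s * z) l -> is_derive_C (signed F s) z (RtoC s * l).
Proof.
intros H. apply (is_derive_C_comp F (fun z => RtoC s * z)); [exact H |].
pose proof (is_derive_C_scal (RtoC s) (fun z => z) z 1 (is_derive_C_id z)) as D.
replace (RtoC s * 1) with (RtoC s) in D by ring. exact D.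
Qed.

Lemma is_RInt_gen_reflect (g : R -> C) (l : C) :
  is_I (fun y => g (- y)%R) l ->
  is_RInt_gen (V := C_R_NormedModule) g (Rbar_locally m_infty) (at_point 0) l.
Proof.
intros H P HP. destruct (H P HP) as [Q1 Q2 H1 [M HM] HQ].
refine (Filter_prod _ _ _ (fun a => (a < - M)%R) (fun b => b = 0%R) _ _ _).
- exists (- M)%R. auto.
- reflexivity.
- intros a b Ha ->. destruct (HQ 0%R (- a)%R H1 (HM (- a)%R ltac:(lra))) as [y [Hy1 Hy2]].
  simpl in Hy1. exists y. split; [| exact Hy2]. simpl.
  assert (Hy3 : is_CInt (fun y => g (- y)%R) (- 0) (- a) y) by (rewrite Ropp_0; exact Hy1).
  apply (is_RInt_comp_opp (V := C_R_NormedModule)) in Hy3.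
  apply (is_RInt_swap (V := C_R_NormedModule)) in Hy3.
  apply (is_RInt_opp (V := C_R_NormedModule)) in Hy3.
  rewrite opp_opp in Hy3. revert Hy3. apply is_RInt_ext.
  intros x _. rewrite opp_opp, Ropp_involutive. reflexivity.
Qed.

Definition pm1 (s : R) : Prop := (s = 1 \/ s = -1)%R.

Lemma pm1_cases (s : R) : pm1 s -> forall X, (0 < X)%R ->
  Rabs (s * X) = X /\ sign (s * X) = s.
Proof.
intros [-> | ->] X HX.
- rewrite Rmult_1_l, Rabs_pos_eq, sign_eq_1 by lra. auto.
- replace (-1 * X)%R with (- X)%R by ring. rewrite Rabs_Ropp, Rabs_pos_eq, sign_eq_m1 by lra. auto.
Qed.

Lemma eta_scale (alpha beta : C) (s u X y : R) : pm1 s -> pm1 u -> (0 < X)%R -> (0 < y)%R ->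
  eta alpha beta (s * X) (u * y) = eta alpha beta s u.
Proof.
intros Hs Hu HX Hy. unfold eta. destruct (Req_dec_T _ _); [reflexivity |]. f_equal.
destruct Hs as [-> | ->], Hu as [-> | ->];
  repeat match goal with |- context [Rlt_dec ?a ?b] => destruct (Rlt_dec a b) end;
  try reflexivity; lra.
Qed.

Lemma scale_product (s u X y : R) : pm1 s -> pm1 u -> (0 < X)%R -> (0 < y)%R ->
  Theta (s * X * (u * y)) = Theta (s * u) /\
  Theta (- (s * X * (u * y))) = Theta (- (s * u)) /\
  sign (s * X * (u * y)) = sign (s * u).
Proof.
intros Hs Hu HX Hy. assert (HXy : (0 < X * y)%R) by now apply Rmult_lt_0_compat.
assert (Hsu : (s * u = 1 \/ s * u = -1)%R) by (destruct Hs as [-> | ->], Hu as [-> | ->]; lra).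
replace (s * X * (u * y))%R with (s * u * (X * y))%R by ring.
unfold Theta. destruct Hsu as [-> | ->].
- rewrite !sign_eq_1 by lra.
  repeat match goal with |- context [Rlt_dec ?a ?b] => destruct (Rlt_dec a b) end; repeat split; lra.
- rewrite !sign_eq_m1 by lra.
  repeat match goal with |- context [Rlt_dec ?a ?b] => destruct (Rlt_dec a b) end; repeat split; lra.
Qed.

(** All of [G] except the free kernel [k(t, x - y)], which is kept apart because its argument
    becomes [X - y] or [X + y] according to the relative sign. *)
Definition kbase (phi : R) (alpha beta : C) (s u : R) : kexpr :=
  Kadd (Kadd (Kscal (mu_plus phi alpha beta s u) (KE (omega_plus phi alpha)))
             (Kscal (mu_minus phi alpha beta s u) (KE (omega_minus phi alpha))))
       (Kscal (mu_zero phi alpha beta s u) KK).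

Lemma green_kval (phi : R) (alpha beta : C) (t s u X y : R) :
  pm1 s -> pm1 u -> (0 < X)%R -> (0 < y)%R ->
  green phi alpha beta t (s * X) (u * y) =
  kval (kbase phi alpha beta s u) t (RtoC X + RtoC y) + kern t (RtoC (s * X) - RtoC (u * y)).
Proof.
intros Hs Hu HX Hy. unfold green.
destruct (pm1_cases s Hs X HX) as [-> _]. destruct (pm1_cases u Hu y Hy) as [-> _].
destruct (scale_product s u X y Hs Hu HX Hy) as (E1 & E2 & E3).
unfold mu_plus, mu_minus, mu_zero. rewrite E1, E2, E3, (eta_scale alpha beta s u X y Hs Hu HX Hy).
fold (mu_plus phi alpha beta s u). fold (mu_minus phi alpha beta s u).
fold (mu_zero phi alpha beta s u).
rewrite RtoC_plus. unfold kbase, kval, ekern, kern. ring.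
Qed.

Lemma gaussian_kbase (a phi : R) (alpha beta : C) (s u : R) :
  (0 < a < PI / 2)%R -> gaussian_bounded a (kbase phi alpha beta s u).
Proof.
intros Ha. unfold kbase.
repeat apply gaussian_Kadd; apply gaussian_Kscal; auto using gaussian_KE, gaussian_KK.
Qed.

(** The solution on the half line of sign [s], at distance [X] from the origin,
    with [o] applied to the kernels.  As [X] enters the free kernel with a minus
    sign, each differentiation in [X] flips the sign of [c]. *)
Definition wave (phi : R) (alpha beta : C) (a : R) (F : C -> C)
  (o : kexpr -> kexpr) (c : C) (s t X : R) : C :=
  Tint a (signed F s) (o (kbase phi alpha beta s s)) t X +
  c * Tint a (signed F s) (o KK) t (- X) +
  Tint a (signed F (- s)) (o (Kadd (kbase phi alpha beta s (- s)) KK)) t X.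

(** As [kern] is even, [y] on the side of [x] contributes the free kernel at [y - X] and [y] on the
    other side the one at [X + y]; each half is then rotated by [Tint_contour]. *)
Lemma Psi_wave (phi : R) (alpha beta : C) (a A B : R) (F : C -> C) (s t X : R) :
  (0 < a < PI / 2)%R -> (0 <= B)%R -> (forall s, pm1 s -> admissible a A B (signed F s)) ->
  pm1 s -> (0 < t)%R -> (0 < X)%R ->
  ex_improper_RInt (fun y : R => green phi alpha beta t (s * X) y * F (RtoC y)) /\
  Psi phi alpha beta F t (s * X) = wave phi alpha beta a F (fun e => e) 1 s t X.
Proof.
intros Ha HB HF Hs Ht HX.
assert (Hs' : pm1 (- s)) by (unfold pm1 in *; lra).
set (h := fun y : R => green phi alpha beta t (s * X) y * F (RtoC y)).
set (L1 := Tint a (signed F s) (kbase phi alpha beta s s) t X + Tint a (signed F s) KK t (- X)).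
set (L2 := Tint a (signed F (- s)) (Kadd (kbase phi alpha beta s (- s)) KK) t X).
assert (H1 : is_I (fun y => h (s * y)%R) L1).
{ pose proof (is_I_plus _ _ _ _
    (Tint_contour a A B _ _ t X Ha HB (HF s Hs) (gaussian_kbase a phi alpha beta s s Ha) Ht)
    (Tint_contour a A B _ _ t (- X) Ha HB (HF s Hs) (gaussian_KK a) Ht)) as H.
  revert H. apply is_I_ext. intros y Hy. unfold h, signed.
  rewrite (green_kval phi alpha beta t s s X y Hs Hs HX Hy), (RtoC_mult s y).
  replace (kern t (RtoC (s * X) - RtoC s * y)) with (kval KK t (RtoC (- X) + y)); [ring |].
  simpl. rewrite RtoC_opp, RtoC_mult.
  destruct Hs as [-> | ->].
  - rewrite <- kern_even. f_equal. ring.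
  - rewrite RtoC_m1. f_equal. ring. }
assert (H2 : is_I (fun y => h (- s * y)%R) L2).
{ assert (G : gaussian_bounded a (Kadd (kbase phi alpha beta s (- s)) KK)).
  { apply gaussian_Kadd; [now apply gaussian_kbase | apply gaussian_KK]. }
  pose proof (Tint_contour a A B _ _ t X Ha HB (HF (- s)%R Hs') G Ht) as H.
  revert H. apply is_I_ext. intros y Hy. unfold h, signed.
  rewrite (green_kval phi alpha beta t s (- s) X y Hs Hs' HX Hy), (RtoC_mult (- s) y).
  replace (kern t (RtoC (s * X) - RtoC (- s) * y)) with (kval KK t (RtoC X + y)); [reflexivity |].
  simpl. rewrite RtoC_opp, RtoC_mult.
  destruct Hs as [-> | ->].
  - f_equal. ring.
  - rewrite <- kern_even, RtoC_m1. f_equal. ring. }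
assert (W : wave phi alpha beta a F (fun e => e) 1 s t X = L1 + L2) by (unfold wave, L1, L2; ring).
rewrite W. unfold ex_improper_RInt, Psi, improper_RInt. fold h.
destruct Hs as [-> | ->].
- assert (R1 : is_I h L1) by (revert H1; apply is_I_ext; intros; now rewrite Rmult_1_l).
  assert (R2 : is_RInt_gen (V := C_R_NormedModule) h (Rbar_locally m_infty) (at_point 0) L2).
  { apply is_RInt_gen_reflect. revert H2. apply is_I_ext. intros y _. f_equal. ring. }
  split; [split; eexists; eassumption |].
  rewrite (is_I_unique _ _ R1), (is_RInt_gen_unique (V := CV) h _ R2). ring.
- assert (R1 : is_I h L2).
  { revert H2; apply is_I_ext; intros; f_equal. ring. }
  assert (R2 : is_RInt_gen (V := C_R_NormedModule) h (Rbar_locally m_infty) (at_point 0) L1).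
  { apply is_RInt_gen_reflect. revert H1. apply is_I_ext. intros y _. f_equal. ring. }
  split; [split; eexists; eassumption |].
  rewrite (is_I_unique _ _ R1), (is_RInt_gen_unique (V := CV) h _ R2). ring.
Qed.

Lemma is_derive_RC_wave (phi : R) (alpha beta : C) (a A B : R) (F : C -> C)
  (o : kexpr -> kexpr) (c : C) (s t X : R) :
  (0 < a < PI / 2)%R -> (0 <= B)%R -> (forall s, pm1 s -> admissible a A B (signed F s)) ->
  pm1 s -> (0 < t)%R ->
  is_derive_RC (wave phi alpha beta a F o c s t) X
    (wave phi alpha beta a F (fun e => kdr (o e)) (- c) s t X).
Proof.
intros Ha HB HF Hs Ht. assert (Hs' : pm1 (- s)) by (unfold pm1 in *; lra). unfold wave.
apply is_derive_RC_plus; [apply is_derive_RC_plus |].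
- now apply (is_derive_RC_Tint a A B); auto.
- replace (- c * Tint a (signed F s) (kdr (o KK)) t (- X))
    with (c * (RtoC (-1) * Tint a (signed F s) (kdr (o KK)) t (- X))).
  + apply is_derive_RC_scal. apply (is_derive_RC_comp_R (Tint a (signed F s) (o KK) t) (fun X => - X)%R).
    * apply (is_derive_RC_Tint a A B); auto.
    * auto_derive; [auto | ring].
  + rewrite RtoC_m1. ring.
- now apply (is_derive_RC_Tint a A B); auto.
Qed.

Lemma is_derive_RC_wave_t (phi : R) (alpha beta : C) (a A B : R) (F : C -> C)
  (o : kexpr -> kexpr) (c : C) (s t X : R) :
  (0 < a < PI / 2)%R -> (0 <= B)%R -> (forall s, pm1 s -> admissible a A B (signed F s)) ->
  pm1 s -> (0 < t)%R ->
  is_derive_RC (fun t => wave phi alpha beta a F o c s t X) t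
    (wave phi alpha beta a F (fun e => kdt (o e)) c s t X).
Proof.
intros Ha HB HF Hs Ht. assert (Hs' : pm1 (- s)) by (unfold pm1 in *; lra). unfold wave.
apply is_derive_RC_plus; [apply is_derive_RC_plus; [| apply is_derive_RC_scal] |];
  apply (is_derive_RC_Tint_t a A B); auto.
Qed.

(** * Equation, initial value and boundary values of the waves *)

Definition schrodinger_kexpr (e : kexpr) : Prop :=
  forall t r, (0 < t)%R -> kval (kdt e) t r = Ci * kval (kdr (kdr e)) t r.

Lemma schrodinger_Kadd (e1 e2 : kexpr) :
  schrodinger_kexpr e1 -> schrodinger_kexpr e2 -> schrodinger_kexpr (Kadd e1 e2).
Proof. intros H1 H2 t r Ht. simpl. rewrite H1, H2 by exact Ht. ring. Qed.

Lemma schrodinger_Kscal (c : C) (e : kexpr) :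
  schrodinger_kexpr e -> schrodinger_kexpr (Kscal c e).
Proof. intros H t r Ht. simpl. rewrite H by exact Ht. ring. Qed.

Lemma schrodinger_kbase (phi : R) (alpha beta : C) (s u : R) :
  schrodinger_kexpr (kbase phi alpha beta s u).
Proof.
unfold kbase. repeat apply schrodinger_Kadd; apply schrodinger_Kscal.
- intros t r Ht. now apply ekern_schrodinger.
- intros t r Ht. now apply ekern_schrodinger.
- intros t r Ht. now apply kern_schrodinger.
Qed.

Lemma wave_schrodinger (phi : R) (alpha beta : C) (a A B : R) (F : C -> C) (s t X : R) :
  (0 < a < PI / 2)%R -> (0 <= B)%R -> (forall s, pm1 s -> admissible a A B (signed F s)) ->
  pm1 s -> (0 < t)%R ->
  Ci * wave phi alpha beta a F kdt 1 s t X = - wave phi alpha beta a F (fun e => kdr (kdr e)) 1 s t X.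
Proof.
intros Ha HB HF Hs Ht. assert (Hs' : pm1 (- s)) by (unfold pm1 in *; lra). unfold wave.
assert (T : forall u e Y, pm1 u -> schrodinger_kexpr e ->
  Tint a (signed F u) (kdt e) t Y = Ci * Tint a (signed F u) (kdr (kdr e)) t Y).
{ intros u e Y Hu He. rewrite <- (Tint_scal a A B) by auto. apply Tint_ext. intros r. now apply He. }
assert (SK : schrodinger_kexpr KK) by (intros t' r Ht'; now apply kern_schrodinger).
rewrite !T; auto using schrodinger_kbase, schrodinger_Kadd.
set (x1 := Tint _ _ _ _ _). set (x2 := Tint _ _ _ _ _). set (x3 := Tint _ _ _ _ _).
transitivity (Ci * Ci * (x1 + x2 + x3)); [ring |]. rewrite Ci_sqr. ring.
Qed.

(** Only the free kernel on the half line containing [x] meets its singularity; the arguments of all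
    other kernels stay at distance at least [X] from it. *)
Lemma wave_initial (phi : R) (alpha beta : C) (a A B : R) (F : C -> C) (s X y : R) :
  (0 < a < PI / 2)%R -> (0 <= B)%R -> (forall s, pm1 s -> admissible a A B (signed F s)) ->
  pm1 s -> (0 < X)%R -> (0 < y)%R ->
  (forall u, (- X <= Re u <= X)%R -> (- y <= Im u <= y)%R -> exists l, is_derive_C F u l) ->
  sqrt_close (fun t => wave phi alpha beta a F (fun e => e) 1 s t X) (F (RtoC (s * X))).
Proof.
intros Ha HB HF Hs HX Hy Hd. assert (Hs' : pm1 (- s)) by (unfold pm1 in *; lra).
assert (Zb : forall u v, pm1 u -> sqrt_close (fun t => Tint a (signed F u) (kbase phi alpha beta s v) t X) 0).
{ intros u v Hu.
  pose proof (sqrt_close_plus _ _ _ _ (sqrt_close_plus _ _ _ _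
    (sqrt_close_scal (mu_plus phi alpha beta s v) _ _ (Tint_initial_KE a A B _ (omega_plus phi alpha) X Ha HB (HF u Hu) HX))
    (sqrt_close_scal (mu_minus phi alpha beta s v) _ _ (Tint_initial_KE a A B _ (omega_minus phi alpha) X Ha HB (HF u Hu) HX)))
    (sqrt_close_scal (mu_zero phi alpha beta s v) _ _ (Tint_initial_KK a A B _ X Ha HB (HF u Hu) HX))) as H.
  rewrite !Cmult_0_r, !Cplus_0_r in H. revert H. apply sqrt_close_ext. intros t Ht.
  unfold kbase. rewrite !(Tint_add a A B), !(Tint_scal a A B) by auto. reflexivity. }
assert (Main : sqrt_close (fun t => Tint a (signed F s) KK t (- X)) (signed F s (RtoC X))).
{ apply (Tint_initial_main a A B _ X y); auto.
  intros u Hu1 Hu2. destruct (Hd (RtoC s * u)) as [l Hl].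
  - unfold Re in *; simpl. destruct Hs as [-> | ->]; lra.
  - unfold Im in *; simpl. destruct Hs as [-> | ->]; lra.
  - eexists. apply is_derive_C_signed. exact Hl. }
pose proof (sqrt_close_plus _ _ _ _ (sqrt_close_plus _ _ _ _ (Zb s s Hs) Main)
  (sqrt_close_plus _ _ _ _ (Zb (- s)%R (- s)%R Hs') (Tint_initial_KK a A B _ X Ha HB (HF (- s)%R Hs') HX))) as H.
cbv beta in H.
replace (0 + signed F s (RtoC X) + (0 + 0)) with (F (RtoC (s * X))) in H
  by (unfold signed; rewrite RtoC_mult; ring).
revert H. apply sqrt_close_ext. intros t Ht. unfold wave. rewrite (Tint_add a A B) by auto. ring.
Qed.

(** [U] is the value and [V] the outward derivative at the origin contributed by the [y] of sign
    [tau]. The four integrals are arbitrary numbers here: the identities of [column_ok] match the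
    coefficients of [p], [m], [k] and [k'] one by one. *)
Lemma column_bc (phi : R) (alpha beta : C) (tau : R) (j1 j2 : C) (s : R) (p m k k' : C) :
  column_ok phi alpha beta tau j1 j2 s ->
  let U := fun x : R => mu_plus phi alpha beta x tau * p + mu_minus phi alpha beta x tau * m +
    (mu_zero phi alpha beta x tau + 1) * k in
  let V := fun x : R => mu_plus phi alpha beta x tau * (omega_plus phi alpha * p - 2 * k) +
    mu_minus phi alpha beta x tau * (omega_minus phi alpha * m - 2 * k) +
    (mu_zero phi alpha beta x tau - x * tau) * k' in
  U s - (j1 * U 1%R + j2 * U (-1)%R) = Ci * (V s + (j1 * V 1%R + j2 * V (-1)%R)).
Proof.
intros (H1 & H2 & H3 & H4) U V. unfold U, V, bc_row in *. clear U V.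
rewrite RtoC_m1.
set (mp := mu_plus phi alpha beta) in *. set (mm := mu_minus phi alpha beta) in *.
set (m0 := mu_zero phi alpha beta) in *.
transitivity ((mp s tau - (j1 * mp 1%R tau + j2 * mp (-1)%R tau)) * p +
  (mm s tau - (j1 * mm 1%R tau + j2 * mm (-1)%R tau)) * m +
  ((m0 s tau + 1) - (j1 * (m0 1%R tau + 1) + j2 * (m0 (-1)%R tau + 1))) * k); [ring |].
rewrite H1, H2, H3.
(* The term [0 * k'] makes room for the fourth identity, by which the coefficient of [k']
   vanishes. *)
transitivity (Ci * ((mp s tau * (omega_plus phi alpha * p - 2 * k) + mm s tau * (omega_minus phi alpha * m - 2 * k)
   + (j1 * (mp 1%R tau * (omega_plus phi alpha * p - 2 * k) + mm 1%R tau * (omega_minus phi alpha * m - 2 * k))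
   + j2 * (mp (-1)%R tau * (omega_plus phi alpha * p - 2 * k) + mm (-1)%R tau * (omega_minus phi alpha * m - 2 * k))))
   + 0 * k')); [ring |].
rewrite <- H4. ring.
Qed.

Lemma Tint_kbase_dr (a A B phi : R) (alpha beta : C) (f : C -> C) (s u t X : R) :
  (0 < a < PI / 2)%R -> (0 <= B)%R -> admissible a A B f -> (0 < t)%R ->
  Tint a f (kbase phi alpha beta s u) t X =
    mu_plus phi alpha beta s u * Tint a f (KE (omega_plus phi alpha)) t X +
    mu_minus phi alpha beta s u * Tint a f (KE (omega_minus phi alpha)) t X +
    mu_zero phi alpha beta s u * Tint a f KK t X /\
  Tint a f (kdr (kbase phi alpha beta s u)) t X =
    mu_plus phi alpha beta s u *
      (omega_plus phi alpha * Tint a f (KE (omega_plus phi alpha)) t X - 2 * Tint a f KK t X) +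
    mu_minus phi alpha beta s u *
      (omega_minus phi alpha * Tint a f (KE (omega_minus phi alpha)) t X - 2 * Tint a f KK t X) +
    mu_zero phi alpha beta s u * Tint a f (kdr KK) t X.
Proof.
intros Ha HB Hf Ht. unfold kbase. cbn [kdr].
rewrite !(Tint_add a A B), !(Tint_scal a A B), !(Tint_add a A B), !(Tint_scal a A B) by auto.
rewrite RtoC_m2. split; ring.
Qed.

(** At [X = 0] both sides of the origin see the same integrals, and [s] enters through coefficients
    only. The terms are regrouped by the sign of [y], instead of same or opposite side, to form the
    columns of [column_bc]. *)
Lemma wave_origin (phi : R) (alpha beta : C) (a A B : R) (F : C -> C) (s t : R) :
  (0 < a < PI / 2)%R -> (0 <= B)%R -> (forall s, pm1 s -> admissible a A B (signed F s)) ->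
  pm1 s -> (0 < t)%R ->
  let p := fun u => Tint a (signed F u) (KE (omega_plus phi alpha)) t 0 in
  let m := fun u => Tint a (signed F u) (KE (omega_minus phi alpha)) t 0 in
  let k := fun u => Tint a (signed F u) KK t 0 in
  let k' := fun u => Tint a (signed F u) (kdr KK) t 0 in
  let U := fun u : R => mu_plus phi alpha beta s u * p u + mu_minus phi alpha beta s u * m u +
    (mu_zero phi alpha beta s u + 1) * k u in
  let V := fun u : R => mu_plus phi alpha beta s u * (omega_plus phi alpha * p u - 2 * k u) +
    mu_minus phi alpha beta s u * (omega_minus phi alpha * m u - 2 * k u) +
    (mu_zero phi alpha beta s u - s * u) * k' u in
  wave phi alpha beta a F (fun e => e) 1 s t 0 = U 1%R + U (-1)%R /\
  wave phi alpha beta a F kdr (- (1)) s t 0 = V 1%R + V (-1)%R.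
Proof.
intros Ha HB HF Hs Ht p m k k' U V.
assert (Hs' : pm1 (- s)) by (unfold pm1 in *; lra).
assert (W : wave phi alpha beta a F (fun e => e) 1 s t 0 = U s + U (- s)%R /\
  wave phi alpha beta a F kdr (- (1)) s t 0 = V s + V (- s)%R).
{ unfold wave. rewrite Ropp_0.
  change (kdr (Kadd (kbase phi alpha beta s (- s)) KK)) with (Kadd (kdr (kbase phi alpha beta s (- s))) (kdr KK)).
  rewrite !(Tint_add a A B _ _ KK), (Tint_add a A B _ _ (kdr KK)) by auto.
  destruct (Tint_kbase_dr a A B phi alpha beta _ s s t 0 Ha HB (HF s Hs) Ht) as [-> ->].
  destruct (Tint_kbase_dr a A B phi alpha beta _ s (- s) t 0 Ha HB (HF (- s)%R Hs') Ht) as [-> ->].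
  assert (S2 : RtoC s * s = 1) by (rewrite <- RtoC_mult; f_equal; destruct Hs as [-> | ->]; ring).
  unfold U, V, p, m, k, k'. rewrite RtoC_opp. split; [ring |].
  replace (s * - RtoC s) with (- (RtoC s * s)) by ring. rewrite S2. ring. }
destruct W as [-> ->].
destruct Hs as [-> | ->]; [split; reflexivity |].
replace (- (-1))%R with 1%R by ring. split; ring.
Qed.

(** Unlike [sign], this takes only the values 1 and -1; the value at [0] never matters. *)
Definition sgn (x : R) : R := if Rlt_dec 0 x then 1%R else (-1)%R.

Lemma sgn_spec (x : R) : x <> 0%R ->
  pm1 (sgn x) /\ (0 < Rabs x)%R /\ x = (sgn x * Rabs x)%R.
Proof.
intros Hx. split; [| split; [now apply Rabs_pos_lt |]].
- unfold sgn, pm1. destruct (Rlt_dec 0 x); auto.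
- unfold sgn. destruct (Rlt_dec 0 x).
  + rewrite Rabs_pos_eq by lra. ring.
  + rewrite Rabs_left by lra. ring.
Qed.

Lemma sgn_locally (x : R) : x <> 0%R ->
  locally (T := R_UniformSpace) x (fun y => y <> 0%R /\ sgn y = sgn x /\ Rabs y = (sgn x * y)%R).
Proof.
intros Hx. exists (mkposreal (Rabs x) (Rabs_pos_lt x Hx)). intros y Hy.
change (Rabs (y - x) < Rabs x)%R in Hy. revert Hy. unfold sgn, Rabs.
destruct (Rcase_abs (y - x)), (Rcase_abs x), (Rcase_abs y), (Rlt_dec 0 x), (Rlt_dec 0 y);
  intros; repeat split; lra.
Qed.

Lemma is_derive_RC_even (H : R -> R -> C) (x : R) (l : C) : x <> 0%R ->
  is_derive_RC (H (sgn x)) (Rabs x) l ->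
  is_derive_RC (fun y => H (sgn y) (Rabs y)) x (sgn x * l).
Proof.
intros Hx Hl.
apply (is_derive_ext_loc (V := C_R_NormedModule) (fun y => H (sgn x) (sgn x * y)%R)).
- generalize (sgn_locally x Hx). apply filter_imp. intros y (_ & E1 & E2). now rewrite E1, E2.
- destruct (sgn_locally x Hx) as [d Hd]. destruct (Hd x (ball_center x d)) as (_ & _ & E).
  apply (is_derive_RC_comp_R (H (sgn x)) (fun y => (sgn x * y)%R)); [now rewrite <- E |].
  auto_derive; [auto | ring].
Qed.

Lemma tends_right (g h : R -> C) : ccont h 0 -> (forall x, (0 < x)%R -> g x = h x) ->
  tends_to g (at_right 0) (h 0%R).
Proof.
intros Hh E. apply filterlim_C_eps; [typeclasses eauto |]. intros eps.
destruct (proj1 (ccont_eps h 0) Hh eps) as [d Hd]. exists d. intros x Hx Hx0.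
rewrite E by exact Hx0. apply Hd. exact Hx.
Qed.

Lemma tends_left (g h : R -> C) : ccont h 0 -> (forall x, (x < 0)%R -> g x = h (- x)%R) ->
  tends_to g (at_left 0) (h 0%R).
Proof.
intros Hh E. apply filterlim_C_eps; [typeclasses eauto |]. intros eps.
destruct (proj1 (ccont_eps h 0) Hh eps) as [d Hd]. exists d. intros x Hx Hx0.
rewrite E by exact Hx0. apply Hd. change (Rabs (x - 0) < d)%R in Hx.
replace (- x - 0)%R with (- (x - 0))%R by ring. now rewrite Rabs_Ropp.
Qed.

Lemma bc_matrix (e a b c d u v x y : C) :
  u - (e * a * u + e * b * v) = Ci * (x + (e * a * x + e * b * y)) ->
  v - (e * c * u + e * d * v) = Ci * (y + (e * c * x + e * d * y)) ->
  Mmult (minus Mone (Mscal e (mat2 a b c d))) (col2 u v) =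
  Mmult (Mscal Ci (plus Mone (Mscal e (mat2 a b c d)))) (col2 x y).
Proof.
intros H1 H2.
unfold Mmult, minus, Mone, Mscal, mat2, col2, plus, opp, coeff_mat, mk_matrix. cbn.
f_equal; f_equal; [| f_equal].
- transitivity (u - (e * a * u + e * b * v)); [ring |]. rewrite H1. ring.
- transitivity (v - (e * c * u + e * d * v)); [ring |]. rewrite H2. ring.
Qed.

Theorem theorem4p4
  (J : @matrix C 2 2) (phi : R) (alpha beta : C)
  (HJ : unitary J) (HJp : J_params J phi alpha beta)
  (alpha0 : R) (Halpha0 : (0 < alpha0 < PI / 2)%R)
  (Omega : C -> Prop) (HOmega : open (T := C_UniformSpace) Omega)
  (HS : forall z : C, double_sector alpha0 z -> Omega z)
  (F : C -> C) (HF : holomorphic_on Omega F)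
  (A B : R) (HA : (0 <= A)%R) (HB : (0 <= B)%R)
  (Hgrowth : forall z : C, double_sector alpha0 z ->
     (Cmod (F z) <= A * exp (B * Rabs (Im z)))%R) :
  (forall t x : R, (0 < t)%R -> x <> 0%R ->
     ex_improper_RInt (fun y : R => (green phi alpha beta t x y * F (RtoC y))%C)) /\
  schrodinger_point_interaction J (fun x : R => F (RtoC x))
    (Psi phi alpha beta F).
Proof.
destruct HJp as (Hphi & Hnorm & HJe).
assert (Copp2 : forall z : C, - - z = z) by (intros; ring).
assert (Hder : forall z, Omega z -> exists l, is_derive_C F z l).
{ intros z Hz. destruct (HF z Hz) as [l Hl]. now exists l. }
assert (Hdouble : forall s z, pm1 s -> wedge alpha0 z -> double_sector alpha0 (RtoC s * z)).
{ intros s z [-> | ->] Hz.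
  - left. rewrite Cmult_1_l. now apply wedge_sector.
  - right. replace (- (RtoC (-1) * z)) with z by (apply injective_projections; simpl; ring).
    now apply wedge_sector. }
assert (Hadm : forall s, pm1 s -> admissible alpha0 A B (signed F s)).
{ intros s Hs. split.
  - intros z Hz. destruct (Hder _ (HS _ (Hdouble s z Hs Hz))) as [l Hl].
    eexists. apply is_derive_C_signed. exact Hl.
  - intros z Hz. unfold signed. eapply Rle_trans; [apply Hgrowth; now apply Hdouble |].
    right. f_equal. f_equal. f_equal. destruct Hz as [Hz _].
    replace (Im (RtoC s * z)) with (s * Im z)%R by (unfold Im; simpl; ring).
    rewrite Rabs_mult, (Rabs_pos_eq (Im z)) by exact Hz.
    destruct Hs as [-> | ->]; [rewrite Rabs_R1 | rewrite Rabs_left by lra]; ring. }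
pose (w := fun o c s t X => wave phi alpha beta alpha0 F o c s t X).
assert (HPsi : forall t x, (0 < t)%R -> x <> 0%R ->
  ex_improper_RInt (fun y : R => green phi alpha beta t x y * F (RtoC y)) /\
  Psi phi alpha beta F t x = w (fun e => e) (RtoC 1) (sgn x) t (Rabs x)).
{ intros t x Ht Hx. destruct (sgn_spec x Hx) as (Hs & HX & E).
  pose proof (Psi_wave phi alpha beta alpha0 A B F (sgn x) t (Rabs x) Halpha0 HB Hadm Hs Ht HX) as P.
  rewrite <- E in P. exact P. }
split; [intros t x Ht Hx; now apply HPsi |].
assert (Dx : forall o c s t X, pm1 s -> (0 < t)%R ->
  is_derive_RC (w o c s t) X (w (fun e => kdr (o e)) (- c) s t X)).
{ intros o c s t X Hs Ht. now apply (is_derive_RC_wave phi alpha beta alpha0 A B). }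
(* [w] depends on the distance [|x|], so each derivative in [x] brings a factor [sgn x]: one remains
   in [u_x], two cancel in [u_xx]. Likewise the sign of the free term is [-1] after one derivative
   and [1] after two. *)
exists (fun t x => w kdt (RtoC 1) (sgn x) t (Rabs x)),
  (fun t x => sgn x * w kdr (- RtoC 1) (sgn x) t (Rabs x)),
  (fun t x => w (fun e => kdr (kdr e)) (RtoC 1) (sgn x) t (Rabs x)).
split; [| split].
- intros t x Ht Hx. destruct (sgn_spec x Hx) as (Hs & HX & E). split; [| split; [| split]].
  + apply (is_derive_RC_ext_pos (fun t => w (fun e => e) (RtoC 1) (sgn x) t (Rabs x))); [exact Ht | |].
    * intros t' Ht'. symmetry. now apply HPsi.
    * now apply (is_derive_RC_wave_t phi alpha beta alpha0 A B).
  + apply (is_derive_ext_loc (V := C_R_NormedModule) (fun x => w (fun e => e) (RtoC 1) (sgn x) t (Rabs x))).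
    * generalize (sgn_locally x Hx). apply filter_imp. intros y (Hy & _). symmetry. now apply HPsi.
    * apply (is_derive_RC_even (fun s => w (fun e => e) (RtoC 1) s t)); [exact Hx |]. now apply Dx.
  + replace (w (fun e => kdr (kdr e)) (RtoC 1) (sgn x) t (Rabs x))
      with (RtoC (sgn x) * (RtoC (sgn x) * w (fun e => kdr (kdr e)) (- - RtoC 1) (sgn x) t (Rabs x))).
    * apply (is_derive_RC_even (fun s X => s * w kdr (- RtoC 1) s t X)); [exact Hx |].
      apply is_derive_RC_scal. now apply Dx.
    * rewrite Copp2. rewrite Cmult_assoc, <- RtoC_mult.
      replace (sgn x * sgn x)%R with 1%R by (destruct Hs as [-> | ->]; ring). ring.
  + now apply (wave_schrodinger phi alpha beta alpha0 A B).
- intros t Ht.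
  assert (Hp : pm1 1) by (left; reflexivity). assert (Hm : pm1 (-1)) by (right; reflexivity).
  (* On the left [d/dx = - d/dX]; this sign cancels the one in the boundary condition, which thus
     involves outward derivatives on both sides. *)
  exists (w (fun e => e) (RtoC 1) 1%R t 0%R), (w (fun e => e) (RtoC 1) (-1)%R t 0%R),
    (w kdr (- RtoC 1) 1%R t 0%R), (- w kdr (- RtoC 1) (-1)%R t 0%R).
  assert (Sp : forall x, (0 < x)%R -> sgn x = 1%R /\ Rabs x = x).
  { intros x Hx. unfold sgn. destruct (Rlt_dec 0 x); [| lra]. rewrite Rabs_pos_eq by lra. auto. }
  assert (Sm : forall x, (x < 0)%R -> sgn x = (-1)%R /\ Rabs x = (- x)%R).
  { intros x Hx. unfold sgn. destruct (Rlt_dec 0 x); [lra |]. rewrite Rabs_left by lra. auto. }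
  assert (Cw : forall o c s, pm1 s -> ccont (w o c s t) 0).
  { intros o c s Hs. eapply is_derive_RC_cont. now apply Dx. }
  split; [| split; [| split; [| split]]].
  + apply (tends_right _ (w (fun e => e) (RtoC 1) 1%R t)); [now apply Cw |].
    intros x Hx. destruct (HPsi t x Ht ltac:(lra)) as [_ ->]. now destruct (Sp x Hx) as [-> ->].
  + apply (tends_left _ (w (fun e => e) (RtoC 1) (-1)%R t)); [now apply Cw |].
    intros x Hx. destruct (HPsi t x Ht ltac:(lra)) as [_ ->]. now destruct (Sm x Hx) as [-> ->].
  + apply (tends_right _ (w kdr (- RtoC 1) 1%R t)); [now apply Cw |].
    intros x Hx. destruct (Sp x Hx) as [-> ->]. apply Cmult_1_l.
  + apply (tends_left _ (fun X => - w kdr (- RtoC 1) (-1)%R t X)).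
    * apply (continuous_opp (V := C_R_NormedModule)). now apply Cw.
    * intros x Hx. destruct (Sm x Hx) as [-> ->].
      rewrite RtoC_m1. ring.
  + rewrite Copp2.
    destruct (wave_origin phi alpha beta alpha0 A B F 1 t Halpha0 HB Hadm Hp Ht) as [U1 V1].
    destruct (wave_origin phi alpha beta alpha0 A B F (-1) t Halpha0 HB Hadm Hm Ht) as [U2 V2].
    destruct (columns_ok phi alpha beta 1 Hphi Hnorm (or_introl eq_refl)) as [Kpp Kpm].
    destruct (columns_ok phi alpha beta (-1) Hphi Hnorm (or_intror eq_refl)) as [Kmp Kmm].
    (* Each half line of [y] satisfies the boundary condition by itself, whatever the values of its
       four integrals; [Sum] adds the two. *)
    pose (K := fun u e => Tint alpha0 (signed F u) e t 0).
    pose proof (fun s j1 j2 u H => column_bc phi alpha beta u j1 j2 s (K u (KE (omega_plus phi alpha)))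
      (K u (KE (omega_minus phi alpha))) (K u KK) (K u (kdr KK)) H) as Col.
    cbv zeta in Col, U1, V1, U2, V2.
    pose proof (Col _ _ _ _ Kpp) as E1. pose proof (Col _ _ _ _ Kmp) as E2.
    pose proof (Col _ _ _ _ Kpm) as E3. pose proof (Col _ _ _ _ Kmm) as E4.
    clear Col Kpp Kpm Kmp Kmm. unfold K in *. unfold w. rewrite U1, V1, U2, V2, HJe.
    assert (Sum : forall j1 j2 u u' u1 u1' u2 u2' v v' v1 v1' v2 v2' : C,
      u - (j1 * u1 + j2 * u2) = Ci * (v + (j1 * v1 + j2 * v2)) ->
      u' - (j1 * u1' + j2 * u2') = Ci * (v' + (j1 * v1' + j2 * v2')) ->
      (u + u') - (j1 * (u1 + u1') + j2 * (u2 + u2')) =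
      Ci * ((v + v') + (j1 * (v1 + v1') + j2 * (v2 + v2')))).
    { intros j1 j2 u u' u1 u1' u2 u2' v v' v1 v1' v2 v2' X1 X2.
      transitivity ((u - (j1 * u1 + j2 * u2)) + (u' - (j1 * u1' + j2 * u2'))); [ring |].
      rewrite X1, X2. ring. }
    apply bc_matrix; apply Sum; assumption.
- intros x Hx. destruct (sgn_spec x Hx) as (Hs & HX & E).
  (* The real interval between [- |x|] and [|x|] lies in the double sector, hence in [Omega]; this
     provides the room below the axis for [left_half]. *)
  destruct (tube Omega (Rabs x) HOmega) as [y [Hy Ht]].
  { intros s Hss. apply HS. destruct (Rle_dec 0 s) as [Hs0 | Hs0].
    - rewrite <- (Cmult_1_l s). apply (Hdouble 1%R); [now left | apply wedge_real; auto].
    - replace (RtoC s) with (RtoC (-1) * RtoC (- s)) by (rewrite <- RtoC_mult; f_equal; ring).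
      apply (Hdouble (-1)%R); [now right | apply wedge_real; auto; lra]. }
  change (tends_to (fun t => Psi phi alpha beta F t x) (at_right 0) (F (RtoC x))).
  replace (F (RtoC x)) with (F (RtoC (sgn x * Rabs x))) by (now rewrite <- E).
  apply sqrt_close_tends.
  apply (sqrt_close_ext (fun t => w (fun e => e) (RtoC 1) (sgn x) t (Rabs x))).
  + intros t Ht'. symmetry. now apply HPsi.
  + apply (wave_initial phi alpha beta alpha0 A B F (sgn x) (Rabs x) y); auto.
Qed.
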